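(* Let $(X_n,y_n)$ be deterministic data with $\limsup_n\ell_{n,1}/\ell_{n,p}<\infty$, and let $S_{m,n}$ be sparse sign embeddings with sparsity $\zeta_m$, where $m,n\to\infty$ and $\zeta_m^2/m\to0$. If $(\sqrt m/\zeta_m)\|\mathrm{vec}(U_n)\|_4^4\to0$ and $(\sqrt m/\zeta_m)\,\|\varepsilon_n\|_4^4/\|\varepsilon_n\|^4\to0$, then with $\hat\Sigma_{m,n}=\|\tilde\varepsilon_{m,n}\|^2(\tilde X_{m,n}^\top\tilde X_{m,n})^{-1}$, $$\sqrt m\,\hat\Sigma_{m,n}^{-1/2}(\hat\beta^{\mathrm s}_{m,n}-\beta_n)\Rightarrow\mathcal N(0,I_p).$$ If $(\sqrt m/\zeta_m)\|\mathrm{vec}(U_n)\|_4^4\to0$ and $(\sqrt m/\zeta_m)\,\|y_n-\varepsilon_n\|_4^4/\|y_n-\varepsilon_n\|^4\to0$, then with $\hat\Sigma^{\mathrm{pa}}_{m,n}=\hat\beta^{\mathrm{pa}\top}_{m,n}\tilde X_{m,n}^\top\tilde X_{m,n}\hat\beta^{\mathrm{pa}}_{m,n}\,(\tilde X_{m,n}^\top\tilde X_{m,n})^{-1}+\hat\beta^{\mathrm{pa}}_{m,n}\hat\beta^{\mathrm{pa}\top}_{m,n}$, $$\sqrt m\,(\hat\Sigma^{\mathrm{pa}}_{m,n})^{-1/2}(\hat\beta^{\mathrm{pa}}_{m,n}-\beta_n)\Rightarrow\mathcal N(0,I_p).$$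
   Context: Asymptotic regime: $p$ fixed, $n\to\infty$, $m=m_n\to\infty$, $m<n$. A sparse sign embedding with integer sparsity $1\le\zeta_m\le m$ is the random $m\times n$ matrix $S_{m,n}=(R_{m,1},\dots,R_{m,n})$ whose columns are i.i.d. uniform on $\{f/\sqrt{\zeta_m}:f\in\{-1,0,1\}^m,\ \|f\|^2=\zeta_m\}$. $X_n$ is $n\times p$ of full column rank with SVD $X_n=U_nL_nV_n^\top$ ($U_n$ is $n\times p$ with orthonormal columns, $L_n=\mathrm{diag}(\ell_{n,1},\dots,\ell_{n,p})$, $\ell_{n,1}\ge\dots\ge\ell_{n,p}>0$, $V_n$ orthogonal), $\|\mathrm{vec}(U_n)\|_4^4=\sum_{i,j}(U_n)_{ij}^4$, $y_n\in\mathbb R^n$, $\beta_n=(X_n^\top X_n)^{-1}X_n^\top y_n$, $\varepsilon_n=y_n-X_n\beta_n$; $\varepsilon_n\ne0$ is assumed for the first claim and $X_n\beta_n\ne0$ for the second. $\tilde X_{m,n}=S_{m,n}X_n$, $\tilde y_{m,n}=S_{m,n}y_n$, $\hat\beta^{\mathrm s}_{m,n}=(\tilde X_{m,n}^\top\tilde X_{m,n})^{-1}\tilde X_{m,n}^\top\tilde y_{m,n}$, $\hat\beta^{\mathrm{pa}}_{m,n}=(\tilde X_{m,n}^\top\tilde X_{m,n})^{-1}X_n^\top y_n$, $\tilde\varepsilon_{m,n}=\tilde y_{m,n}-\tilde X_{m,n}\hat\beta^{\mathrm s}_{m,n}$ (arbitrary when the inverse does not exist). *)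

(* Defs.v *)
From HB Require Import structures.
From mathcomp Require Import all_boot all_order all_algebra finmap.
From mathcomp Require Import all_classical all_reals all_analysis.

Set Implicit Arguments.
Unset Strict Implicit.
Unset Printing Implicit Defensive.

Import Order.TTheory GRing.Theory Num.Theory.
Import numFieldNormedType.Exports.

Local Open Scope classical_set_scope.
Local Open Scope ring_scope.

Fact measure_matrix_display : measure_display.
Proof. exact: default_measure_display. Qed.

(* The sigma-algebra generated by the entries; over the reals it coincides
   with the Borel sigma-algebra of the product topology. *)
Section measurable_matrix.
Context (R : realType) (m n : nat).

Definition mx_cylinders : set (set 'M[R]_(m, n)) :=
  [set A | exists i j (B : set R),
     measurable B /\ A = [set M : 'M[R]_(m, n) | B (M i j)]].

Let mx_measurable0 : <<s mx_cylinders >> set0.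
Proof. exact: sigma_algebra0. Qed.

Let mx_measurableC A : <<s mx_cylinders >> A -> <<s mx_cylinders >> (~` A).
Proof. exact: sigma_algebraC. Qed.

Let mx_measurable_bigcup (F : (set 'M[R]_(m, n))^nat) :
  (forall i, <<s mx_cylinders >> (F i)) ->
  <<s mx_cylinders >> (\bigcup_i F i).
Proof. exact: sigma_algebra_bigcup. Qed.

HB.instance Definition _ := @isMeasurable.Build measure_matrix_display
  'M[R]_(m, n) <<s mx_cylinders >>
  mx_measurable0 mx_measurableC mx_measurable_bigcup.

Lemma measurable_mx_entry i j :
  measurable_fun [set: 'M[R]_(m, n)] (fun M : 'M[R]_(m, n) => M i j).
Proof.
move=> _ B mB; rewrite setTI; apply: sub_sigma_algebra.
by exists i, j, B.
Qed.

Lemma measurable_fun_mxP d (T : measurableType d) (f : T -> 'M[R]_(m, n)) :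
  measurable_fun setT f <->
  forall i j, measurable_fun setT (fun t => f t i j).
Proof.
split=> [mf i j|mf].
  exact: (measurableT_comp (measurable_mx_entry i j) mf).
apply: (@measurability _ _ T 'M[R]_(m, n) setT f mx_cylinders) => //.
move=> _ [_ [i [j [B [mB ->]]]] <-].
exact: mf.
Qed.

End measurable_matrix.

Section std_normal.
Context (R : realType).

(* measurableTypeR R is the copy of R that carries normal_prob. *)
Definition vcons n (xv : measurableTypeR R * 'cV[R]_n) : 'cV[R]_(1 + n) :=
  col_mx (xv.1)%:M xv.2.

Lemma vcons0 n (x : measurableTypeR R) (v : 'cV[R]_n) :
  vcons (x, v) (ord0 : 'I_n.+1) 0 = x.
Proof.
transitivity (col_mx x%:M v (lshift n 0) 0).
  by rewrite /vcons; congr (col_mx _ _ _ _); exact: val_inj.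
by rewrite col_mxEu mxE eqxx mulr1n.
Qed.

Lemma vcons_lift n (x : measurableTypeR R) (v : 'cV[R]_n) (i : 'I_n) :
  vcons (x, v) (lift ord0 i : 'I_n.+1) 0 = v i 0.
Proof.
transitivity (col_mx (x%:M : 'M[R]_1) v (rshift 1 i) 0).
  by rewrite /vcons; congr (col_mx _ _ _ _); exact: val_inj.
by rewrite col_mxEd.
Qed.

Lemma measurable_vcons n : measurable_fun setT (@vcons n).
Proof.
apply/measurable_fun_mxP => i j; rewrite /vcons ord1.
case: (splitP i) => k ik.
  have -> : (fun t : measurableTypeR R * 'cV[R]_n => col_mx (t.1)%:M t.2 i 0) = fst.
    apply/funext => t; rewrite (_ : i = lshift n k); last exact: val_inj.
    by rewrite col_mxEu ord1 mxE eqxx mulr1n.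
  exact: measurable_fst.
have -> : (fun t : measurableTypeR R * 'cV[R]_n => col_mx (t.1)%:M t.2 i 0) =
          (fun t => t.2 k 0).
  apply/funext => t; rewrite (_ : i = rshift 1 k); last exact: val_inj.
  by rewrite col_mxEd.
exact: (measurableT_comp (measurable_mx_entry k 0) measurable_snd).
Qed.

HB.instance Definition _ n :=
  isMeasurableFun.Build _ _ _ _ (@vcons n) (@measurable_vcons n).

(* N(0, I_n), as the law of n independent standard normal coordinates *)
Fixpoint std_normal n : probability 'cV[R]_n R :=
  match n with
  | 0 => dirac (0 : 'cV[R]_0)
  | n'.+1 => distribution
      ((normal_prob 0 1 : probability (measurableTypeR R) R) \x
       std_normal n')%E
      [the {mfun (measurableTypeR R * 'cV[R]_n')%type >-> 'cV[R]_(1 + n')}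
       of @vcons n']
  end.

Lemma std_normal_box n (A : 'I_n -> set R) :
  (forall i, measurable (A i)) ->
  std_normal n [set v | forall i, A i (v i 0)] =
  (\prod_(i < n) normal_prob 0 1 (A i))%E.
Proof.
elim: n A => [|n IHn] A mA.
  rewrite big_ord0 /= /dirac indicE mem_set// => i.
  by case: i.
rewrite big_ord_recl /= -IHn; last by move=> i; exact: mA.
have mA' : measurable [set v : 'cV[R]_n | forall i, A (lift ord0 i) (v i 0)].
  suff -> : [set v : 'cV[R]_n | forall i, A (lift ord0 i) (v i 0)] =
      \bigcap_(i in [set: 'I_n])
        [set v : 'cV[R]_n | A (lift ord0 i) (v i 0)].
    apply: fin_bigcap_measurable => // i _; apply: sub_sigma_algebra.
    by exists i, 0, (A (lift ord0 i)).
  by apply/seteqP; split=> v /= Av i; [move=> _|]; exact: Av.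
rewrite /distribution /pushforward /=.
rewrite -product_measure1E /=; [|exact: mA|exact: mA'].
congr (product_measure1 _ _ _); apply/seteqP; split=> -[x v] /= H.
  split=> [|i]; first by have := H ord0; rewrite vcons0.
  by have := H (lift ord0 i); rewrite vcons_lift.
case: H => Hx Hv i; have [->|[k ->]] : i = ord0 \/ exists k, i = lift ord0 k.
- by case: (unliftP ord0 i) => [k ->|->]; [right; exists k|left].
- by rewrite vcons0.
- by rewrite vcons_lift; exact: Hv.
Qed.

End std_normal.

(* convergence in distribution of Z n, defined on (T n, P n), to the law Q *)
Definition cvg_in_distribution (R : realType) (k : nat)
    (d : nat -> measure_display) (T : forall n, measurableType (d n))
    (P : forall n, probability (T n) R)
    (Z : forall n, {RV (P n) >-> 'cV[R]_k}) (Q : probability 'cV[R]_k R) :=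
  forall f : 'cV[R]_k -> R,
    continuous f -> (exists M : R, forall v, `|f v| <= M) ->
    ('E_(P n)[f \o Z n])%E @[n --> \oo] --> (\int[Q]_v (f v)%:E)%E.

(* Taking some of the B i to be setT gives the product rule for subfamilies. *)
Definition independent_RVs (R : realType) d d' (T : measurableType d)
    (T' : measurableType d') (P : probability T R) (I : finType)
    (Y : I -> T -> T') :=
  forall B : I -> set T', (forall i, measurable (B i)) ->
    P [set t | forall i, B i (Y i t)] = (\prod_i P (Y i @^-1` B i))%E.

(* for a finite nonempty A *)
Definition uniform_on (R : realType) d d' (T : measurableType d)
    (T' : measurableType d') (P : probability T R) (A : set T')
    (Y : T -> T') :=
  forall B, measurable B ->
    P (Y @^-1` B) =
    (#|` fset_set (A `&` B)|%:R / #|` fset_set A|%:R)%:E.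

(* lpow k A is ||vec A||_k^k *)
Definition lpow (R : realType) (k m n : nat) (A : 'M[R]_(m, n)) : R :=
  \sum_i \sum_j `|A i j| ^+ k.

Definition sparse_sign_vectors (R : realType) (m zeta : nat) :
    set 'cV[R]_m :=
  [set (Num.sqrt zeta%:R)^-1 *: f | f in
    [set f : 'cV[R]_m |
      (forall i, f i 0 \in [:: -1; 0; 1]) /\ lpow 2 f = zeta%:R]].

Definition sparse_sign_embedding (R : realType) d (T : measurableType d)
    (P : probability T R) (m n zeta : nat) (S : {RV P >-> 'M[R]_(m, n)}) :=
  [/\ (1 <= zeta <= m)%N,
      independent_RVs P (fun (j : 'I_n) t => col j (S t)) &
      forall j, uniform_on P (@sparse_sign_vectors R m zeta)
                           (fun t => col j (S t))].

Definition thin_svd (R : realType) (n p : nat) (X U : 'M[R]_(n, p.+1))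
    (ell : 'rV[R]_p.+1) (V : 'M[R]_p.+1) :=
  [/\ X = U *m diag_mx ell *m V^T,
      U^T *m U = 1%:M,
      V^T *m V = 1%:M,
      forall i j : 'I_p.+1, (i <= j)%N -> ell 0 j <= ell 0 i &
      forall i, 0 < ell 0 i].

Section least_squares.
Context (R : realType).

Definition gram n p (X : 'M[R]_(n, p)) : 'M[R]_p := X^T *m X.

Definition ols n p (X : 'M[R]_(n, p)) (y : 'cV[R]_n) : 'cV[R]_p :=
  invmx (gram X) *m (X^T *m y).

Definition residual n p (X : 'M[R]_(n, p)) (y : 'cV[R]_n) : 'cV[R]_n :=
  y - X *m ols X y.

Context (m n p : nat) (S : 'M[R]_(m, n)) (X : 'M[R]_(n, p)) (y : 'cV[R]_n).

Definition sketched_ols : 'cV[R]_p := ols (S *m X) (S *m y).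

Definition partial_ols : 'cV[R]_p := invmx (gram (S *m X)) *m (X^T *m y).

Definition Sigma_sketched : 'M[R]_p :=
  lpow 2 (residual (S *m X) (S *m y)) *: invmx (gram (S *m X)).

Definition Sigma_partial : 'M[R]_p :=
  (partial_ols^T *m gram (S *m X) *m partial_ols) 0 0 *:
    invmx (gram (S *m X)) + partial_ols *m partial_ols^T.

End least_squares.

Definition psdmx (R : realType) p (A : 'M[R]_p) :=
  A^T = A /\ forall v : 'cV[R]_p, 0 <= (v^T *m A *m v) 0 0.

(* A^(-1/2) for A symmetric positive definite: the inverse of the positive
   semidefinite square root, which is unique. *)
Definition invsqrtmx (R : realType) p (A : 'M[R]_p) : 'M[R]_p :=
  invmx (xget 0 [set B : 'M[R]_p | psdmx B /\ B *m B = A]).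

(* Main.v *)
Require Import Defs.
From mathcomp Require Import finmap.
From HB Require Import structures.
From mathcomp Require Import all_boot all_order all_algebra.
From mathcomp Require Import spectral sesquilinear complex.
From mathcomp Require Import all_classical all_reals all_analysis.
From mathcomp Require Import measurable_realfun perm ring lra.

Set Implicit Arguments.
Unset Strict Implicit.
Unset Printing Implicit Defensive.

Import Order.TTheory GRing.Theory Num.Theory.
Import numFieldNormedType.Exports.

Local Open Scope classical_set_scope.
Local Open Scope ring_scope.

(** Write [xi = U^T e] and [K = 1 + xi xi^T], where [e] is the normalised
    residual in the first claim, so that [xi = 0], and the normalised fitted
    vector in the second one, so that [|xi| = 1].  With [H = (S U)^T (S U)] and
    the deviation [tau = (S U)^T (S e) - U^T e], linear algebra with the thin
    singular value decomposition turns both estimation errors into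
    [+- s N H^-1 tau] and both normalising matrices into [s^2 N Khat N^T]
    ([sketched_studentized], [partial_studentized]).  Here [s > 0] is a scalar,
    [N] is deterministic with [N N^T >= 1], bounded thanks to the condition on
    the singular values, and [Khat] is a continuous function of [H], [tau] and
    [|S e|^2] that equals [K] when the sketch is exactly isometric.

    Three facts then give the theorem.

    - With probability tending to one, [H], [|S e|^2] and [tau] are close to
      [1], [1] and [0] ([avg_bad_sketch], a second moment bound).  On that event
      the studentized error is close to [Q (sqrt m tau)], where
      [Q = (N K N^T)^(-1/2) N] satisfies [Q K Q^T = 1]
      ([studentization_perturbation]), because the matrix square root is
      Lipschitz away from singular matrices ([sqrt_stability]).

    - For a fixed vector [t], [<t, Q (sqrt m tau)>] is a quadratic form
      [1/2 sum_(j,k) A j k * h (r_j) (r_k)] without diagonal in the columns [r_j]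
      of [S], where [h r r' = sqrt m <r, r'>]; the diagonal vanishes because
      the columns have norm one.  The columns are independent and uniform on a
      finite set, so every expectation is an average over a finite product set
      ([mean_sketch]).  A leave-one-out form of Stein's method bounds
      [E (W g(W)) - v E g'(W)] by fourth moments ([stein_quad_form]).  For
      [g x = sin (a x + b)] the bound is a differential inequality in [a] for
      [E cos (a W + b)], whence
      [E cos (W + b) = cos b exp (- v / 2) + o(1)] ([char_fun_quad_form]).
      The conditional variances concentrate because their fluctuation is again
      such a quadratic form, multiplied by [1 / sqrt m]
      ([avg_cond_sqr_deviation]).
      The sparsity enters through the fourth moment of [h], which is at most
      [3 + m / zeta^2]: the error contains the product of
      [sqrt m / zeta * |U|_4^4] and [sqrt m / zeta * |e|_4^4], and both factors
      tend to zero.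

    - Convergence of the characteristic functions and tightness imply
      convergence in distribution ([levy_continuity]); trigonometric
      polynomials are dense enough by a multivariate Bernstein approximation in
      the variables [sin (v_i / L)]. *)

(** * Averages over finite sets and product spaces *)

Lemma le_of_eq (R : realType) (x y : R) : x = y -> x <= y.
Proof. by move->. Qed.

Section average.
Context (R : realType).

Definition avg (T : finType) (F : T -> R) : R := (\sum_x F x) / #|T|%:R.

Lemma eq_avg (T : finType) (F G : T -> R) : F =1 G -> avg F = avg G.
Proof. by move=> FG; rewrite /avg (eq_bigr G). Qed.

Lemma avgD (T : finType) (F G : T -> R) :
  avg (fun x => F x + G x) = avg F + avg G.
Proof. by rewrite /avg big_split mulrDl. Qed.

Lemma avgZ (T : finType) (k : R) (F : T -> R) :
  avg (fun x => k * F x) = k * avg F.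
Proof. by rewrite /avg -mulr_sumr mulrA. Qed.

Lemma avgN (T : finType) (F : T -> R) : avg (fun x => - F x) = - avg F.
Proof. by rewrite /avg sumrN mulNr. Qed.

Lemma avgB (T : finType) (F G : T -> R) :
  avg (fun x => F x - G x) = avg F - avg G.
Proof. by rewrite avgD avgN. Qed.

Lemma avg_sum (T I : finType) (P : pred I) (F : I -> T -> R) :
  avg (fun x => \sum_(i | P i) F i x) = \sum_(i | P i) avg (F i).
Proof. by rewrite /avg exchange_big mulr_suml. Qed.

Lemma avg0 (T : finType) : avg (fun _ : T => 0) = 0.
Proof. by rewrite /avg big1 ?mul0r. Qed.

Lemma avg_cst (T : finType) (x0 : T) (k : R) : avg (fun _ : T => k) = k.
Proof.
rewrite /avg sumr_const -[k *+ _]mulr_natr mulfK// pnatr_eq0 -lt0n.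
by apply/card_gt0P; exists x0.
Qed.

Lemma le_avg (T : finType) (F G : T -> R) :
  (forall x, F x <= G x) -> avg F <= avg G.
Proof. by move=> FG; rewrite /avg ler_wpM2r// ler_sum. Qed.

Lemma avg_ge0 (T : finType) (F : T -> R) : (forall x, 0 <= F x) -> 0 <= avg F.
Proof. by move=> F0; rewrite -(avg0 T); exact: le_avg. Qed.

Lemma ler_norm_avg (T : finType) (F : T -> R) :
  `|avg F| <= avg (fun x => `|F x|).
Proof.
rewrite /avg normrM [X in _ * X]ger0_norm ?invr_ge0// ler_wpM2r ?invr_ge0//.
exact: ler_norm_sum.
Qed.

Lemma sqr_avg_le (T : finType) (x0 : T) (F : T -> R) :
  avg F ^+ 2 <= avg (fun x => F x ^+ 2).
Proof.
have : 0 <= avg (fun x => (F x - avg F) ^+ 2).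
  by apply: avg_ge0 => x; exact: sqr_ge0.
have -> : avg (fun x => (F x - avg F) ^+ 2) = avg (fun x => F x ^+ 2) - avg F ^+ 2.
  rewrite (@eq_avg _ _ (fun x => F x ^+ 2 + (- (2 * avg F) * F x + avg F ^+ 2))).
    by rewrite avgD avgD avgZ (avg_cst x0); ring.
  by move=> x; ring.
by rewrite subr_ge0.
Qed.

Lemma sum_cauchy_schwarz (I : finType) (a b : I -> R) :
  (\sum_i a i * b i) ^+ 2 <= (\sum_i a i ^+ 2) * (\sum_i b i ^+ 2).
Proof.
have : 0 <= \sum_i \sum_j (a i * b j - a j * b i) ^+ 2.
  by apply: sumr_ge0 => i _; apply: sumr_ge0 => j _; exact: sqr_ge0.
have -> : \sum_i \sum_j (a i * b j - a j * b i) ^+ 2 =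
   \sum_i \sum_j (a i ^+ 2 * b j ^+ 2)
   + \sum_i \sum_j (b i ^+ 2 * a j ^+ 2)
   - 2 * \sum_i \sum_j ((a i * b i) * (a j * b j)).
  rewrite mulr_sumr -big_split -sumrB; apply: eq_bigr => i _.
  rewrite mulr_sumr -big_split -sumrB; apply: eq_bigr => j _ /=; ring.
have E (u v : I -> R) : \sum_i \sum_j u i * v j = (\sum_i u i) * (\sum_i v i).
  by rewrite mulr_suml; apply: eq_bigr => i _; rewrite mulr_sumr.
rewrite !E; nra.
Qed.

End average.

Section product_space.
Context (R : realType) (I C : finType).
Implicit Types (w : {ffun I -> C}) (F G : {ffun I -> C} -> R).

Definition upd w (i : I) (c : C) : {ffun I -> C} :=
  [ffun j => if j == i then c else w j].

Lemma upd_same w i c : upd w i c i = c.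
Proof. by rewrite ffunE eqxx. Qed.

Lemma upd_other w i c j : j != i -> upd w i c j = w j.
Proof. by rewrite ffunE => /negbTE->. Qed.

(** The tower property: [upd w i c] with [c] averaged out is the conditional
    expectation given all coordinates of [w] but the [i]-th one. *)
Lemma avg_upd (c0 : C) i F :
  avg (fun w => avg (fun c => F (upd w i c))) = avg F.
Proof.
rewrite /avg -mulr_suml; congr (_ / _).
pose f (wc : {ffun I -> C} * C) := (upd wc.1 i wc.2, wc.1 i).
have fK : involutive f.
  move=> [w c]; rewrite /f /= upd_same; congr (_, _).
  by apply/ffunP => j; rewrite !ffunE; case: eqP => // ->.
rewrite (pair_bigA _ (fun w c => F (upd w i c))) /=.
rewrite (reindex_inj (inv_inj fK)) /=.
under eq_bigr => wc _.
  have -> : upd (upd wc.1 i wc.2) i (wc.1 i) = wc.1.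
    by apply/ffunP => j; rewrite !ffunE; case: eqP => // ->.
over.
rewrite -(pair_bigA _ (fun w (c : C) => F w)) /=.
under eq_bigr => w _ do rewrite sumr_const -[F w *+ _]mulr_natr.
rewrite -mulr_suml mulfK// pnatr_eq0 -lt0n.
by apply/card_gt0P; exists c0.
Qed.

Lemma avg_upd_eq (c0 : C) i F G :
  (forall w, avg (fun c => F (upd w i c)) = avg (fun c => G (upd w i c))) ->
  avg F = avg G.
Proof.
by move=> FG; rewrite -(avg_upd c0 i F) -(avg_upd c0 i G); exact: eq_avg.
Qed.

Lemma avg_upd_eq0 (c0 : C) i F :
  (forall w, avg (fun c => F (upd w i c)) = 0) -> avg F = 0.
Proof.
by move=> F0; rewrite -(avg_upd c0 i F) (eq_avg F0) avg0.
Qed.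

End product_space.

(** * Moments of quadratic forms in independent variables *)

(** The model is [h r r' = sqrt m * <r, r'>] for two columns of the sketching
    matrix, with [s = 1 / sqrt m]: a column has norm one and covariance [1 / m],
    and its law is symmetric. *)
Record isotropic_kernel (R : realType) (C : finType) (h : C -> C -> R)
    (s M4 : R) : Prop := IsotropicKernel {
  kernel_sym : forall x y, h x y = h y x ;
  kernel_s_ge0 : 0 <= s ;
  kernel_diag : forall x, s * h x x = 1 ;
  kernel_avg1 : forall x, avg (h x) = 0 ;
  kernel_avg2 : forall x y, avg (fun c => h x c * h y c) = s * h x y ;
  kernel_avg3 : forall x, avg (fun c => h x c ^+ 3) = 0 ;
  kernel_avg4 : forall x, avg (fun c => h x c ^+ 4) <= M4 }.

Section degenerate_quadratic_form.
Context (R : realType) (I C : finType) (c0 : C) (h : C -> C -> R) (s M4 : R).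
Hypothesis hK : isotropic_kernel h s M4.
Implicit Types (w : {ffun I -> C}) (A B : I -> I -> R).

Definition row_form A i w : R := \sum_k A i k * h (w i) (w k).

Definition quad_form A w : R := 2^-1 * \sum_i row_form A i w.

Definition hollow A :=
  (forall i j, A i j = A j i) /\ (forall i, A i i = 0).

Definition row_mass A i : R := \sum_k A i k ^+ 2.

Definition half_mass A : R := 2^-1 * \sum_i row_mass A i.

Lemma row_mass_ge0 A i : 0 <= row_mass A i.
Proof. by apply: sumr_ge0 => k _; exact: sqr_ge0. Qed.

Lemma half_mass_ge0 A : 0 <= half_mass A.
Proof.
by rewrite mulr_ge0// sumr_ge0// => i _; exact: row_mass_ge0.
Qed.

Lemma avg_kernel_sqr x : avg (fun c => h x c ^+ 2) = 1.
Proof. by rewrite -(kernel_diag hK x) -(kernel_avg2 hK); apply: eq_avg => c; rewrite expr2. Qed.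

Section fixed_form.
Variable A : I -> I -> R.
Hypothesis hA : hollow A.

Let Asym := hA.1.
Let Adiag := hA.2.

Lemma row_form_upd i w c :
  row_form A i (upd w i c) = \sum_k A i k * h c (w k).
Proof.
apply: eq_bigr => k _; rewrite upd_same; have [->|ki] := eqVneq k i.
  by rewrite Adiag !mul0r.
by rewrite upd_other.
Qed.

Lemma quad_form_leave_one_out i w :
  quad_form A w - row_form A i w =
  2^-1 * \sum_(j | j != i) \sum_(k | k != i) A j k * h (w j) (w k).
Proof.
rewrite /quad_form (bigD1 i)//= mulrDr.
have -> : \sum_(j | j != i) row_form A j w =
   row_form A i w + \sum_(j | j != i) \sum_(k | k != i) A j k * h (w j) (w k).
  have -> : row_form A i w = \sum_(k | k != i) A i k * h (w i) (w k).
    by rewrite /row_form (bigD1 i)//= Adiag mul0r add0r.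
  rewrite -big_split; apply: eq_bigr => j ji /=.
  by rewrite /row_form (bigD1 i)//= Asym (kernel_sym hK).
by field.
Qed.

(** Leaving out the terms that contain the [i]-th coordinate gives a quantity
    that does not see that coordinate: this is what makes conditioning on all
    other coordinates effective. *)
Lemma leave_one_out_upd i w c :
  quad_form A (upd w i c) - row_form A i (upd w i c) =
  quad_form A w - row_form A i w.
Proof.
rewrite !quad_form_leave_one_out; congr (_ * _).
apply: eq_bigr => j ji; apply: eq_bigr => k ki.
by rewrite !upd_other.
Qed.

(** The conditional second moment of [row_form A i] given the coordinates
    other than [i]. *)
Definition cond_sqr i w : R :=
  s * \sum_k \sum_l A i k * A i l * h (w k) (w l).

Lemma avg_row_form_cond i w : avg (fun c => row_form A i (upd w i c)) = 0.
Proof.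
under eq_avg do rewrite row_form_upd.
rewrite avg_sum big1// => k _; rewrite avgZ.
under eq_avg do rewrite (kernel_sym hK).
by rewrite (kernel_avg1 hK) mulr0.
Qed.

Lemma avg_row_form_sqr_cond i w :
  avg (fun c => row_form A i (upd w i c) ^+ 2) = cond_sqr i w.
Proof.
under eq_avg => c.
  rewrite row_form_upd expr2 mulr_suml.
  under eq_bigr => k _ do rewrite mulr_sumr.
  over.
rewrite avg_sum /cond_sqr mulr_sumr; apply: eq_bigr => k _.
rewrite avg_sum mulr_sumr; apply: eq_bigr => l _.
rewrite (@eq_avg _ _ _ (fun c => (A i k * A i l) * (h (w k) c * h (w l) c))).
  by rewrite avgZ (kernel_avg2 hK); ring.
by move=> c; rewrite !(kernel_sym hK c); ring.
Qed.

Lemma cond_sqr_upd i w c : cond_sqr i (upd w i c) = cond_sqr i w.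
Proof.
congr (_ * _); apply: eq_bigr => k _; apply: eq_bigr => l _.
have [->|ki] := eqVneq k i; first by rewrite Adiag !mul0r.
have [->|li] := eqVneq l i; first by rewrite Adiag !(mulr0, mul0r).
by rewrite !upd_other.
Qed.

Lemma cond_sqr_ge0 i w : 0 <= cond_sqr i w.
Proof.
by rewrite -avg_row_form_sqr_cond; apply: avg_ge0 => c; exact: sqr_ge0.
Qed.

Lemma avg_kernel_pair k l : k != l -> avg (fun w => h (w k) (w l)) = 0.
Proof.
move=> kl; apply: (avg_upd_eq0 c0 (i := l)) => w.
under eq_avg => c do rewrite upd_other// upd_same.
by rewrite (kernel_avg1 hK).
Qed.

(** The off-diagonal products of the columns have mean zero. *)
Lemma avg_cond_sqr i : avg (cond_sqr i) = row_mass A i.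
Proof.
rewrite /cond_sqr avgZ avg_sum mulr_sumr; apply: eq_bigr => k _.
rewrite avg_sum (bigD1 k)//= big1 ?addr0; last first.
  by move=> l lk; rewrite avgZ avg_kernel_pair ?mulr0// eq_sym.
rewrite -avgZ (@eq_avg _ _ _ (fun=> A i k ^+ 2)).
  by rewrite (avg_cst [ffun=> c0]).
by move=> w; rewrite mulrCA (kernel_diag hK) mulr1 expr2.
Qed.

Lemma avg_row_form_sqr i : avg (fun w => row_form A i w ^+ 2) = row_mass A i.
Proof.
rewrite -avg_cond_sqr -(avg_upd c0 i (fun w => row_form A i w ^+ 2)).
by apply: eq_avg => w; rewrite avg_row_form_sqr_cond.
Qed.

Lemma sum_row_form w : \sum_i row_form A i w = 2 * quad_form A w.
Proof. by rewrite /quad_form mulrA divff ?mul1r// pnatr_eq0. Qed.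

Lemma avg_quad_form_sqr : avg (fun w => quad_form A w ^+ 2) = half_mass A.
Proof.
rewrite (@eq_avg _ _ _
  (fun w => 2^-1 * \sum_i row_form A i w * quad_form A w)); last first.
  by move=> w; rewrite -mulr_suml sum_row_form; field.
rewrite avgZ avg_sum; congr (_ * _); apply: eq_bigr => i _.
rewrite -avg_row_form_sqr; apply: (avg_upd_eq c0 (i := i)) => w.
apply/eqP; rewrite -subr_eq0 -avgB.
rewrite (@eq_avg _ _ _ (fun c => (quad_form A w - row_form A i w) *
                                   row_form A i (upd w i c))).
  by rewrite avgZ avg_row_form_cond mulr0.
by move=> c; rewrite -(leave_one_out_upd i w c); ring.
Qed.

(** Adding one independent variable [h (w i) (w j)] to the partial sum [M] kills
    the odd cross terms of [(a h + M)^4], which leaves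
    [a^4 E h^4 + 6 a^2 E M^2 + E M^4]. *)
Lemma avg_partial_row_moments (i : I) (S : seq I) : uniq S -> i \notin S ->
  let M w := \sum_(k <- S) A i k * h (w i) (w k) in
  avg (fun w => M w ^+ 2) = \sum_(k <- S) A i k ^+ 2 /\
  avg (fun w => M w ^+ 4) <=
    M4 * (\sum_(k <- S) A i k ^+ 4) + 3 * (\sum_(k <- S) A i k ^+ 2) ^+ 2.
Proof.
move=> + + M; rewrite {}/M; elim: S => [_ _|j S IH /= /andP[jS uS]].
  split.
    under eq_avg do rewrite big_nil expr0n.
    by rewrite avg0 big_nil.
  under eq_avg do rewrite big_nil expr0n.
  by rewrite avg0 !big_nil mulr0 expr0n mulr0 addr0.
rewrite inE negb_or => /andP[ij iS]; have [IH2 IH4] := IH uS iS.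
set M := fun w => \sum_(k <- S) A i k * h (w i) (w k) in IH2 IH4.
have Mupd w c : M (upd w j c) = M w.
  apply: eq_big_seq => k kS; rewrite !upd_other//.
  by apply: contraNneq jS => <-.
have Xupd w c : A i j * h (upd w j c i) (upd w j c j) = A i j * h (w i) c.
  by rewrite upd_same upd_other.
split.
  rewrite big_cons -IH2.
  have -> : avg (fun w => (\sum_(k <- j :: S) A i k * h (w i) (w k)) ^+ 2) =
            avg (fun w => A i j ^+ 2 + M w ^+ 2).
    apply: (avg_upd_eq c0 (i := j)) => w.
    under eq_avg do rewrite big_cons -/(M _) Xupd Mupd.
    under [RHS]eq_avg do rewrite Mupd.
    rewrite (@eq_avg _ _ _ (fun c => A i j ^+ 2 * h (w i) c ^+ 2
       + ((2 * A i j * M w) * h (w i) c + M w ^+ 2))); last by move=> c; ring.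
    by rewrite !avgD !avgZ avg_kernel_sqr (kernel_avg1 hK) !(avg_cst c0); ring.
  by rewrite avgD (avg_cst [ffun=> c0]).
have -> : avg (fun w => (\sum_(k <- j :: S) A i k * h (w i) (w k)) ^+ 4) =
   avg (fun w => A i j ^+ 4 * avg (fun c => h (w i) c ^+ 4)
                  + (6 * A i j ^+ 2 * M w ^+ 2 + M w ^+ 4)).
  apply: (avg_upd_eq c0 (i := j)) => w.
  under eq_avg do rewrite big_cons -/(M _) Xupd Mupd.
  under [RHS]eq_avg do rewrite Mupd upd_other//.
  rewrite (avg_cst c0).
  rewrite (@eq_avg _ _ _ (fun c => A i j ^+ 4 * h (w i) c ^+ 4
       + ((4 * A i j ^+ 3 * M w) * h (w i) c ^+ 3
       + ((6 * A i j ^+ 2 * M w ^+ 2) * h (w i) c ^+ 2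
       + ((4 * A i j * M w ^+ 3) * h (w i) c + M w ^+ 4)))));
     last by move=> c; ring.
  rewrite !avgD !avgZ avg_kernel_sqr (kernel_avg1 hK) (kernel_avg3 hK).
  by rewrite (avg_cst c0); ring.
rewrite !avgD avgZ (avgZ (6 * A i j ^+ 2)) IH2 !big_cons.
have : avg (fun w => avg (fun c => h (w i) c ^+ 4)) <= M4.
  rewrite -(avg_cst ([ffun=> c0] : {ffun I -> C}) M4); apply: le_avg => w.
  exact: (kernel_avg4 hK).
have := IH4; move: (avg (fun w => M w ^+ 4)) (avg _) => u v.
move: (\sum_(k <- S) A i k ^+ 4) (\sum_(k <- S) A i k ^+ 2) (A i j) => X Y a H1 H2.
have a4 : 0 <= a ^+ 4 by rewrite exprn_even_ge0.
have := ler_wpM2l a4 H2.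
have -> : M4 * (a ^+ 4 + X) + 3 * (a ^+ 2 + Y) ^+ 2 =
  a ^+ 4 * M4 + (6 * a ^+ 2 * Y + (M4 * X + 3 * Y ^+ 2)) + 3 * a ^+ 4 by ring.
lra.
Qed.

Lemma avg_row_form_pow4 i : avg (fun w => row_form A i w ^+ 4) <=
  M4 * (\sum_k A i k ^+ 4) + 3 * row_mass A i ^+ 2.
Proof.
have e (F : I -> R) : F i = 0 ->
    \sum_k F k = \sum_(k <- [seq k <- index_enum I | k != i]) F k.
  by move=> Fi; rewrite big_filter (bigD1 i)//= Fi add0r.
pose S := [seq k <- index_enum I | k != i].
have uS : uniq S by rewrite filter_uniq// index_enum_uniq.
have iS : i \notin S by rewrite mem_filter eqxx.
have [_] := avg_partial_row_moments uS iS.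
rewrite /row_mass -!e ?Adiag ?expr0n// /row_form.
by under eq_avg do rewrite -e ?Adiag ?mul0r//.
Qed.

End fixed_form.
End degenerate_quadratic_form.

(** * Calculus on the real line *)

Section real_calculus.
Context (R : realType).
Implicit Types (f df : R -> R).

Lemma is_derive_continuous f df : (forall x : R, is_derive x 1 f (df x)) ->
  continuous f.
Proof.
by move=> fd x; apply: differentiable_continuous; apply/derivable1_diffP; case: (fd x).
Qed.

(** The mean value theorem without a condition on the order of [x] and [y]. *)
Lemma mean_value f df (x y : R) : (forall x : R, is_derive x 1 f (df x)) ->
  exists2 c, `|c - x| <= `|y - x| & f y - f x = df c * (y - x).
Proof.
move=> fd; have fc := is_derive_continuous fd.
have [xy|yx] := leP x y.
  have [c] := @MVT_segment R f df x y xy (fun z _ => fd z) (continuous_subspaceT fc).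
  rewrite in_itv/= => /andP[xc cy] e; exists c => //.
  by rewrite !ger0_norm ?subr_ge0// lerB.
have [c] := @MVT_segment R f df y x (ltW yx) (fun z _ => fd z) (continuous_subspaceT fc).
rewrite in_itv/= => /andP[yc cx] e; exists c.
  by rewrite !ler0_norm ?subr_le0 ?(ltW yx)// lerN2 lerB.
by rewrite -opprB e; ring.
Qed.

Lemma is_derive_big_sum (T : Type) (S : seq T) (f df : T -> R -> R) (x : R) :
  (forall i, is_derive x 1 (f i) (df i x)) ->
  is_derive x 1 (fun t => \sum_(i <- S) f i t) (\sum_(i <- S) df i x).
Proof.
move=> fd; elim: S => [|i S IH].
  rewrite big_nil (_ : (fun _ => _) = cst 0); first exact: is_derive_cst.
  by apply/funext => t; rewrite big_nil.
rewrite big_cons (_ : (fun _ => _) = f i + (fun t => \sum_(i <- S) f i t)).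
  exact: is_deriveD.
by apply/funext => t; rewrite big_cons.
Qed.

Lemma is_derive_avg (T : finType) (f df : T -> R -> R) (x : R) :
  (forall i, is_derive x 1 (f i) (df i x)) ->
  is_derive x 1 (fun t => avg (fun i => f i t)) (avg (fun i => df i x)).
Proof.
move=> fd; rewrite /avg mulrC.
rewrite (_ : (fun _ => _) =
  (#|T|%:R^-1 : R) *: (fun t => \sum_i f i t) :> (R -> R)).
  exact/is_deriveZ/is_derive_big_sum.
by apply/funext => t; rewrite mulrC.
Qed.

Lemma is_derive_cos_affine (w b t : R) :
  is_derive t 1 (fun t => cos (t * w + b)) (- (w * sin (t * w + b))).
Proof.
have -> : - (w * sin (t * w + b)) = (- sin (t * w + b)) * w by ring.
have H : is_derive t 1 (fun t => t * w + b : R) w.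
  rewrite (_ : (fun t => _) = w *: id + cst b :> (R -> R)); last first.
    by apply/funext => u; rewrite /GRing.scale/= mulrC.
  by apply: is_derive_eq; rewrite /GRing.scale/= mulr1 addr0.
exact: (is_derive1_comp (f := cos) (g := fun t => t * w + b)).
Qed.

Lemma norm_sin_le1 (x : R) : `|sin x| <= 1.
Proof. by rewrite ler_norml sin_geN1 sin_le1. Qed.

Lemma norm_cos_le1 (x : R) : `|cos x| <= 1.
Proof. by rewrite ler_norml cos_geN1 cos_le1. Qed.

Lemma cos_lipschitz (x y : R) : `|cos y - cos x| <= `|y - x|.
Proof.
have [c _ ->] := @mean_value cos (fun x => - sin x) x y (@is_derive_cos R).
by rewrite normrM normrN ler_piMl// norm_sin_le1.
Qed.

Lemma sin_taylor2 (x y : R) : `|sin (x + y) - sin x - y * cos x| <= y ^+ 2.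
Proof.
have [c] := @mean_value sin cos x (x + y) (@is_derive_sin R).
rewrite [x + y]addrC addrK => cy ->.
rewrite mulrC -mulrBr normrM -[y ^+ 2]ger0_norm ?sqr_ge0// normrX expr2.
by rewrite ler_wpM2l// (le_trans (cos_lipschitz _ _)).
Qed.

(** The equation [phi' = - v t phi] has the solution [exp (- v t^2 / 2)]; the
    integrating factor [E] turns the defect [e] into a bound on the error at
    time one. *)
Lemma gaussian_ode (phi dphi : R -> R) (v e : R) : 0 <= v ->
  (forall t : R, is_derive t 1 phi (dphi t)) ->
  (forall t : R, 0 <= t <= 1 -> `|dphi t + v * t * phi t| <= e) ->
  `|phi 1 - phi 0 * expR (- (v / 2))| <= e.
Proof.
move=> v0 phid H.
pose E t : R := expR (v / 2 * t ^+ 2).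
have Ed (t : R) : is_derive t 1 E (v * t * E t).
  have H2 : is_derive t 1 (fun t => v / 2 * t ^+ 2 : R) (v * t).
    rewrite (_ : (fun t => _) = (v / 2) *: (id ^+ 2) :> (R -> R)); last first.
      by apply/funext => u; rewrite /GRing.scale/=.
    by apply: is_derive_eq; rewrite /GRing.scale/= expr1 mulr1; field.
  rewrite mulrC; exact: (is_derive1_comp (f := expR)).
pose psi : R -> R := phi * E.
have psid (t : R) : is_derive t 1 psi ((dphi t + v * t * phi t) * E t).
  by apply: is_derive_eq; rewrite /GRing.scale/=; ring.
have [c] := @MVT_segment R psi _ 0 1 ler01 (fun z _ => psid z)
  (continuous_subspaceT (is_derive_continuous psid)).
rewrite in_itv/= => c01; rewrite subr0 mulr1 => e1.
have E1 : E 1 = expR (v / 2) by rewrite /E expr1n mulr1.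
have E0 : E 0 = 1 by rewrite /E expr0n mulr0 expR0.
have -> : phi 1 - phi 0 * expR (- (v / 2)) = (psi 1 - psi 0) * expR (- (v / 2)).
  rewrite /psi /= -[(phi * E) 1]/(phi 1 * E 1) -[(phi * E) 0]/(phi 0 * E 0).
  by rewrite E1 E0 mulrBl -mulrA -expRD subrr expR0 !mulr1.
rewrite e1 -mulrA normrM -[leRHS]mulr1 ler_pM// ?H//.
rewrite ger0_norm ?mulr_ge0 ?expR_ge0// -expRD -expR0 ler_expR.
case/andP: c01 => c_ge0 c_le1.
by rewrite subr_le0 ler_piMr ?divr_ge0 ?expr_le1.
Qed.

End real_calculus.

(** * Stein's method for quadratic forms *)

Section stein_bound.
Context (R : realType) (I C : finType) (c0 : C) (h : C -> C -> R) (s M4 : R).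
Hypothesis hK : isotropic_kernel h s M4.
Variable A : I -> I -> R.
Hypothesis hA : hollow A.
Implicit Types w : {ffun I -> C}.

Let W := @quad_form R I C h A.
Let D := @row_form R I C h A.
Let V := @cond_sqr R I C h s A.
Let w0 : {ffun I -> C} := [ffun=> c0].

Definition pow4_mass : R :=
  M4 * (\sum_i \sum_k A i k ^+ 4) + 3 * \sum_i row_mass A i ^+ 2.

(** The square of the matrix [A] with its diagonal removed. *)
Definition square_form (k l : I) : R :=
  if k == l then 0 else \sum_i A i k * A i l.

Lemma hollow_square_form : hollow square_form.
Proof.
split=> [k l|k]; rewrite /square_form ?eqxx// eq_sym; case: ifP => // _.
by apply: eq_bigr => i _; rewrite mulrC.
Qed.

(** The diagonal terms [h x x] are constant, equal to [1 / s], and sum up to the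
    mean; the other terms form a quadratic form again. *)
Lemma half_sum_cond_sqr w :
  2^-1 * \sum_i V i w - half_mass A = s * quad_form h square_form w.
Proof.
rewrite /V /cond_sqr /half_mass /quad_form -mulr_sumr -mulrBr mulrCA; congr (_ * _).
have -> : \sum_i \sum_k \sum_l A i k * A i l * h (w k) (w l) =
  \sum_k \sum_l (\sum_i A i k * A i l) * h (w k) (w l).
  rewrite exchange_big; apply: eq_bigr => k _; rewrite exchange_big.
  by apply: eq_bigr => l _; rewrite mulr_suml.
have -> : \sum_i row_mass A i = s * \sum_k (\sum_i A i k * A i k) * h (w k) (w k).
  rewrite mulr_sumr; apply: eq_bigr => k _.
  rewrite mulrCA (kernel_diag hK) mulr1; apply: eq_bigr => i _.
  by rewrite hA.1 expr2.
rewrite -mulrBr -sumrB; congr (_ * _); apply: eq_bigr => k _.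
rewrite [X in X - _](bigD1 k)//= [LHS]addrC addKr.
rewrite /row_form [RHS](bigD1 k)//= /square_form eqxx mul0r add0r.
by apply: eq_bigr => l; rewrite eq_sym => /negbTE ->.
Qed.

(** Cauchy-Schwarz: the Frobenius norm of [A^2] is at most the squared Frobenius
    norm of [A]. *)
Lemma half_mass_square_form : half_mass square_form <= 2 * half_mass A ^+ 2.
Proof.
have -> : 2 * half_mass A ^+ 2 = 2^-1 * (\sum_i row_mass A i) ^+ 2.
  by rewrite /half_mass exprMn mulrA; congr (_ * _); field.
rewrite /half_mass ler_wpM2l// expr2 mulr_suml; apply: ler_sum => k _.
rewrite mulr_sumr; apply: ler_sum => l _.
rewrite /square_form; case: ifP => _.
  by rewrite expr0n mulr_ge0// row_mass_ge0.
apply: (le_trans (sum_cauchy_schwarz _ _)).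
apply/le_of_eq; rewrite /row_mass; congr (_ * _); apply: eq_bigr => i _; by rewrite hA.1.
Qed.

(** The fluctuation of the conditional variance is itself a quadratic form, with
    the small factor [s]. *)
Lemma avg_cond_sqr_deviation :
  avg (fun w => `|2^-1 * \sum_i V i w - half_mass A|) <=
  s / 2 * (1 + 2 * half_mass A ^+ 2).
Proof.
pose Q := quad_form h square_form : {ffun I -> C} -> R.
apply: (@le_trans _ _ (avg (fun w => s / 2 + s / 2 * Q w ^+ 2))).
  apply: le_avg => w; rewrite half_sum_cond_sqr -/(Q w) normrM.
  rewrite ger0_norm ?(kernel_s_ge0 hK)//.
  have s0 := kernel_s_ge0 hK.
  have : 0 <= (`|Q w| - 1) ^+ 2 by exact: sqr_ge0.
  (* [|Q| <= (1 + Q^2) / 2] *)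
  rewrite sqrrB1 real_normK ?num_real//; nra.
rewrite avgD (avg_cst w0) avgZ (avg_quad_form_sqr c0 hK hollow_square_form).
have s0 := kernel_s_ge0 hK; have := half_mass_square_form; nra.
Qed.

Section test_function.
Variables (g g' : R -> R) (lam : R).
Hypothesis lam_gt0 : 0 < lam.
Hypothesis g'_le1 : forall x, `|g' x| <= 1.
Hypothesis g'_lip : forall x y, `|g' (x + y) - g' x| <= `|y|.
Hypothesis g_taylor : forall x y, `|g (x + y) - g x - y * g' x| <= y ^+ 2.

(** Let [m = W - D i], which does not depend on the [i]-th variable. Expanding [g]
    around [m], the zeroth order term of [D i * g W] has conditional mean zero
    and the first order one has conditional mean [V i * g' m]. What remains is a
    second order Taylor remainder of size [|D i|^3] and the error [V i * |D i|]
    made by replacing [g' W] by [g' m]; Young's inequality with weight [lam]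
    splits these cubic terms into second and fourth moments. *)
Lemma stein_row i :
  `|avg (fun w => D i w * g (W w)) - avg (fun w => V i w * g' (W w))| <=
  lam * row_mass A i + lam^-1 * avg (fun w => D i w ^+ 4).
Proof.
pose rem w := D i w * (g (W w) - g (W w - D i w) - D i w * g' (W w - D i w))
  - V i w * (g' (W w) - g' (W w - D i w)).
have -> : avg (fun w => D i w * g (W w)) - avg (fun w => V i w * g' (W w)) =
          avg rem.
  rewrite -avgB; apply: (avg_upd_eq c0 (i := i)) => w; apply/eqP.
  rewrite -subr_eq0 -avgB; apply/eqP.
  pose m := W w - D i w.
  rewrite (@eq_avg _ _ _ (fun c => g m * D i (upd w i c)
     + g' m * (D i (upd w i c) ^+ 2 + - V i w))).
    rewrite avgD avgZ (avg_row_form_cond hK hA) mulr0 add0r avgZ avgD.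
    by rewrite (avg_row_form_sqr_cond hK hA) (avg_cst c0) subrr mulr0.
  move=> c; rewrite /rem [_ - D i (upd w i c)](leave_one_out_upd hK hA) -/m.
  rewrite /V (cond_sqr_upd h s hA); ring.
pose bnd w := lam / 2 * D i w ^+ 2 + (lam^-1 / 2 * D i w ^+ 4
                + (lam / 2 * D i w ^+ 2 + lam^-1 / 2 * V i w ^+ 2)).
have young (x y : R) : 0 <= x -> 0 <= y -> x * y <= lam / 2 * x ^+ 2 + lam^-1 / 2 * y ^+ 2.
  move=> x0 y0; rewrite -subr_ge0.
  have -> : lam / 2 * x ^+ 2 + lam^-1 / 2 * y ^+ 2 - x * y =
      lam^-1 / 2 * (lam * x - y) ^+ 2 by field; rewrite gt_eqF.
  by rewrite mulr_ge0 ?sqr_ge0// divr_ge0// invr_ge0 ltW.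
apply: (le_trans (ler_norm_avg _)).
apply: (@le_trans _ _ (avg bnd)).
  apply: le_avg => w; rewrite /rem /bnd.
  have e : W w = (W w - D i w) + D i w by rewrite subrK.
  apply: (le_trans (ler_normB _ _)); rewrite (normrM (D i w)) (normrM (V i w)).
  have V0 : 0 <= V i w := cond_sqr_ge0 hK hA i w.
  have H1 : `|g (W w) - g (W w - D i w) - D i w * g' (W w - D i w)| <= D i w ^+ 2.
    by rewrite {1}e.
  have H2 : `|g' (W w) - g' (W w - D i w)| <= `|D i w| by rewrite {1}e.
  have d2 : D i w ^+ 2 = `|D i w| ^+ 2 by rewrite real_normK ?num_real.
  have d4 : D i w ^+ 4 = (`|D i w| ^+ 2) ^+ 2 by rewrite -d2 -exprM.
  rewrite (ger0_norm V0) d4 d2 addrA; apply: lerD.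
    apply: le_trans (young _ _ _ _) => //.
    by apply: ler_wpM2l => //; rewrite -d2.
  apply: le_trans (young _ _ _ _) => //.
  by rewrite mulrC ler_wpM2r.
rewrite /bnd !avgD !avgZ (avg_row_form_sqr c0 hK hA).
have : avg (fun w => V i w ^+ 2) <= avg (fun w => D i w ^+ 4).
  rewrite -(avg_upd c0 i (fun w => D i w ^+ 4)); apply: le_avg => w.
  rewrite /V -(avg_row_form_sqr_cond hK hA).
  apply: le_trans (sqr_avg_le c0 _) _; apply: le_avg => c.
  by rewrite -exprM.
have : 0 < lam^-1 by rewrite invr_gt0.
move: (avg _) (avg _) lam^-1 => a b l l0 ab; nra.
Qed.

Definition stein_error : R :=
  lam * half_mass A + lam^-1 / 2 * pow4_mass + s / 2 * (1 + 2 * half_mass A ^+ 2).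

Lemma stein_quad_form :
  `|avg (fun w => W w * g (W w)) - half_mass A * avg (fun w => g' (W w))| <=
  stein_error.
Proof.
have -> : avg (fun w => W w * g (W w)) - half_mass A * avg (fun w => g' (W w)) =
  2^-1 * \sum_i (avg (fun w => D i w * g (W w)) - avg (fun w => V i w * g' (W w)))
  + avg (fun w => (2^-1 * (\sum_i V i w) - half_mass A) * g' (W w)).
  rewrite sumrB -!avg_sum mulrBr.
  rewrite [avg (fun w => (_ - _) * _)](_ : _ =
    2^-1 * avg (fun w => \sum_i V i w * g' (W w)) - half_mass A * avg (fun w => g' (W w))); last first.
    rewrite -!avgZ -avgB; apply: eq_avg => w.
    by rewrite mulrBl -mulrA mulr_suml.
  rewrite addrA subrK; congr (_ - _); rewrite -avgZ; apply: eq_avg => w.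
  by rewrite -mulr_suml /D (sum_row_form h A w) /W; field.
apply: (le_trans (ler_normD _ _)); apply: lerD.
  rewrite normrM ger0_norm//.
  apply: (@le_trans _ _ (2^-1 * \sum_i (lam * row_mass A i
      + lam^-1 * (M4 * (\sum_k A i k ^+ 4) + 3 * row_mass A i ^+ 2)))).
    rewrite ler_wpM2l//; apply: (le_trans (ler_norm_sum _ _ _)).
    apply: ler_sum => i _; apply: (le_trans (stein_row i)).
    rewrite lerD2l ler_wpM2l ?invr_ge0 ?(ltW lam_gt0)//.
    exact: (avg_row_form_pow4 c0 hK hA).
  rewrite big_split/= -!mulr_sumr big_split/= -!mulr_sumr /half_mass /pow4_mass.
  by apply/le_of_eq; ring.
apply: (le_trans (ler_norm_avg _)).
apply: le_trans avg_cond_sqr_deviation; apply: le_avg => w.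
by rewrite normrM ler_piMr.
Qed.

End test_function.

(** Stein's bound with the test function [sin (t x + b)] controls the defect of
    [t |-> E cos (t W + b)] in the differential equation of the Gaussian
    characteristic function. *)
Lemma char_fun_quad_form (b lam : R) : 0 < lam ->
  `|avg (fun w => cos (W w + b)) - cos b * expR (- (half_mass A / 2))| <=
  stein_error lam.
Proof.
move=> lam0; have v0 := half_mass_ge0 A.
pose phi (t : R) := avg (fun w => cos (t * W w + b)).
have phi0 : phi 0 = cos b.
  rewrite -[RHS](avg_cst w0 (cos b)); apply: eq_avg => w.
  by rewrite mul0r add0r.
have phi1 : phi 1 = avg (fun w => cos (W w + b)).
  by apply: eq_avg => w; rewrite mul1r.
have := @gaussian_ode R phi
   (fun t => avg (fun w => - (W w * sin (t * W w + b)))) _ (stein_error lam) v0.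
rewrite phi0 phi1 => H; apply: H => [t|t /andP[t0 t1]].
  exact: (@is_derive_avg _ _ (fun w t => cos (t * W w + b))
    (fun w t => - (W w * sin (t * W w + b))) t
    (fun w => is_derive_cos_affine (W w) b t)).
rewrite avgN -normrN opprD opprK.
have := @stein_quad_form (fun x => sin (t * x + b)) (fun x => t * cos (t * x + b))
  lam lam0.
have shift x y : t * (x + y) + b = t * x + b + t * y by ring.
rewrite avgZ mulrA; apply=> [x|x y|x y].
- by rewrite normrM (ger0_norm t0) mulr_ile1// norm_cos_le1.
- rewrite -mulrBr normrM (ger0_norm t0).
  apply: (le_trans (ler_piMl _ t1)) => //.
  apply: le_trans (cos_lipschitz _ _) _.
  by rewrite shift [_ + _ - _]addrC addKr normrM (ger0_norm t0) ler_piMl.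
- rewrite shift mulrA [y * t]mulrC.
  apply: le_trans (sin_taylor2 _ _) _.
  by rewrite exprMn ler_piMl ?sqr_ge0// expr_le1.
Qed.

End stein_bound.

(** * Moments of sparse sign vectors *)

Section sign_symmetric_vectors.
Context (R : realType) (C : finType) (m zeta : nat) (r : C -> 'I_m -> R).
Hypotheses (zeta_gt0 : (0 < zeta)%N) (zeta_le : (zeta <= m)%N).
Hypothesis r_flip : forall a, exists2 f : C -> C, injective f &
  forall c b, r (f c) b = if b == a then - r c b else r c b.
Hypothesis r_swap : forall a a', exists2 f : C -> C, injective f &
  forall c b, r (f c) b = r c (tperm a a' b).
Hypothesis r_opp : exists2 f : C -> C, injective f &
  forall c b, r (f c) b = - r c b.
Hypothesis r_norm : forall c, \sum_a r c a ^+ 2 = 1.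
Hypothesis r_pow4 : forall c a, r c a ^+ 4 = r c a ^+ 2 / zeta%:R.
Variable c0 : C.

Let m_gt0 : (0 < m)%N. Proof. exact: leq_trans zeta_le. Qed.
Let mR_gt0 : 0 < m%:R :> R. Proof. by rewrite ltr0n. Qed.
Let zR_gt0 : 0 < zeta%:R :> R. Proof. by rewrite ltr0n. Qed.

Lemma avg_reindex (f : C -> C) (F : C -> R) : injective f ->
  avg (fun c => F (f c)) = avg F.
Proof. by move=> fi; rewrite /avg [in RHS](reindex_inj fi). Qed.

(** Flipping the sign of one coordinate preserves the uniform law, so a function
    that is odd in that coordinate averages to zero. *)
Lemma avg_odd_flip a (F : C -> R) :
  (forall c c', (forall b, r c' b = if b == a then - r c b else r c b) ->
     F c' = - F c) -> avg F = 0.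
Proof.
move=> FN; have [f fi fr] := r_flip a.
have : avg F = - avg F.
  by rewrite -{1}(avg_reindex F fi) -avgN; apply: eq_avg => c; apply: FN => b; exact: fr.
lra.
Qed.

Lemma avg_coord2 a : avg (fun c => r c a ^+ 2) = m%:R^-1.
Proof.
have E b : avg (fun c => r c b ^+ 2) = avg (fun c => r c a ^+ 2).
  have [f fi fr] := r_swap a b.
  rewrite -(avg_reindex (fun c => r c b ^+ 2) fi); apply: eq_avg => c.
  by rewrite fr tpermR.
apply: (mulfI (lt0r_neq0 mR_gt0)); rewrite divff ?lt0r_neq0//.
rewrite -[RHS](avg_cst c0) -(eq_avg r_norm) avg_sum.
by under eq_bigr do rewrite E; rewrite sumr_const card_ord mulr_natl.
Qed.

Lemma avg_coord4 a : avg (fun c => r c a ^+ 4) = (m%:R * zeta%:R)^-1.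
Proof.
under eq_avg do rewrite r_pow4 mulrC.
by rewrite avgZ avg_coord2 invfM mulrC.
Qed.

(** By exchangeability all these averages are equal, and their sum over [b] is
    determined by [sum_b r_b^2 = 1]: the squared coordinates are negatively
    correlated. *)
Lemma avg_coord22 a b : a != b ->
  avg (fun c => r c a ^+ 2 * r c b ^+ 2) <= m%:R ^- 2.
Proof.
move=> ab; set p := avg _.
have E b' : b' != a -> avg (fun c => r c a ^+ 2 * r c b' ^+ 2) = p.
  move=> b'a; have [f fi fr] := r_swap b b'.
  rewrite -(avg_reindex _ fi); apply: eq_avg => c.
  by rewrite !fr tpermR tpermD// eq_sym.
have : m.-1%:R * p = m%:R^-1 - (m%:R * zeta%:R)^-1.
  rewrite -(avg_coord2 a) -(avg_coord4 a) -avgB.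
  rewrite (@eq_avg _ _ _ (fun c => \sum_(b' | b' != a) r c a ^+ 2 * r c b' ^+ 2)).
    rewrite avg_sum; under eq_bigr => b' b'a do rewrite E//.
    rewrite sumr_const mulr_natl; congr (_ *+ _).
    by have := cardC1 a; rewrite card_ord => <-; apply: eq_card => x; rewrite !inE.
  move=> c; rewrite -mulr_sumr -[X in X - _]mulr1 -(r_norm c) (bigD1 a)//=.
  by ring.
have m1 : (1 < m)%N.
  rewrite ltnNge; apply: contra ab => m1; apply/eqP/val_inj => /=.
  have E0 (c : 'I_m) : nat_of_ord c = 0%N.
    by have := leq_trans (ltn_ord c) m1; rewrite ltnS leqn0 => /eqP.
  by rewrite !E0.
have m1R : 0 < m.-1%:R :> R by rewrite ltr0n -ltnS prednK.
move=> e; rewrite -(ler_pM2l m1R) e invfM.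
have -> : m.-1%:R = m%:R - 1 :> R by rewrite -subn1 natrB.
have zm : zeta%:R <= m%:R :> R by rewrite ler_nat.
have h1 : m%:R^-1 * m%:R = 1 :> R by rewrite mulVf// lt0r_neq0.
have : m%:R^-1 <= zeta%:R^-1 :> R by rewrite lef_pV2 ?posrE.
have : 0 < m%:R^-1 :> R by rewrite invr_gt0.
rewrite -exprVn mulrBl mul1r expr2 mulrA divff ?lt0r_neq0// mul1r lerD2l lerN2.
by move=> h0 h2; exact: ler_wpM2l (ltW h0) _ _ h2.
Qed.

Definition dot (x y : 'I_m -> R) : R := \sum_a x a * y a.

Lemma avg_dot x : avg (fun c => dot x (r c)) = 0.
Proof.
have [f fi fr] := r_opp.
have : avg (fun c => dot x (r c)) = - avg (fun c => dot x (r c)).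
  rewrite -{1}(avg_reindex _ fi) -avgN; apply: eq_avg => c.
  by rewrite /dot -sumrN; apply: eq_bigr => a _; rewrite fr mulrN.
lra.
Qed.

Lemma avg_dot3 x : avg (fun c => dot x (r c) ^+ 3) = 0.
Proof.
have [f fi fr] := r_opp.
have : avg (fun c => dot x (r c) ^+ 3) = - avg (fun c => dot x (r c) ^+ 3).
  rewrite -{1}(avg_reindex _ fi) -avgN; apply: eq_avg => c.
  have -> : dot x (r (f c)) = - dot x (r c).
    by rewrite /dot -sumrN; apply: eq_bigr => a _; rewrite fr mulrN.
  by ring.
lra.
Qed.

Lemma avg_dot2 x y : avg (fun c => dot x (r c) * dot y (r c)) = dot x y / m%:R.
Proof.
rewrite (@eq_avg _ _ _ (fun c => \sum_a \sum_b (x a * y b) * (r c a * r c b))).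
  rewrite avg_sum /dot mulr_suml; apply: eq_bigr => a _.
  rewrite avg_sum (bigD1 a)//= big1 ?addr0.
    by rewrite avgZ -(avg_coord2 a).
  move=> b ba; rewrite avgZ (avg_odd_flip (a := a)) ?mulr0// => c c' e.
  by rewrite !e eqxx (negbTE ba) mulNr.
move=> c; rewrite /dot mulr_suml; apply: eq_bigr => a _.
by rewrite mulr_sumr; apply: eq_bigr => b _; ring.
Qed.

(** As for a quadratic form, each new coordinate contributes only even cross
    terms; these are handled by [H2]. *)
Lemma avg_dot4 x : avg (fun c => dot x (r c) ^+ 4) <=
  (m%:R * zeta%:R)^-1 * (\sum_a x a ^+ 4) + 3 * m%:R ^- 2 * (\sum_a x a ^+ 2) ^+ 2.
Proof.
pose k : R := m%:R ^- 2.
have k0 : 0 <= k by rewrite invr_ge0 exprn_ge0.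
rewrite /dot; elim: (index_enum _) (index_enum_uniq 'I_m) => [_|a S IH /=].
  under eq_avg do rewrite big_nil expr0n.
  by rewrite avg0 !big_nil expr0n !mulr0 addr0.
move=> /andP[aS uS]; have {}IH := IH uS.
pose M c := \sum_(b <- S) x b * r c b.
have Mflip a' c c' : a' \notin S ->
    (forall b, r c' b = if b == a' then - r c b else r c b) -> M c' = M c.
  move=> a'S e; apply: eq_big_seq => b bS; rewrite e; case: eqP => // ba.
  by rewrite -ba bS in a'S.
have H2 : avg (fun c => r c a ^+ 2 * M c ^+ 2) <= k * \sum_(b <- S) x b ^+ 2.
  clear IH Mflip; rewrite {}/M; elim: S uS aS => [_ _|b S IH /= /andP[bS uS]].
    under eq_avg do rewrite big_nil expr0n mulr0.
    by rewrite avg0 big_nil mulr0.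
  rewrite inE negb_or => /andP[ab aS]; have {}IH := IH uS aS.
  pose M c := \sum_(b <- S) x b * r c b.
  rewrite (@eq_avg _ _ _ (fun c => x b ^+ 2 * (r c a ^+ 2 * r c b ^+ 2)
     + (r c a ^+ 2 * M c ^+ 2 + (2 * x b) * (r c a ^+ 2 * r c b * M c)))); last first.
    by move=> c; rewrite big_cons -/(M c); ring.
  rewrite !avgD !avgZ big_cons [avg (fun c => r c a ^+ 2 * r c b * M c)](avg_odd_flip (a := b)).
    rewrite mulr0 addr0 mulrDr lerD// mulrC ler_wpM2r ?sqr_ge0//.
    exact: avg_coord22.
  move=> c c' e; rewrite !e eqxx (negbTE ab) (_ : M c' = M c); first by ring.
  apply: eq_big_seq => b' bS'; rewrite e; case: eqP => // bb.
  by rewrite -bb bS' in bS.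
rewrite (@eq_avg _ _ _ (fun c => x a ^+ 4 * r c a ^+ 4
   + (6 * x a ^+ 2 * (r c a ^+ 2 * M c ^+ 2)
   + (M c ^+ 4 + (4 * x a * (r c a * M c ^+ 3)
      + 4 * x a ^+ 3 * (r c a ^+ 3 * M c)))))); last first.
  by move=> c; rewrite big_cons -/(M c); ring.
rewrite !avgD !avgZ avg_coord4.
rewrite [avg (fun c => r c a * M c ^+ 3)](avg_odd_flip (a := a)); last first.
  by move=> c c' e; rewrite (Mflip a _ _ aS e) e eqxx; ring.
rewrite [avg (fun c => r c a ^+ 3 * M c)](avg_odd_flip (a := a)); last first.
  by move=> c c' e; rewrite (Mflip a _ _ aS e) e eqxx; ring.
rewrite !mulr0 !addr0 !big_cons.
move: IH H2; rewrite -/(M _) -/k.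
move: (avg (fun c => M c ^+ 4)) (avg _) (\sum_(b <- S) x b ^+ 4) (\sum_(b <- S) x b ^+ 2).
move: (_^-1) (x a) => z y u v X Y H1 H2.
have := ler_wpM2l (sqr_ge0 y) H2.
have -> : z * (y ^+ 4 + X) + 3 * k * (y ^+ 2 + Y) ^+ 2 =
  z * y ^+ 4 + (6 * (y ^+ 2 * (k * Y)) + (z * X + 3 * k * Y ^+ 2)) + 3 * k * y ^+ 4.
  by ring.
have : 0 <= k * y ^+ 4 by rewrite mulr_ge0// exprn_even_ge0.
lra.
Qed.

(** The fourth moment is
    [m^2 ((m zeta)^-1 sum_a r_a^4 + 3 m^-2)] with [sum_a r_a^4 = 1 / zeta]. *)
Lemma isotropic_sign_kernel :
  isotropic_kernel (fun c c' => Num.sqrt m%:R * dot (r c) (r c'))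
    (Num.sqrt m%:R)^-1 (3 + m%:R / zeta%:R ^+ 2).
Proof.
have sm0 : Num.sqrt m%:R != 0 :> R by rewrite gt_eqF// sqrtr_gt0.
have sm2 : Num.sqrt m%:R ^+ 2 = m%:R :> R by rewrite sqr_sqrtr// ltW.
have dot1 c : dot (r c) (r c) = 1.
  by rewrite -[RHS](r_norm c); apply: eq_bigr => a _; rewrite expr2.
split.
- by move=> c c'; congr (_ * _); apply: eq_bigr => a _; rewrite mulrC.
- by rewrite invr_ge0 sqrtr_ge0.
- by move=> c; rewrite mulKf.
- by move=> c; rewrite avgZ avg_dot mulr0.
- move=> c c'; rewrite mulKf//.
  rewrite (@eq_avg _ _ _ (fun d => m%:R * (dot (r c) (r d) * dot (r c') (r d)))).
    by rewrite avgZ avg_dot2 mulrCA divff ?mulr1 ?lt0r_neq0.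
  by move=> d; rewrite mulrACA -expr2 sm2.
- move=> c; rewrite (@eq_avg _ _ _ (fun d => Num.sqrt m%:R ^+ 3 * dot (r c) (r d) ^+ 3)).
    by rewrite avgZ avg_dot3 mulr0.
  by move=> d; rewrite exprMn.
move=> c; rewrite (@eq_avg _ _ _ (fun d => m%:R ^+ 2 * dot (r c) (r d) ^+ 4)); last first.
  by move=> d; rewrite exprMn (exprM _ 2 2) sm2.
rewrite avgZ; apply: (le_trans (ler_wpM2l _ (avg_dot4 _))); first exact: sqr_ge0.
have -> : \sum_a r c a ^+ 4 = zeta%:R^-1.
  under eq_bigr do rewrite r_pow4.
  by rewrite -mulr_suml r_norm mul1r.
rewrite r_norm; apply/le_of_eq; field.
by rewrite !lt0r_neq0.
Qed.

End sign_symmetric_vectors.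

(** * From the sketching matrix to a finite model *)

Section mean.
Context d (T : measurableType d) (R : realType) (P : probability T R).
Implicit Types f g : T -> R.

Definition bdd_meas f :=
  measurable_fun setT f /\ exists M : R, forall x, `|f x| <= M.

Definition mean f : R := (\int[P]_x f x)%R.

Lemma bdd_meas_integrable f : bdd_meas f -> P.-integrable setT (EFin \o f).
Proof.
move=> [mf [M fM]]; apply: measurable_bounded_integrable => //.
  by apply: (@le_lt_trans _ _ 1%E); [exact: probability_le1|rewrite ltry].
exists M; split; first exact: num_real.
by move=> x Mx y _; exact: le_trans (fM y) (ltW Mx).
Qed.

Lemma mean_EFin f : bdd_meas f -> (\int[P]_x (f x)%:E)%E = (mean f)%:E.
Proof.
move=> /bdd_meas_integrable fi; rewrite /mean /Rintegral fineK//.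
exact: integrable_fin_num.
Qed.

Lemma bdd_meas_cst (k : R) : bdd_meas (fun=> k).
Proof. by split; [exact: measurable_cst|exists `|k|]. Qed.

Lemma bdd_measD f g : bdd_meas f -> bdd_meas g -> bdd_meas (fun x => f x + g x).
Proof.
move=> [mf [M fM]] [mg [N gN]]; split; first exact: measurable_funD.
by exists (M + N) => x; rewrite (le_trans (ler_normD _ _))// lerD.
Qed.

Lemma bdd_measM f g : bdd_meas f -> bdd_meas g -> bdd_meas (fun x => f x * g x).
Proof.
move=> [mf [M fM]] [mg [N gN]]; split; first exact: measurable_funM.
by exists (M * N) => x; rewrite normrM ler_pM.
Qed.

Lemma bdd_measZ k f : bdd_meas f -> bdd_meas (fun x => k * f x).
Proof. exact/bdd_measM/bdd_meas_cst. Qed.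

Lemma bdd_measB f g : bdd_meas f -> bdd_meas g -> bdd_meas (fun x => f x - g x).
Proof.
move=> bf bg; have := bdd_measD bf (bdd_measZ (-1) bg).
by congr bdd_meas; apply/funext => x; rewrite mulN1r.
Qed.

Lemma bdd_meas_indic (A : set T) : measurable A -> bdd_meas (\1_A : T -> R).
Proof.
move=> mA; split; first exact: measurable_indic.
by exists 1 => x; rewrite indicE normr_nat; case: (_ \in _); rewrite ?lexx ?ler01.
Qed.

Lemma bdd_meas_sum (I : Type) (s : seq I) (p : pred I) (f : I -> T -> R) :
  (forall i, bdd_meas (f i)) -> bdd_meas (fun x => \sum_(i <- s | p i) f i x).
Proof.
move=> bf; elim: s => [|i s IH].
  have := bdd_meas_cst 0; congr bdd_meas.
  by apply/funext => x; rewrite big_nil.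
have [pi|pi] := boolP (p i).
  have := bdd_measD (bf i) IH; congr bdd_meas.
  by apply/funext => x; rewrite big_cons pi.
by move: IH; congr bdd_meas; apply/funext => x; rewrite big_cons (negbTE pi).
Qed.

Lemma bdd_meas_norm f : bdd_meas f -> bdd_meas (fun x => `|f x|).
Proof.
move=> [mf [M fM]]; split; first exact: measurableT_comp.
by exists M => x; rewrite normr_id.
Qed.

Lemma meanD f g : bdd_meas f -> bdd_meas g ->
  mean (fun x => f x + g x) = mean f + mean g.
Proof.
by move=> bf bg; rewrite /mean RintegralD//; exact: bdd_meas_integrable.
Qed.

Lemma meanB f g : bdd_meas f -> bdd_meas g ->
  mean (fun x => f x - g x) = mean f - mean g.
Proof.
by move=> bf bg; rewrite /mean RintegralB//; exact: bdd_meas_integrable.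
Qed.

Lemma meanZ k f : bdd_meas f -> mean (fun x => k * f x) = k * mean f.
Proof.
by move=> bf; rewrite /mean RintegralZl//; exact: bdd_meas_integrable.
Qed.

Lemma mean_cst (k : R) : mean (fun=> k) = k.
Proof. by rewrite /mean Rintegral_cst//= probability_setT mulr1. Qed.

Lemma mean_sum (I : Type) (s : seq I) (p : pred I) (f : I -> T -> R) :
  (forall i, bdd_meas (f i)) ->
  mean (fun x => \sum_(i <- s | p i) f i x) = \sum_(i <- s | p i) mean (f i).
Proof.
move=> bf; elim: s => [|i s IH].
  rewrite big_nil -[RHS](mean_cst 0); congr mean.
  by apply/funext => x; rewrite big_nil.
rewrite big_cons -IH; case: ifPn => pi.
  rewrite -meanD//; last exact: bdd_meas_sum.
  by congr mean; apply/funext => x; rewrite big_cons pi.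
by congr mean; apply/funext => x; rewrite big_cons (negbTE pi).
Qed.

Lemma mean_indic (A : set T) : measurable A -> (mean \1_A)%:E = P A.
Proof.
move=> mA; rewrite -mean_EFin; last exact: bdd_meas_indic.
by rewrite integral_indic// setIT.
Qed.

Lemma le_mean f g : bdd_meas f -> bdd_meas g -> (forall x, f x <= g x) ->
  mean f <= mean g.
Proof.
by move=> bf bg fg; apply: le_Rintegral => //; exact: bdd_meas_integrable.
Qed.

Lemma ler_norm_mean f : bdd_meas f -> `|mean f| <= mean (fun x => `|f x|).
Proof.
by move=> bf; apply: le_normr_Rintegral => //; exact: bdd_meas_integrable.
Qed.

Lemma norm_meanB f g b : bdd_meas f -> bdd_meas g -> bdd_meas b ->
  (forall x, `|f x - g x| <= b x) -> `|mean f - mean g| <= mean b.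
Proof.
move=> bf bg bb fgb; rewrite -meanB//.
have bfg := bdd_measB bf bg.
apply: le_trans (ler_norm_mean bfg) _; apply: le_mean => //.
exact: bdd_meas_norm.
Qed.

End mean.

Section sparse_columns.
Context (R : realType) (m zeta : nat).
Hypotheses (zeta_gt0 : (0 < zeta)%N) (zeta_le : (zeta <= m)%N).

Local Notation A := (@sparse_sign_vectors R m zeta).

(** The entries are [0] or [+- 1 / sqrt zeta], and the norm is one. *)
Lemma sparse_sign_vectorsP (v : 'cV[R]_m) : A v <->
  (forall a, Num.sqrt zeta%:R * v a 0 \in [:: -1; 0; 1]) /\
  \sum_a (v a 0) ^+ 2 = 1.
Proof.
have z0 : 0 < zeta%:R :> R by rewrite ltr0n.
have sz0 : Num.sqrt zeta%:R != 0 :> R by rewrite gt_eqF// sqrtr_gt0.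
have E (f : 'cV[R]_m) : lpow 2 f = \sum_a f a 0 ^+ 2.
  apply: eq_bigr => a _; rewrite big_ord_recl big_ord0 addr0.
  by rewrite real_normK ?num_real.
split=> [[f [fa]]|[va v1]].
  rewrite E => f2 <-; split=> [a|]; first by rewrite mxE mulVKf.
  under eq_bigr do rewrite mxE exprMn.
  by rewrite -mulr_sumr f2 exprVn sqr_sqrtr ?mulVf ?gt_eqF// ltW.
exists (Num.sqrt zeta%:R *: v); last by rewrite scalerA mulVf// scale1r.
split=> [a|]; first by rewrite mxE.
rewrite E; under eq_bigr do rewrite mxE exprMn.
by rewrite -mulr_sumr v1 mulr1 sqr_sqrtr// ltW.
Qed.

Lemma finite_sparse_sign_vectors : finite_set A.
Proof.
pose g (t : {ffun 'I_m -> 'I_3}) : 'cV[R]_m :=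
  \col_a ((Num.sqrt zeta%:R)^-1 * ((t a)%:R - 1)).
apply: (@sub_finite_set _ _ [set g t | t in [set: {ffun 'I_m -> 'I_3}]]).
  move=> v [f [fa _] <-].
  exists [ffun a => if f a 0 == -1 then @Ordinal 3 0 isT
    else if f a 0 == 0 then @Ordinal 3 1 isT else @Ordinal 3 2 isT] => //.
  apply/colP => a; rewrite !mxE ffunE; congr (_ * _).
  move: (fa a); rewrite !inE; case: eqP => [->|_] /=; first by rewrite add0r.
  case: eqP => [->|_] /=; first by rewrite subrr.
  by move=> /eqP ->; ring.
exact/finite_image/finite_finset.
Qed.

Definition sparse_columns := fset_set A.

Lemma sparse_columnsP (v : 'cV[R]_m) : reflect (A v) (v \in sparse_columns).
Proof.
rewrite /sparse_columns in_fset_set; last exact: finite_sparse_sign_vectors.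
exact: asboolP.
Qed.

Definition col_entry (c : sparse_columns) (a : 'I_m) : R := (val c) a 0.

Lemma sparse_columns_involution (g : 'cV[R]_m -> 'cV[R]_m) :
  involutive g -> (forall v, A v -> A (g v)) ->
  exists2 f : sparse_columns -> sparse_columns, injective f &
    forall c, val (f c) = g (val c).
Proof.
move=> gK gA.
have gC (c : sparse_columns) : g (val c) \in sparse_columns.
  by apply/sparse_columnsP/gA/sparse_columnsP; exact: valP.
exists (fun c => [` gC c]%fset) => // c c' /(congr1 val)/= /(congr1 g).
by rewrite !gK => /val_inj.
Qed.

Let sign_opp (x : R) : x \in [:: -1; 0; 1] -> - x \in [:: -1; 0; 1].
Proof.
by rewrite !inE => /or3P[]/eqP ->; rewrite ?opprK ?oppr0 eqxx ?orbT.
Qed.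

Lemma col_entry_flip a : exists2 f : sparse_columns -> sparse_columns,
  injective f & forall c b, col_entry (f c) b = if b == a then - col_entry c b else col_entry c b.
Proof.
pose g (v : 'cV[R]_m) : 'cV[R]_m := \col_b (if b == a then - v b 0 else v b 0).
have [||f fi fg] := @sparse_columns_involution g.
- by move=> v; apply/colP => b; rewrite !mxE; case: eqP => // _; rewrite opprK.
- move=> v /sparse_sign_vectorsP[v1 v2]; apply/sparse_sign_vectorsP; split=> [b|].
    by rewrite mxE; case: eqP => // _; rewrite mulrN sign_opp.
  by rewrite -v2; apply: eq_bigr => b _; rewrite mxE; case: eqP => // _; rewrite sqrrN.
by exists f => // c b; rewrite /col_entry fg mxE.
Qed.

Lemma col_entry_swap a a' : exists2 f : sparse_columns -> sparse_columns,
  injective f & forall c b, col_entry (f c) b = col_entry c (tperm a a' b).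
Proof.
pose g (v : 'cV[R]_m) : 'cV[R]_m := \col_b v (tperm a a' b) 0.
have [||f fi fg] := @sparse_columns_involution g.
- by move=> v; apply/colP => b; rewrite !mxE tpermK.
- move=> v /sparse_sign_vectorsP[v1 v2]; apply/sparse_sign_vectorsP; split=> [b|].
    by rewrite mxE.
  rewrite -v2 [RHS](reindex_inj (@perm_inj _ (tperm a a'))).
  by apply: eq_bigr => b _; rewrite mxE.
by exists f => // c b; rewrite /col_entry fg mxE.
Qed.

Lemma col_entry_opp : exists2 f : sparse_columns -> sparse_columns,
  injective f & forall c b, col_entry (f c) b = - col_entry c b.
Proof.
have [||f fi fg] := @sparse_columns_involution -%R.
- exact: opprK.
- move=> v /sparse_sign_vectorsP[v1 v2]; apply/sparse_sign_vectorsP; split=> [b|].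
    by rewrite mxE mulrN sign_opp.
  by rewrite -v2; apply: eq_bigr => b _; rewrite mxE sqrrN.
by exists f => // c b; rewrite /col_entry fg mxE.
Qed.

Lemma col_entry_norm c : \sum_a col_entry c a ^+ 2 = 1.
Proof. by have /sparse_columnsP/sparse_sign_vectorsP[] := valP c. Qed.

Lemma col_entry_pow4 c a : col_entry c a ^+ 4 = col_entry c a ^+ 2 / zeta%:R.
Proof.
have z0 : 0 < zeta%:R :> R by rewrite ltr0n.
have sz2 : Num.sqrt zeta%:R ^+ 2 = zeta%:R :> R by rewrite sqr_sqrtr// ltW.
have /sparse_columnsP/sparse_sign_vectorsP[+ _] := valP c.
move=> /(_ a); rewrite -/(col_entry c a); move: (col_entry c a) => x xs.
apply: (mulfI (x := zeta%:R ^+ 2)); first by rewrite expf_neq0// gt_eqF.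
transitivity ((Num.sqrt zeta%:R * x) ^+ 4).
  by rewrite exprMn (exprM (Num.sqrt _) 2 2) sz2.
transitivity ((Num.sqrt zeta%:R * x) ^+ 2).
  move: xs; rewrite !inE => /or3P[]/eqP ->; first by rewrite -signr_odd expr0 -signr_odd expr0.
    by rewrite !expr0n.
  by rewrite !expr1n.
by rewrite exprMn sz2; field; rewrite gt_eqF.
Qed.

Lemma sparse_columns_inhab : sparse_columns.
Proof.
pose v : 'cV[R]_m := (Num.sqrt zeta%:R)^-1 *: \col_a (a < zeta)%N%:R.
suff vA : v \in sparse_columns by exact: [` vA]%fset.
apply/sparse_columnsP; exists (\col_a (a < zeta)%N%:R) => //; split=> [a|].
  by rewrite mxE !inE; case: (_ < _)%N; rewrite eqxx ?orbT.
rewrite /lpow; under eq_bigr => a _.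
  rewrite big_ord_recl big_ord0 addr0 mxE normr_nat.
  have -> : (a < zeta)%N%:R ^+ 2 = (if (a < zeta)%N then 1 else 0) :> R.
    by case: (_ < _)%N; rewrite ?expr1n ?expr0n.
  over.
rewrite -big_mkcond/= -(big_ord_widen m (fun=> 1)) //.
by rewrite sumr_const card_ord.
Qed.

Lemma sparse_kernel :
  isotropic_kernel
    (fun c c' : sparse_columns => Num.sqrt m%:R * dot (col_entry c) (col_entry c'))
    (Num.sqrt m%:R)^-1 (3 + m%:R / zeta%:R ^+ 2).
Proof.
exact: (isotropic_sign_kernel zeta_gt0 zeta_le col_entry_flip col_entry_swap
  col_entry_opp col_entry_norm col_entry_pow4 sparse_columns_inhab).
Qed.

Definition sketch n (w : {ffun 'I_n -> sparse_columns}) : 'M[R]_(m, n) :=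
  \matrix_(a, j) col_entry (w j) a.

End sparse_columns.

Section transfer.
Context (R : realType) d (T : measurableType d) (P : probability T R).
Context (m n zeta : nat) (S : {RV P >-> 'M[R]_(m, n)}).
Hypothesis Sse : sparse_sign_embedding zeta S.
Local Notation Om := {ffun 'I_n -> sparse_columns R m zeta}.

Lemma measurable_mx_set1 k l (M : 'M[R]_(k, l)) : measurable [set M].
Proof.
have -> : [set M] = \bigcap_(i in [set: 'I_k]) \bigcap_(j in [set: 'I_l])
   [set N : 'M[R]_(k, l) | [set M i j] (N i j)].
  apply/seteqP; split=> [N -> i _ j _//|N H]; apply/matrixP => i j.
  exact: H.
apply: fin_bigcap_measurable => // i _; apply: fin_bigcap_measurable => // j _.
by apply: sub_sigma_algebra; exists i, j, [set M i j].
Qed.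

Definition hits (w : Om) : set T := S @^-1` [set sketch w].

Lemma measurable_hits w : measurable (hits w).
Proof. by rewrite -[hits w]setTI; apply: measurable_funP => //; exact: measurable_mx_set1. Qed.

Lemma prob_hits w : mean P (\1_(hits w)) = #|Om|%:R^-1.
Proof.
case: Sse => /andP[z0 zm] Sind Sunif.
apply: EFin_inj; rewrite mean_indic; last exact: measurable_hits.
pose B (j : 'I_n) : set 'cV[R]_m := [set val (w j)].
have mB j : measurable (B j) by exact: measurable_mx_set1.
have -> : hits w = [set t | forall j, B j (col j (S t))].
  apply/seteqP; split=> t /=.
    move=> St j; rewrite /B/= St; apply/colP => a.
    by rewrite !mxE.
  move=> H; apply/matrixP => a j; have /colP/(_ a) := H j.
  by rewrite !mxE.
rewrite Sind// (eq_bigr (fun=> (#|` sparse_columns R m zeta|%:R^-1)%:E)); last first.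
  move=> j _; rewrite (Sunif j)// /B -/(sparse_columns R m zeta).
  have wA : @sparse_sign_vectors R m zeta (val (w j)) by apply/sparse_columnsP; exact: valP.
  rewrite (_ : _ `&` _ = [set val (w j)]); last first.
    by apply/seteqP; split=> [x [_ ->]//|x ->].
  by rewrite fset_set1 cardfs1 div1r.
by rewrite prodEFin prodr_const card_ord card_ffun card_ord natrX exprVn -cardfE.
Qed.

Lemma hits_disjoint w w' t : hits w t -> hits w' t -> w = w'.
Proof.
rewrite /hits/= => -> e; apply/ffunP => j; apply/val_inj/colP => a.
by have /matrixP/(_ a j) := e; rewrite !mxE.
Qed.

Lemma sum_hits_le1 (p : pred Om) t : \sum_(w | p w) \1_(hits w) t <= 1 :> R.
Proof.
have [[w wt]|nw] := pselect (exists w, hits w t); last first.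
  rewrite big1 ?ler01// => w _; rewrite indicE memNset// => wt.
  by apply: nw; exists w.
apply: (@le_trans _ _ (\sum_(w' in [set w]%SET) 1)); last first.
  by rewrite big_set1.
rewrite big_mkcond [leRHS]big_mkcond/=; apply: ler_sum => w' _.
rewrite inE indicE; have [->|ww'] := eqVneq w' w.
  by case: ifP => // _; case: (_ \in _).
rewrite memNset ?if_same// => w't.
by move/eqP: ww'; apply; exact: hits_disjoint w't wt.
Qed.

(** The columns of a sparse sign embedding are i.i.d. and uniform on a finite
    set, so expectations of functions of the sketch are plain averages over the
    finite set of all sketches. The variable [Y] is compared with [F] on the
    event [G] only; the complement contributes at most [2 M] times its
    probability. *)
Lemma mean_sketch (Y : T -> R) (F g : Om -> R) (G : pred Om) (M : R) :
  measurable_fun setT Y ->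
  (forall t, `|Y t| <= M) -> (forall w, `|F w| <= M) -> (forall w, 0 <= g w) ->
  (forall t w, G w -> S t = sketch w -> `|Y t - F w| <= g w) ->
  `|mean P Y - avg F| <= avg g + 2 * M * avg (fun w => (~~ G w)%:R).
Proof.
move=> mY YM FM g0 YF.
have bI w : bdd_meas (\1_(hits w) : T -> R).
  by apply: bdd_meas_indic; exact: measurable_hits.
have bY : bdd_meas Y by split => //; exists M.
have M0 : 0 <= M by exact: le_trans (normr_ge0 _) (YM point).
(* [pull f] is [f] of the sketch, and zero on the null set where [S] is not one
   of the expected matrices. *)
pose pull (f : Om -> R) t := \sum_w f w * \1_(hits w) t.
have bpull f : bdd_meas (pull f).
  by apply: bdd_meas_sum => w; exact: bdd_measZ.
have mean_pull f : mean P (pull f) = avg f.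
  rewrite /pull (mean_sum P _ _ (fun w => bdd_measZ _ (bI w))) /avg mulr_suml.
  by apply: eq_bigr => w _; rewrite meanZ// prob_hits.
pose b t := pull g t + 2 * M * (1 - \sum_(w | G w) \1_(hits w) t).
have bs : bdd_meas (fun t => \sum_(w | G w) \1_(hits w) t : R) by exact: bdd_meas_sum.
have b1 : bdd_meas (fun t => 1 - \sum_(w | G w) \1_(hits w) t : R).
  by apply: bdd_measB => //; exact: bdd_meas_cst.
have bb : bdd_meas b by apply: bdd_measD => //; exact: bdd_measZ.
rewrite -(mean_pull F).
have <- : mean P b = avg g + 2 * M * avg (fun w => (~~ G w)%:R).
  rewrite meanD//; last exact: bdd_measZ.
  rewrite mean_pull meanZ// meanB//; last exact: bdd_meas_cst.
  rewrite mean_cst (mean_sum P _ _ bI); congr (_ + _ * _).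
  have [w0] : inhabited Om.
    case: Sse => /andP[z0 zm] _ _; constructor.
    exact: [ffun=> sparse_columns_inhab R zm].
  have -> : \sum_(w | G w) mean P \1_(hits w) = avg (fun w : Om => (G w)%:R).
    rewrite /avg mulr_suml big_mkcond/=; apply: eq_bigr => w _.
    by rewrite prob_hits; case: (G w); rewrite ?mul1r ?mul0r.
  rewrite -{1}(avg_cst w0 1) -avgB; apply: eq_avg => w.
  by case: (G w); rewrite ?subrr ?subr0.
apply: norm_meanB => // t; rewrite /b.
have [[w wt]|nw] := pselect (exists w, hits w t); last first.
  have I0 w : \1_(hits w) t = 0 :> R.
    by rewrite indicE memNset// => wt; apply: nw; exists w.
  rewrite /pull !big1 ?subr0 ?add0r; last 3 first.
  - by move=> w _; rewrite I0 ?mulr0.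
  - by move=> w _; rewrite I0 ?mulr0.
  - by move=> w _; rewrite I0 ?mulr0.
  by rewrite mulr1 (le_trans (YM t))// ler_peMl// ler1n.
have I0 w' : w' != w -> \1_(hits w') t = 0 :> R.
  move=> ww'; rewrite indicE memNset// => w't.
  by move/eqP: ww'; apply; exact: hits_disjoint w't wt.
have pullE f : pull f t = f w.
  rewrite /pull (bigD1 w)//= big1 ?addr0 ?indicE ?mem_set ?mulr1//.
  by move=> w' ww'; rewrite I0 ?mulr0.
rewrite !pullE; have [Gw|Gw] := boolP (G w).
  apply: (le_trans (YF t w Gw wt)); rewrite lerDl.
  by rewrite mulr_ge0 ?mulr_ge0// subr_ge0 sum_hits_le1.
rewrite [X in 1 - X]big1; last first.
  by move=> w' Gw'; apply: I0; apply: contraTneq Gw' => ->.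
rewrite subr0 mulr1 (le_trans (ler_normB _ _))// ler_wpDl// mulr2n mulrDl mul1r.
by rewrite lerD.
Qed.

End transfer.

(** * The characteristic function of the standard normal law *)

Section standard_gaussian.
Context (R : realType).
Local Notation mu := (@lebesgue_measure R).
Local Notation gauss := (normal_prob 0 1 : probability (measurableTypeR R) R).
Local Notation pdf := (@normal_pdf R 0 1).

Let pdfE x : pdf x = normal_peak 1 * expR (- (x ^+ 2 / 2)).
Proof.
have -> : pdf x = normal_peak 1 * normal_fun 0 1 x by rewrite normal_pdfE ?oner_neq0.
by rewrite /normal_fun subr0 expr1n mulNr.
Qed.

Lemma integral_gauss_density (g : measurableTypeR R -> R) : bdd_meas g ->
  mean gauss g = (\int[mu]_x (g x * pdf x))%R.
Proof.
move=> bg; have gi := bdd_meas_integrable gauss bg.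
rewrite /mean /Rintegral; congr fine.
rewrite -(Radon_Nikodym_change_of_variables (normal_prob_dominates 0 1))//=.
have mg : measurable_fun setT (EFin \o g) by apply/measurable_EFinP; case: bg.
under [RHS]eq_integral do rewrite EFinM.
apply: ae_eq_integral => //.
- apply: emeasurable_funM => //; apply: (measurable_int mu).
  by apply: Radon_Nikodym_integrable; exact: normal_prob_dominates.
- apply: emeasurable_funM => //=; apply/measurableT_comp => //=.
  exact: measurable_normal_pdf.
- apply: ae_eqe_mul2l => /=.
  rewrite Radon_NikodymE//=; first exact: normal_prob_dominates.
  move=> abmu; case: cid => /= h [h1 h2 h3].
  apply: integral_ae_eq => //=.
  + by apply/measurableT_comp => //; exact: measurable_normal_pdf.
  + by move=> E _ mE; rewrite -h3.
Qed.

Let is_derive_pdf (x : R) : is_derive x 1 pdf (- x * pdf x).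
Proof.
have -> : pdf = normal_peak 1 *: (fun x => expR (- (x ^+ 2 / 2))) :> (R -> R).
  by apply/funext => y; rewrite pdfE.
have H : is_derive x 1 (fun x : R => - (x ^+ 2 / 2)) (- x).
  rewrite (_ : (fun x => _) = (- 2^-1) *: (id ^+ 2) :> (R -> R)); last first.
    by apply/funext => u; rewrite -[RHS]/(- 2^-1 * u ^+ 2) mulNr mulrC.
  by apply: is_derive_eq; rewrite /GRing.scale/= expr1 mulr1; field.
have H2 : is_derive x 1 (fun x : R => expR (- (x ^+ 2 / 2)))
    (expR (- (x ^+ 2 / 2)) * - x).
  exact: (is_derive1_comp (f := expR)).
apply: is_derive_eq; rewrite /GRing.scale/= /GRing.scale/=; ring.
Qed.

(* [1 + x^2/4 <= exp (x^2/4)] trades the factor [|x|] for a larger variance. *)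
Let norm_pdf_le x : `|x| * pdf x <=
  (normal_peak 1 / normal_peak (Num.sqrt 2)) * normal_pdf 0 (Num.sqrt 2) x.
Proof.
have s2 : Num.sqrt 2 != 0 :> R by rewrite gt_eqF// sqrtr_gt0.
have -> : normal_pdf 0 (Num.sqrt 2) x =
    normal_peak (Num.sqrt 2) * normal_fun 0 (Num.sqrt 2) x by rewrite normal_pdfE.
rewrite pdfE /normal_fun subr0 sqr_sqrtr//.
rewrite mulrA divfK; last by rewrite gt_eqF// normal_peak_gt0.
rewrite mulrCA ler_wpM2l ?normal_peak_ge0//.
have -> : - x ^+ 2 / (2 *+ 2) = x ^+ 2 / 4 + - (x ^+ 2 / 2).
  by rewrite -mulr_natr; field.
rewrite expRD ler_wpM2r ?expR_ge0//.
apply: le_trans (expR_ge1Dx _).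
have : 0 <= (`|x| / 2 - 1) ^+ 2 by exact: sqr_ge0.
have -> : x ^+ 2 = `|x| ^+ 2 by rewrite real_normK ?num_real.
nra.
Qed.

(** An integrable bound, uniform in [b], for [stein_integrand u b]. *)
Definition gauss_envelope (u x : R) : R :=
  (normal_peak 1 / normal_peak (Num.sqrt 2)) * normal_pdf 0 (Num.sqrt 2) x
  + `|u| * pdf x.

Let integrable_envelope u : mu.-integrable setT (EFin \o gauss_envelope u).
Proof.
rewrite /gauss_envelope /comp/=; under eq_fun do rewrite EFinD !EFinM.
by apply: integrableD => //; apply: integrableZl => //; exact: integrable_normal_pdf.
Qed.

Let pdf_ge0 x : 0 <= pdf x. Proof. exact: normal_pdf_ge0. Qed.

Let phase (u b x : R) := u * x + b.

Let is_derive_phase u b (x : R) : is_derive x 1 (phase u b) u.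
Proof.
rewrite (_ : phase u b = u *: id + cst b :> (R -> R)); last by apply/funext.
by apply: is_derive_eq; rewrite /GRing.scale/= mulr1 addr0.
Qed.

Let stein_integrand u b x :=
  - x * pdf x * sin (phase u b x) + u * cos (phase u b x) * pdf x.

Let is_derive_pdf_sin u b (x : R) :
  is_derive x 1 (fun x => pdf x * sin (phase u b x)) (stein_integrand u b x).
Proof.
have := is_derive_phase u b x; have := is_derive_pdf x => d1 d2.
have d3 : is_derive x 1 (fun x => sin (phase u b x)) (cos (phase u b x) * u).
  exact: (is_derive1_comp (f := sin)).
rewrite (_ : (fun x => pdf x * _) = pdf * (fun x => sin (phase u b x)) :> (R -> R)); last by [].
by apply: is_derive_eq; rewrite /GRing.scale/= /stein_integrand; ring.
Qed.

Let continuous_phase u b : continuous (phase u b).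
Proof. exact: (is_derive_continuous (is_derive_phase u b)). Qed.

Let continuous_pdf : continuous pdf.
Proof. exact: (is_derive_continuous is_derive_pdf). Qed.

Let continuous_stein_integrand u b : continuous (stein_integrand u b).
Proof.
move=> x; rewrite /stein_integrand.
have cs : {for x, continuous (fun x => sin (phase u b x))}.
  by apply: continuous_comp; [exact: continuous_phase|exact: continuous_sin].
have cc : {for x, continuous (fun x => cos (phase u b x))}.
  by apply: continuous_comp; [exact: continuous_phase|exact: continuous_cos].
apply: cvgD; apply: cvgM => //; try exact: continuous_pdf.
  by apply: cvgM; [apply: cvgN; exact: cvg_id|exact: continuous_pdf].
by apply: cvgM => //; exact: cvg_cst.
Qed.

Let norm_stein_integrand u b x : `|stein_integrand u b x| <= gauss_envelope u x.
Proof.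
rewrite /stein_integrand /gauss_envelope.
apply: (le_trans (ler_normD _ _)); apply: lerD.
  apply: le_trans (norm_pdf_le x).
  rewrite !normrM normrN (ger0_norm (pdf_ge0 x)) ler_piMr ?norm_sin_le1//.
  by rewrite mulr_ge0.
rewrite !normrM (ger0_norm (pdf_ge0 x)) ler_wpM2r//.
by rewrite ler_piMr ?norm_cos_le1.
Qed.

(** Stein's identity for the Gaussian density [pdf]: the integrand is the
    derivative of [pdf x * sin (u x + b)], which vanishes at infinity. *)
Lemma integral_stein_integrand u b : (\int[mu]_x (stein_integrand u b x)%:E = 0)%E.
Proof.
pose g := stein_integrand u b.
have mg : measurable_fun setT g.
  by apply: continuous_measurable_fun => x; exact: continuous_stein_integrand.
pose A (n : nat) : set R := `[- n.+1%:R, n.+1%:R]%classic.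
have AE n : (\int[mu]_(x in A n) (g x)%:E =
  (pdf n.+1%:R * sin (phase u b n.+1%:R))%:E
   - (pdf (- n.+1%:R) * sin (phase u b (- n.+1%:R)))%:E)%E.
  apply: (@continuous_FTC2 _ _ (fun x => pdf x * sin (phase u b x))).
  - by rewrite -subr_gt0 opprK addr_gt0.
  - exact/continuous_subspaceT/continuous_stein_integrand.
  - have c := is_derive_continuous (is_derive_pdf_sin u b).
    split; last 2 first.
    + exact/cvg_at_right_filter/c.
    + exact/cvg_at_left_filter/c.
    by move=> x _; case: (is_derive_pdf_sin u b x).
  - by move=> x _; rewrite derive1E; case: (is_derive_pdf_sin u b x).
have mgA n : measurable_fun setT (fun x => ((g \_ (A n)) x)%:E).
  apply/measurable_EFinP; apply/(measurable_restrictT _ _).1 ; first exact: measurable_itv.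
  exact: measurable_funTS.
have gA : {ae mu, forall x, setT x -> ((g \_ (A n)) x)%:E @[n --> \oo] --> (g x)%:E}.
  apply: aeW => x _ /=.
  apply: cvg_near_cst; near=> n; rewrite patchE mem_set// /A/= in_itv/= -ler_norml.
  near: n; have [N _ HN] := nbhs_infty_ger `|x|.
  exists N => // n /= Nn; apply: le_trans (HN _ Nn) _.
  by rewrite ler_nat.
have gle : {ae mu, forall x n, setT x ->
    (`|((g \_ (A n)) x)%:E| <= (EFin \o gauss_envelope u) x)%E}.
  apply: aeW => x n _ /=; rewrite lee_fin patchE; case: ifP => _.
    exact: norm_stein_integrand.
  rewrite normr0 addr_ge0// mulr_ge0// ?normal_pdf_ge0//.
  by rewrite divr_ge0// normal_peak_ge0.
have [_ _] := @dominated_convergence _ _ R mu setT measurableT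
  (fun n x => ((g \_ (A n)) x)%:E) (EFin \o g) (EFin \o gauss_envelope u) mgA
  ((measurable_EFinP _ _).2 mg) gA (integrable_envelope u) gle.
have -> : [sequence (\int[mu]_x ((g \_ (A n)) x)%:E)%E]_n =
          (fun n => \int[mu]_(x in A n) (g x)%:E)%E.
  apply/funext => n; rewrite [RHS]integral_mkcond/=; apply: eq_integral => x _.
  by rewrite restrict_EFin.
move=> H; apply: (cvg_unique (@ereal_hausdorff R) H).
rewrite (_ : (fun n => _) = EFin \o (fun n => pdf n.+1%:R * sin (phase u b n.+1%:R)
    - pdf (- n.+1%:R) * sin (phase u b (- n.+1%:R)))); last first.
  by apply/funext => n; exact: AE.
apply: cvg_EFin; first exact: nearW.
pose c := normal_peak 1 / normal_peak (Num.sqrt 2) * normal_peak (Num.sqrt 2) : R.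
have pb x : 0 < `|x| -> pdf x <= c * `|x|^-1.
  move=> x0; rewrite ler_pdivlMr// mulrC; apply: (le_trans (norm_pdf_le x)).
  rewrite /c ler_wpM2l//; first by rewrite divr_ge0// normal_peak_ge0.
  by apply: normal_pdf_ub; rewrite gt_eqF// sqrtr_gt0.
apply: (@squeeze_cvgr _ _ _ _ (fun n => - (2 * c * n.+1%:R^-1)) (fun n => 2 * c * n.+1%:R^-1)).
- apply: nearW => n; rewrite -ler_norml.
  apply: (le_trans (ler_normB _ _)); rewrite !normrM !(ger0_norm (pdf_ge0 _)).
  have h x : x = n.+1%:R \/ x = - n.+1%:R ->
      pdf x * `|sin (phase u b x)| <= c * n.+1%:R^-1.
    move=> hx; have nx : `|x| = n.+1%:R.
      by case: hx => ->; rewrite ?normrN normr_nat.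
    by rewrite -nx (le_trans (ler_piMr _ (norm_sin_le1 _)))// pb// nx.
  by rewrite -mulrA mulr2n mulrDl !mul1r lerD//; apply: h; [left|right].
- rewrite -oppr0; apply: cvgN; rewrite -(mulr0 (2 * c)).
  by apply: cvgMl_tmp; exact: cvg_harmonic.
- by rewrite -(mulr0 (2 * c)); apply: cvgMl_tmp; exact: cvg_harmonic.
Unshelve. all: end_near. Qed.

Let integrable_dominated u (g : R -> R) : continuous g ->
  (forall x, `|g x| <= gauss_envelope u x) -> mu.-integrable setT (EFin \o g).
Proof.
move=> cg gle; apply: le_integrable (integrable_envelope u) => //.
  by apply/measurable_EFinP; exact: continuous_measurable_fun.
move=> x _ /=; rewrite lee_fin (le_trans (gle x))// ler_norm//.
Qed.

Let wave (u b t x : R) := cos (phase (t * u) b x) * pdf x.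

Let continuous_wave u b t : continuous (wave u b t).
Proof.
move=> x; apply: cvgM; last exact: continuous_pdf.
by apply: continuous_comp; [exact: continuous_phase|exact: continuous_cos].
Qed.

Let integrable_wave u b t : mu.-integrable setT (EFin \o wave u b t).
Proof.
apply: (@integrable_dominated 1) => [|x]; first exact: continuous_wave.
rewrite /gauss_envelope normr1 mul1r ler_wpDl//.
  rewrite mulr_ge0// ?divr_ge0 ?normal_peak_ge0//.
  exact: normal_pdf_ge0.
by rewrite normrM (ger0_norm (pdf_ge0 x)) ler_piMl// norm_cos_le1.
Qed.

Let wave_derive u b (t x : R) : is_derive t 1 (fun t => wave u b t x)
  (u * stein_integrand (t * u) b x - u ^+ 2 * t * wave u b t x).
Proof.
have d1 : is_derive t 1 (fun t => phase (t * u) b x) (u * x).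
  rewrite (_ : (fun t => _) = phase (u * x) b); first exact: is_derive_phase.
  by apply/funext => y; rewrite /phase; ring.
have d2 : is_derive t 1 (fun t => cos (phase (t * u) b x))
    (- sin (phase (t * u) b x) * (u * x)).
  exact: (is_derive1_comp (f := cos)).
rewrite (_ : (fun t => _) = pdf x *: (fun t => cos (phase (t * u) b x)) :> (R -> R)).
  apply: is_derive_eq; rewrite /GRing.scale/= /stein_integrand /wave; ring.
by apply/funext => y; rewrite /wave /GRing.scale/= mulrC.
Qed.

Lemma bdd_meas_wave1 (u b : R) :
  bdd_meas (fun x : measurableTypeR R => cos (u * x + b)).
Proof.
split; last by exists 1 => x; exact: norm_cos_le1.
apply: continuous_measurable_fun => x.
by apply: (@continuous_comp _ _ _ (phase u b)); [exact: continuous_phase|exact: continuous_cos].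
Qed.

(** By Stein's identity, the integral of [cos (t u x + b)] satisfies the
    Gaussian differential equation in [t] without defect. *)
Lemma char_gauss (u b : R) :
  mean gauss (fun x => cos (u * x + b)) = cos b * expR (- (u ^+ 2 / 2)).
Proof.
have bw := bdd_meas_wave1 u b.
pose phi (t : R) := (\int[mu]_x wave u b t x)%R.
have -> : mean gauss (fun x => cos (u * x + b)) = phi 1.
  by rewrite integral_gauss_density// /phi; apply: eq_Rintegral => x _; rewrite /wave /phase mul1r.
have dphi (t : R) : is_derive t 1 phi (- (u ^+ 2 * t * phi t)).
  have d1E s x : partial1of2 (wave u b) s x =
      u * stein_integrand (s * u) b x - u ^+ 2 * s * wave u b s x.
    by rewrite partial1of2E; case: (wave_derive u b s x).
  have tI : (`]t - 1, t + 1[%classic : set R) t.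
    by rewrite /= in_itv/= ltrBlDr ltrDl ltr01.
  have Iwave s : (`]t - 1, t + 1[%classic : set R) s -> mu.-integrable setT (EFin \o wave u b s).
    by move=> _; exact: integrable_wave.
  have dwave s x : (`]t - 1, t + 1[%classic : set R) s -> setT x -> derivable ((wave u b) ^~ x) s 1.
    by move=> _ _; case: (wave_derive u b s x).
  have G0 x : 0 <= `|u| * gauss_envelope 0 x.
    rewrite mulr_ge0// addr_ge0// mulr_ge0//; last exact: normal_pdf_ge0.
    by rewrite divr_ge0// normal_peak_ge0.
  have iG : mu.-integrable setT (EFin \o (fun x => `|u| * gauss_envelope 0 x)).
    rewrite /comp; under eq_fun do rewrite EFinM.
    by apply: integrableZl => //; exact: integrable_envelope.
  have Gub s x : (`]t - 1, t + 1[%classic : set R) s -> setT x ->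
      `|partial1of2 (wave u b) s x| <= `|u| * gauss_envelope 0 x.
    move=> _ _; rewrite d1E.
    have -> : u * stein_integrand (s * u) b x - u ^+ 2 * s * wave u b s x =
        u * (- sin (phase (s * u) b x) * (x * pdf x)).
      by rewrite /stein_integrand /wave; ring.
    rewrite normrM ler_wpM2l// /gauss_envelope normr0 mul0r addr0.
    apply: le_trans (norm_pdf_le x).
    rewrite !normrM normrN (ger0_norm (pdf_ge0 x)) ler_piMl ?norm_sin_le1//.
    by rewrite mulr_ge0.
  have phid := derivable_under_integral measurableT tI Iwave dwave G0 iG Gub.
  have phiD := differentiation_under_integral measurableT tI Iwave dwave G0 iG Gub.
  apply: DeriveDef => //; rewrite -derive1E phiD.
  have iS : mu.-integrable setT (EFin \o stein_integrand (t * u) b).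
    apply: (@integrable_dominated (t * u)); first exact: continuous_stein_integrand.
    exact: norm_stein_integrand.
  rewrite (@eq_Rintegral _ _ _ mu setT (fun x =>
    u * stein_integrand (t * u) b x - u ^+ 2 * t * wave u b t x)); last first.
    by move=> x _; rewrite d1E.
  have iw := integrable_wave u b t.
  rewrite RintegralB//=; last 2 first.
  - by rewrite /comp; under eq_fun do rewrite EFinM; apply: integrableZl.
  - by rewrite /comp; under eq_fun do rewrite EFinM; apply: integrableZl.
  rewrite RintegralZl// RintegralZl//.
  rewrite [X in u * X](_ : _ = 0) ?mulr0 ?sub0r//.
  by rewrite /Rintegral integral_stein_integrand.
have u0 : 0 <= u ^+ 2 by exact: sqr_ge0.
have := gaussian_ode u0 dphi (e := 0).
have -> : phi 0 = cos b.
  rewrite -[RHS](mean_cst gauss) integral_gauss_density; last exact: bdd_meas_cst.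
  by apply: eq_Rintegral => x _; rewrite /wave /phase mul0r mul0r add0r.
move=> H; apply/eqP; rewrite -subr_eq0 -normr_le0; apply: H => t _.
by rewrite addNr normr0.
Qed.

Definition inner q (t v : 'cV[R]_q) : R := \sum_i t i 0 * v i 0.

Lemma measurable_inner q (t : 'cV[R]_q) : measurable_fun setT (inner t).
Proof.
apply: measurable_sum => i; apply: measurable_funM => //.
exact: measurable_mx_entry.
Qed.

Lemma bdd_meas_wave q (t : 'cV[R]_q) b : bdd_meas (fun v => cos (inner t v + b)).
Proof.
split; last by exists 1 => v; exact: norm_cos_le1.
have mc : measurable_fun setT (@cos R) by apply: continuous_measurable_fun; exact: continuous_cos.
by apply: (measurableT_comp mc); apply: measurable_funD => //; exact: measurable_inner.
Qed.

Lemma char_std_normal q (t : 'cV[R]_q) (b : R) :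
  mean (std_normal R q) (fun v => cos (inner t v + b)) =
  cos b * expR (- ((\sum_i t i 0 ^+ 2) / 2)).
Proof.
elim: q t b => [|q IH] t b.
  rewrite big_ord0 mul0r oppr0 expR0 mulr1 -[RHS](mean_cst (std_normal R 0)).
  by congr mean; apply/funext => v; rewrite /inner big_ord0 add0r.
apply: EFin_inj; rewrite -mean_EFin; last exact: bdd_meas_wave.
pose f (z : measurableTypeR R * 'cV[R]_q) := cos (inner t (vcons z) + b).
have bf : bdd_meas f.
  have [mc bc] := bdd_meas_wave t b; split; last by exists 1 => v; exact: norm_cos_le1.
  exact: (measurableT_comp mc (@measurable_vcons R q)).
pose t' : 'cV[R]_q := \col_i t (lift ord0 i) 0.
have fE x v : f (x, v) = cos (inner t' v + (t ord0 0 * x + b)).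
  rewrite /f /inner big_ord_recl vcons0 -addrA addrCA; congr (cos (_ + _)).
  by apply: eq_bigr => i _; rewrite vcons_lift mxE.
have mf := bdd_meas_integrable (gauss \x std_normal R q)%E bf.
rewrite /= integral_distribution//; last first.
  by apply/measurable_EFinP; case: (bdd_meas_wave t b).
transitivity (\int[(gauss \x std_normal R q)%E]_z (f z)%:E)%E; first by [].
rewrite -(integral12_prod_meas1 mf) /fubini_F.
under eq_integral => x _.
  under eq_integral do rewrite /= fE.
  rewrite mean_EFin; last exact: bdd_meas_wave.
  rewrite IH.
  over.
have bw := bdd_meas_wave1 (t ord0 0) b.
set K := expR _.
rewrite (_ : (fun x => _) = (fun x => (K * cos (t ord0 0 * x + b))%:E)); last first.
  by apply/funext => x; rewrite mulrC.
rewrite mean_EFin; last exact: bdd_measZ.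
rewrite meanZ// char_gauss big_ord_recl mulrCA -expRD; congr (_ * expR _)%:E.
rewrite (eq_bigr (fun i => t (lift ord0 i) 0 ^+ 2)); last by move=> i _; rewrite mxE.
by field.
Qed.

End standard_gaussian.

(** * Levy's continuity theorem *)

Section trigonometric_polynomials.
Context (R : realType) (q : nat).
Implicit Types (f g : 'cV[R]_q -> R).

(** The phase [b] makes real cosines suffice: sines and products of cosines are
    again in the span. *)
Inductive trig_poly : ('cV[R]_q -> R) -> Prop :=
| trig_wave t b : trig_poly (fun v => cos (inner t v + b))
| trig_add f g : trig_poly f -> trig_poly g -> trig_poly (fun v => f v + g v)
| trig_scale k f : trig_poly f -> trig_poly (fun v => k * f v).

Lemma trig_cst k : trig_poly (fun=> k).
Proof.
have := trig_scale k (trig_wave 0 0); congr trig_poly; apply/funext => v.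
by rewrite /inner big1 ?addr0 ?cos0 ?mulr1// => i _; rewrite mxE mul0r.
Qed.

Lemma innerD (t t' v : 'cV[R]_q) : inner (t + t') v = inner t v + inner t' v.
Proof. by rewrite /inner -big_split; apply: eq_bigr => i _; rewrite mxE mulrDl. Qed.

Lemma innerN (t v : 'cV[R]_q) : inner (- t) v = - inner t v.
Proof. by rewrite /inner -sumrN; apply: eq_bigr => i _; rewrite mxE mulNr. Qed.

(** [2 cos x cos y = cos (x + y) + cos (x - y)]. *)
Lemma trig_mul f g : trig_poly f -> trig_poly g -> trig_poly (fun v => f v * g v).
Proof.
move=> tf; elim: tf g => {f} [t b|f1 f2 _ IH1 _ IH2|k f _ IH] g tg; last 2 first.
- have := trig_add (IH1 g tg) (IH2 g tg); congr trig_poly.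
  by apply/funext => v; rewrite mulrDl.
- have := trig_scale k (IH g tg); congr trig_poly.
  by apply/funext => v; rewrite mulrA.
elim: tg => {g} [t' b'|g1 g2 _ IH1 _ IH2|k g _ IH]; last 2 first.
- have := trig_add IH1 IH2; congr trig_poly.
  by apply/funext => v; rewrite mulrDr.
- have := trig_scale k IH; congr trig_poly.
  by apply/funext => v; rewrite mulrCA.
have := trig_scale 2^-1 (trig_add (trig_wave (t + t') (b + b')) (trig_wave (t - t') (b - b'))).
congr trig_poly; apply/funext => v; rewrite !innerD innerN.
rewrite addrACA [_ - _ + (b - b')]addrACA -opprD cosB.
by rewrite [cos (_ + (_ + _))]cosD; field.
Qed.

Lemma trig_sin_coord (k : R) i : trig_poly (fun v => sin (k * v i 0)).
Proof.
have := trig_wave (\col_j (if j == i then k else 0)) (- (pi / 2)).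
congr trig_poly; apply/funext => v; rewrite cosBpihalf; congr sin.
rewrite /inner (bigD1 i)//= mxE eqxx big1 ?addr0// => j /negbTE ji.
by rewrite mxE ji mul0r.
Qed.

Lemma trig_poly_bdd_meas f : trig_poly f -> bdd_meas f.
Proof.
elim=> [t b|g h _ bg _ bh|k g _ bg].
- exact: bdd_meas_wave.
- exact: bdd_measD.
- exact: bdd_measZ.
Qed.

End trigonometric_polynomials.

Section lazy_walk.
Context (R : realType) (q : nat) (step : R).
Implicit Types (s : 'I_q -> R) (F : 'rV[R]_q -> R) (z : 'rV[R]_q).

(** The expectation of [F] at the end of a random walk that starts from [z]
    and, for each index [i] of the list, moves by [step] along the [i]-th axis
    with probability [s i]; with [N] steps of length [1/N] along every axis it
    is the multivariate Bernstein polynomial of [F] in [s]. *)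
Fixpoint walk s (l : seq 'I_q) F z : R :=
  if l is i :: l' then
    s i * walk s l' F (z + step *: delta_mx 0 i) + (1 - s i) * walk s l' F z
  else F z.

Lemma le_walk s l F G : (forall i, 0 <= s i <= 1) ->
  (forall z, F z <= G z) -> forall z, walk s l F z <= walk s l G z.
Proof.
move=> s01 FG; elim: l => [//|i l IH] z /=.
have /andP[s0 s1] := s01 i.
by rewrite lerD// ler_wpM2l// subr_ge0.
Qed.

Lemma walkD s l F G z :
  walk s l (fun x => F x + G x) z = walk s l F z + walk s l G z.
Proof. by elim: l z => [//|i l IH] z /=; rewrite !IH; ring. Qed.

Lemma walkZ s l k F z : walk s l (fun x => k * F x) z = k * walk s l F z.
Proof. by elim: l z => [//|i l IH] z /=; rewrite !IH; ring. Qed.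

Lemma walk_cst s l k z : walk s l (fun=> k) z = k.
Proof. by elim: l z => [//|i l IH] z /=; rewrite !IH; ring. Qed.

Lemma walk_sum s l (I : Type) (r : seq I) (F : I -> 'rV[R]_q -> R) z :
  walk s l (fun x => \sum_(j <- r) F j x) z = \sum_(j <- r) walk s l (F j) z.
Proof.
elim: r => [|j r IH].
  rewrite big_nil -[RHS](walk_cst s l 0 z); congr walk.
  by apply/funext => x; rewrite big_nil.
rewrite big_cons -IH -walkD; congr walk.
by apply/funext => x; rewrite big_cons.
Qed.

Lemma norm_walk s l F (M : R) z : (forall i, 0 <= s i <= 1) ->
  (forall z, `|F z| <= M) -> `|walk s l F z| <= M.
Proof.
move=> s01 FM; rewrite ler_norml -{1}(walk_cst s l (- M) z).
rewrite -{2}(walk_cst s l M z); apply/andP.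
by split; apply: le_walk => // x; have := FM x; rewrite ler_norml => /andP[].
Qed.

(** Bias and variance of the final position in a coordinate direction. *)
Lemma walk_sqr s l i (a : R) z :
  walk s l (fun x => (x 0 i - a) ^+ 2) z =
  (z 0 i + (count_mem i l)%:R * step * s i - a) ^+ 2
  + (count_mem i l)%:R * step ^+ 2 * (s i * (1 - s i)).
Proof.
elim: l z => [|j l IH] z /=; first by rewrite !mul0r !addr0.
rewrite !IH !mxE /= natrD; have [->|ji] := eqVneq j i => /=; by ring.
Qed.

Lemma trig_walk (s : 'I_q -> 'cV[R]_q -> R) l F z : (forall i, trig_poly (s i)) ->
  trig_poly (fun v => walk (s^~ v) l F z).
Proof.
move=> ts; elim: l z => [|i l IH] z /=; first exact: trig_cst.
apply: trig_add; first by apply: trig_mul => //; exact: IH.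
apply: trig_mul; last exact: IH.
have := trig_add (trig_cst q 1) (trig_scale (-1) (ts i)); congr trig_poly.
by apply/funext => v; rewrite mulN1r.
Qed.

End lazy_walk.

Section trigonometric_approximation.
Context (R : realType) (q : nat).

Lemma mx_continuousP (T : topologicalType) k l (f : T -> 'M[R]_(k, l)) :
  (forall i j, continuous (fun x => f x i j)) -> continuous f.
Proof.
move=> cf x; apply/cvg_ballP => e e0.
have H i j : \forall y \near x, ball (f x i j) e (f y i j).
  by have /cvg_ballP/(_ e e0) := cf i j x.
have FF : Filter (nbhs x) by exact: nbhs_filter.
have := filter_forall FF (fun i => filter_forall FF (H i)).
by apply: filterS => y fy; split.
Qed.

Lemma uniform_continuity_cube (F : 'rV[R]_q -> R) (e : R) : 0 < e -> continuous F ->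
  exists2 eta : R, 0 < eta & forall s z : 'rV[R]_q,
    (forall i, 0 <= s 0 i <= 1) -> (forall i, `|z 0 i - s 0 i| < eta) ->
    `|F s - F z| <= e.
Proof.
move=> e0 cF.
have cK : compact [set s : 'rV[R]_q | forall i, `[0, 1]%classic (s 0 i)].
  exact: (@rV_compact R q (fun=> `[0, 1]%classic) (fun=> @segment_compact R 0 1)).
pose P (eta : R) (s : 'rV[R]_q) :=
  forall z : 'rV[R]_q, (forall i, `|z 0 i - s 0 i| < eta) -> `|F s - F z| <= e.
have H : \forall eta \near 0^'+,
    [set s : 'rV[R]_q | forall i, `[0, 1]%classic (s 0 i)] `<=` P eta.
  apply: ((compact_near_coveringP _).1 cK R (0^'+) P) => s0 _.
  have e20 : 0 < e / 2 by rewrite divr_gt0.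
  have /cvgrPdist_lt/(_ _ e20) := cF s0.
  move=> /nbhs_ballP[r /= r0 rF].
  exists (ball s0 (r / 2), [set eta | 0 < eta < r / 2]) => /=.
    split; first by apply: nbhsx_ballx; rewrite divr_gt0.
    near=> eta => /=; apply/andP; split; near: eta; first exact: nbhs_right_gt.
    by apply: nbhs_right_lt; rewrite divr_gt0.
  move=> [s eta] /= [[_ ss0] /andP[eta0 etar]] z zs.
  have Fs : `|F s0 - F s| < e / 2.
    apply: rF; split => // i j; apply: le_ball (ss0 i j).
    by rewrite ler_pdivrMr// ler_peMr ?ler1n// ltW.
  have Fz : `|F s0 - F z| < e / 2.
    apply: rF; split => // i j; rewrite (splitr r).
    apply: (ball_triangle (ss0 i j)); rewrite (ord1 i) /ball/= distrC.
    exact: lt_trans (zs j) etar.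
  rewrite (_ : F s - F z = (F s0 - F z) - (F s0 - F s)); last by ring.
  by rewrite (le_trans (ler_normB _ _))// (splitr e) lerD// ltW.
have : \forall eta \near 0^'+, 0 < eta /\
    [set s : 'rV[R]_q | forall i, `[0, 1]%classic (s 0 i)] `<=` P eta.
  by near=> eta; split; near: eta; [exact: nbhs_right_gt|exact: H].
move=> /filter_ex[eta [eta0 Peta]]; exists eta => // s z s01 zs.
by apply: Peta zs => i; rewrite /= in_itv/=.
Unshelve. all: end_near. Qed.

(** Multivariate Bernstein approximation, in the variables [s i]; the bound on
    the walk is Chebyshev's inequality. *)
Lemma walk_approximation (F : 'rV[R]_q -> R) (M e : R) : 0 < e -> continuous F ->
  (forall z, `|F z| <= M) ->
  exists (N : nat), forall s : 'I_q -> R, (forall i, 0 <= s i <= 1) ->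
    `|F (\row_i s i) -
      walk N.+1%:R^-1 s (flatten (nseq N.+1 (enum 'I_q))) F 0| <= e.
Proof.
move=> e0 cF FM; have M0 : 0 <= M by exact: le_trans (normr_ge0 _) (FM 0).
have e20 : 0 < e / 2 by rewrite divr_gt0.
have [eta eta0 Feta] := uniform_continuity_cube e20 cF.
pose c := 2 * M / eta ^+ 2.
have c0 : 0 <= c by apply: divr_ge0; [exact: mulr_ge0|exact: sqr_ge0].
have [N cN] : exists N : nat, c * q%:R <= e / 2 * N.+1%:R.
  exists (Num.truncn (c * q%:R / (e / 2))).
  rewrite [e / 2 * _]mulrC -ler_pdivrMr//; apply: ltW.
  by have /andP[] := truncn_itv (divr_ge0 (mulr_ge0 c0 (ler0n R q)) (ltW e20)).
exists N => s s01; set l := flatten _; set st := N.+1%:R^-1.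
have lN i : count_mem i l = N.+1.
  rewrite /l; elim: (N.+1) => [//|k IH] /=.
  by rewrite count_cat IH count_uniq_mem ?enum_uniq// mem_enum.
set s' := \row_i s i.
have bound z : `|F s' - F z| <= e / 2 + c * \sum_i (z 0 i - s i) ^+ 2.
  have S0 : 0 <= \sum_i (z 0 i - s i) ^+ 2 by apply: sumr_ge0 => i _; exact: sqr_ge0.
  have [H|] := pselect (forall i, `|z 0 i - s' 0 i| < eta).
    apply: (@le_trans _ _ (e / 2)); last by rewrite lerDl mulr_ge0.
    by apply: Feta => // i; rewrite mxE.
  move=> /existsNP[i /negP]; rewrite -leNgt mxE => Hi.
  apply: (le_trans (ler_normB _ _)); apply: (@le_trans _ _ (M + M)); first exact: lerD.
  apply: (@le_trans _ _ (c * \sum_i (z 0 i - s i) ^+ 2)); last by rewrite lerDr ltW.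
  apply: (@le_trans _ _ (c * eta ^+ 2)).
    by rewrite /c divfK ?expf_neq0 ?gt_eqF// mulr2n mulrDl mul1r.
  rewrite ler_wpM2l// (bigD1 i)//= ler_wpDr//.
    by apply: sumr_ge0 => j _; exact: sqr_ge0.
  rewrite -[leRHS]real_normK ?num_real// lerXn2r// ?nnegrE ?normr_ge0//.
  exact: ltW.
have -> : F s' - walk st s l F 0 = walk st s l (fun z => F s' + -1 * F z) 0.
  by rewrite walkD walk_cst walkZ mulN1r.
have step1 (G : 'rV[R]_q -> R) : (forall z, `|F s' - F z| <= G z) ->
    `|walk st s l (fun z => F s' + -1 * F z) 0| <= walk st s l G 0.
  move=> FG; rewrite ler_norml -[- walk _ _ _ G _]mulN1r -walkZ; apply/andP; split;
    by apply: le_walk => // z; have := FG z; rewrite ler_norml => /andP[? ?]; lra.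
apply: (le_trans (step1 _ bound)).
rewrite walkD walk_cst walkZ walk_sum [leRHS]splitr lerD2l.
have stN : N.+1%:R * st = 1 by rewrite divff// pnatr_eq0.
have stN2 : N.+1%:R * st ^+ 2 = st by rewrite expr2 mulrA stN mul1r.
apply: (@le_trans _ _ (c * \sum_(i < q) st)).
  rewrite ler_wpM2l//; apply: ler_sum => i _; rewrite walk_sqr lN stN !mxE.
  have st0 : 0 <= st by rewrite invr_ge0.
  rewrite add0r mul1r subrr expr0n add0r stN2.
  have /andP[s0 s1] := s01 i; rewrite ler_piMr// mulr_ile1 ?subr_ge0//.
  by rewrite gerBl.
by rewrite sumr_const card_ord -[st *+ _]mulr_natr mulrCA mulrC ler_pdivrMr.
Qed.

(** A continuous left inverse of [x |-> (1 + sin (x / L)) / 2] on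
    [|x| <= L / 2], clamped outside so that it is defined everywhere. *)
Definition unfold_sin (L x : R) : R :=
  L * asin (Num.max (- sin (1 / 2)) (Num.min (sin (1 / 2)) (2 * x - 1))).

Let sin_half_gt0 : 0 < sin (1 / 2) :> R.
Proof.
apply: sin_gt0_pihalf; rewrite divr_gt0//=.
by have := @pihalf_ge1 R; lra.
Qed.

Let sin_half_lt1 : sin (1 / 2) < 1 :> R.
Proof.
have h : 1 <= pi / 2 :> R := pihalf_ge1 R.
by rewrite -[ltRHS](@sin_pihalf R) ltr_sin ?in_itv/=; [lra|apply/andP; split; lra|apply/andP; split; lra].
Qed.

Lemma unfold_sin_continuous L : continuous (unfold_sin L).
Proof.
move=> x; rewrite /unfold_sin; apply: cvgM; first exact: cvg_cst.
apply: continuous_comp; last first.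
  apply: continuous_asin; apply/andP; split.
    by rewrite lt_max ltrN2 sin_half_lt1.
  rewrite gt_max gt_min sin_half_lt1/= andbT.
  by have := sin_half_gt0; lra.
apply: (@continuous_max _ _ (fun=> _)); first exact: cvg_cst.
apply: (@continuous_min _ _ (fun=> _)); first exact: cvg_cst.
apply: cvgB; last exact: cvg_cst.
by apply: cvgM; [exact: cvg_cst|exact: cvg_id].
Qed.

Lemma unfold_sinK (L x : R) : 0 < L -> `|x| <= L / 2 ->
  unfold_sin L (2^-1 + 2^-1 * sin (L^-1 * x)) = x.
Proof.
move=> L0 xL; have h : 1 <= pi / 2 :> R := pihalf_ge1 R.
rewrite /unfold_sin (_ : 2 * _ - 1 = sin (L^-1 * x)); last by field.
have : `|L^-1 * x| <= 1 / 2.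
  by rewrite normrM gtr0_norm ?invr_gt0// mulrC ler_pdivrMr// mulrC mulrA mulr1.
rewrite ler_norml => /andP[x1 x2].
have in1 (y : R) : - (1 / 2) <= y -> y <= 1 / 2 -> y \in `[- (pi / 2), pi / 2].
  by move=> y1 y2; rewrite in_itv/=; apply/andP; split; lra.
have half_in : (1 / 2 : R) \in `[- (pi / 2), pi / 2] by apply: in1; lra.
have sle y z : y \in `[- (pi / 2), pi / 2] -> z \in `[- (pi / 2), pi / 2] ->
    (sin y <= sin z) = (y <= z) :> bool.
  by move=> yi zi; rewrite !leNgt ltr_sin.
have h1 : sin (L^-1 * x) <= sin (1 / 2) by rewrite sle// in1.
have h2 : - sin (1 / 2) <= sin (L^-1 * x).
  by rewrite -sinN sle ?in1//; lra.
rewrite (min_r h1) (max_r h2).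
by rewrite sinK ?in1// mulrA divff ?mul1r// gt_eqF.
Qed.

(** The Bernstein polynomial of [f], read in the variables
    [s i = (1 + sin (v i / L)) / 2], is a trigonometric polynomial. Being an
    average of values of [f], it keeps the bound [M] on the whole space, which
    is what controls the tails in Levy's theorem. *)
Lemma trig_approximation (f : 'cV[R]_q -> R) (M K e : R) :
  0 < e -> 0 < K -> continuous f -> (forall v, `|f v| <= M) ->
  exists2 g : 'cV[R]_q -> R, trig_poly g & (forall v, `|g v| <= M) /\
    (forall v : 'cV[R]_q, (forall i, `|v i 0| <= K) -> `|f v - g v| <= e).
Proof.
move=> e0 K0 cf fM.
pose L := 2 * K; have L0 : 0 < L by rewrite mulr_gt0.
pose F (z : 'rV[R]_q) := f (\col_i unfold_sin L (z 0 i)).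
have cF : continuous F.
  move=> z; apply: continuous_comp; last exact: cf.
  apply: (@mx_continuousP 'rV[R]_q q 1 (fun z : 'rV[R]_q => \col_i unfold_sin L (z 0 i))) => i j.
  under [X in continuous X]eq_fun do rewrite mxE.
  move=> y; apply: (@continuous_comp _ _ _ (fun z : 'rV[R]_q => z 0 i) (unfold_sin L)).
    exact: (@coord_continuous R 1 q 0 i y).
  exact: unfold_sin_continuous.
have FM z : `|F z| <= M by exact: fM.
have [N HN] := walk_approximation e0 cF FM.
pose s (v : 'cV[R]_q) i := 2^-1 + 2^-1 * sin (L^-1 * v i 0).
have s01 v i : 0 <= s v i <= 1.
  have := sin_geN1 (L^-1 * v i 0); have := sin_le1 (L^-1 * v i 0).
  by rewrite /s => ? ?; apply/andP; split; lra.
exists (fun v => walk N.+1%:R^-1 (s v) (flatten (nseq N.+1 (enum 'I_q))) F 0).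
  apply: (@trig_walk R q _ (fun i v => s v i)) => i.
  apply: trig_add; first exact: trig_cst.
  by apply: trig_scale; exact: trig_sin_coord.
split=> [v|v vK]; first exact: norm_walk.
rewrite [f v](_ : _ = F (\row_i s v i)); first exact: HN.
rewrite /F; congr f; apply/colP => i; rewrite !mxE unfold_sinK//.
by rewrite /L mulrC mulrA mulVf ?mul1r.
Qed.

(** On the sigma-algebra generated by the entries, continuous functions are
    measurable as pointwise limits of trigonometric polynomials. *)
Lemma continuous_bdd_meas (f : 'cV[R]_q -> R) : continuous f ->
  (exists M, forall v, `|f v| <= M) -> bdd_meas f.
Proof.
move=> cf [M fM]; split; last by exists M.
have n0 (n : nat) : 0 < n.+1%:R :> R by rewrite ltr0n.
have H (n : nat) : exists g : 'cV[R]_q -> R, trig_poly g /\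
    (forall v : 'cV[R]_q, (forall i, `|v i 0| <= n.+1%:R) -> `|f v - g v| <= n.+1%:R^-1).
  have [|g tg [_ gf]] := trig_approximation (e := n.+1%:R^-1) _ (n0 n) cf fM.
    by rewrite invr_gt0.
  by exists g.
have [g gP] := choice H.
apply: (@measurable_fun_cvg _ _ _ _ g) => [n|v _].
  by have [/trig_poly_bdd_meas[]] := gP n.
apply/cvgrPdist_le => e e0.
have Hv : \forall n \near \oo, forall i, `|v i 0| <= n.+1%:R.
  have FF : Filter \oo by typeclasses eauto.
  have := filter_forall FF (fun i : 'I_q => nbhs_infty_ger `|v i 0|).
  apply: filterS => n vn i.
  by rewrite (le_trans (vn i))// ler_nat.
have He : \forall n \near \oo, n.+1%:R^-1 <= e.
  have := @near_infty_natSinv_lt R (PosNum e0); apply: filterS => n /=.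
  exact: ltW.
near=> n; have [_ /(_ v)] := gP n; move=> /(_ _)/le_trans; apply; last by near: n.
by near: n.
Unshelve. all: end_near. Qed.

End trigonometric_approximation.

Section levy.
Context (R : realType) (q : nat).

Definition cube (K : R) : set 'cV[R]_q := [set v | forall i, `|v i 0| <= K].

Lemma measurable_cube K : measurable (cube K).
Proof.
have -> : cube K = \bigcap_(i in [set: 'I_q]) [set v | `[- K, K]%classic (v i 0)].
  apply/seteqP; split=> v /= H i; first by rewrite /= in_itv/= -ler_norml.
  by have := H i I; rewrite /= in_itv/= -ler_norml.
apply: fin_bigcap_measurable => // i _; apply: sub_sigma_algebra.
by exists i, 0, `[- K, K]%classic; split => //; exact: measurable_itv.
Qed.

Lemma bdd_meas_cubeC K : bdd_meas (\1_(~` cube K) : 'cV[R]_q -> R).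
Proof. by apply: bdd_meas_indic; apply: measurableC; exact: measurable_cube. Qed.

Lemma tight_probability (Q : probability 'cV[R]_q R) (e : R) : 0 < e ->
  \forall K \near +oo, mean Q (\1_(~` cube K)) <= e.
Proof.
move=> e0.
have Qn : \forall n \near \oo, mean Q (\1_(~` cube n%:R)) <= e.
  have : Q (~` cube n%:R) @[n --> \oo] --> Q (\bigcap_n ~` cube n%:R).
    apply: nonincreasing_cvg_mu => //.
    - by apply: (le_lt_trans (probability_le1 _ _)); [apply: measurableC; exact: measurable_cube|rewrite ltry].
    - by move=> n; apply: measurableC; exact: measurable_cube.
    - by apply: bigcap_measurable => // n _; apply: measurableC; exact: measurable_cube.
    move=> i j ij; apply/subsetPset; apply: subsetC => v H k.
    by rewrite (le_trans (H k))// ler_nat.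
  rewrite [X in Q X](_ : _ = set0); last first.
    apply/seteqP; split=> v //= H.
    have Hv : \forall n \near \oo, forall i, `|v i 0| <= n%:R.
      have FF : Filter \oo by typeclasses eauto.
      exact: (filter_forall FF (fun i : 'I_q => nbhs_infty_ger `|v i 0|)).
    have [n Hn] := filter_ex Hv.
    exact: H n I Hn.
  rewrite measure0 => /fine_cvgP[_ /cvgrPdist_le/(_ e e0)].
  apply: filterS => n; rewrite sub0r normrN /= => H.
  rewrite -lee_fin mean_indic; last by apply: measurableC; exact: measurable_cube.
  rewrite -(fineK (fin_num_measure Q _ _)); last first.
    by apply: measurableC; exact: measurable_cube.
  by rewrite lee_fin (le_trans _ H)// ler_norm.
have [n Hn] := filter_ex Qn.
exists n%:R; split; first exact: num_real.
move=> K nK; apply: le_trans Hn; apply: le_mean; [exact: bdd_meas_cubeC..|].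
move=> v; rewrite !indicE ler_nat; case: (boolP (v \in ~` cube K)) => //.
rewrite inE => H; rewrite mem_set//= => Hn; apply: H => i.
exact: le_trans (Hn i) (ltW nK).
Qed.

(** Tightness is a hypothesis: approximate the test function by a trigonometric
    polynomial on a cube that carries almost all the mass. *)
Lemma levy_continuity (d : nat -> measure_display) (T : forall n, measurableType (d n))
    (P : forall n, probability (T n) R)
    (Z : forall n, {RV (P n) >-> 'cV[R]_q}) (Q : probability 'cV[R]_q R) :
  (forall t b, mean (P n) (fun x => cos (inner t (Z n x) + b)) @[n --> \oo]
     --> mean Q (fun v => cos (inner t v + b))) ->
  (forall e : R, 0 < e -> exists2 K0 : R, 0 < K0 & \forall n \near \oo,
     mean (P n) (fun x => \1_(~` cube K0) (Z n x)) <= e) ->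
  cvg_in_distribution Z Q.
Proof.
move=> Zchar Ztight f cf bf.
have bmf := continuous_bdd_meas cf bf; have [M fM] := bf.
have M0 : 0 <= M by exact: le_trans (normr_ge0 _) (fM 0).
have bmZ (g : 'cV[R]_q -> R) n : bdd_meas g -> bdd_meas (fun x => g (Z n x)).
  move=> [mg [N gN]]; split; last by exists N => x.
  exact: (measurableT_comp mg (measurable_funP (Z n))).
rewrite mean_EFin//.
under eq_fun => n.
  rewrite unlock (_ : (\int[P n]_w _)%E = (mean (P n) (fun x => f (Z n x)))%:E); last first.
    by rewrite -mean_EFin//; exact: bmZ.
  over.
apply: cvg_EFin; first exact: nearW.
have trig_cvg g : trig_poly g ->
    mean (P n) (fun x => g (Z n x)) @[n --> \oo] --> mean Q g.
  elim=> [t b|g1 g2 t1 c1 t2 c2|k g1 t1 c1]; first exact: Zchar.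
    rewrite meanD; [|exact: trig_poly_bdd_meas..].
    rewrite (_ : (fun n => _) = (fun n => mean (P n) (fun x => g1 (Z n x))
       + mean (P n) (fun x => g2 (Z n x)))); first exact: cvgD.
    apply/funext => n; apply: meanD; exact/bmZ/trig_poly_bdd_meas.
  rewrite meanZ; last exact: trig_poly_bdd_meas.
  rewrite (_ : (fun n => _) = (fun n => k * mean (P n) (fun x => g1 (Z n x)))).
    by apply: cvgM => //; exact: cvg_cst.
  by apply/funext => n; apply: meanZ; exact/bmZ/trig_poly_bdd_meas.
apply/cvgrPdist_le => e e0.
(* Two approximation errors [e1 + 2 M e1] and the error [e1] of the limit. *)
pose e1 := e / (3 + 4 * M).
have D0 : 0 < 3 + 4 * M by rewrite ltr_wpDr ?mulr_ge0.
have e10 : 0 < e1 by rewrite divr_gt0.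
have e1E : (3 + 4 * M) * e1 = e by rewrite mulrC divfK ?gt_eqF.
clearbody e1.
have [K0 K00 ZK0] := Ztight e1 e10.
have [K [K0K QK]] : exists K, K0 <= K /\ mean Q (\1_(~` cube K)) <= e1.
  have : \forall K \near +oo, K0 <= K /\ mean Q (\1_(~` cube K)) <= e1.
    near=> K; split; last by near: K; exact: tight_probability.
    by near: K; apply: nbhs_pinfty_ge; exact: num_real.
  by move=> /filter_ex.
have Kgt0 : 0 < K by exact: lt_le_trans K0K.
have [g tg [gM gf]] := trig_approximation e10 Kgt0 cf fM.
have bg := trig_poly_bdd_meas tg.
have fg v : `|f v - g v| <= e1 + 2 * M * \1_(~` cube K) v.
  rewrite indicE; case: (boolP (v \in _)) => [_|].
    rewrite mulr1 (le_trans (ler_normB _ _))// (@le_trans _ _ (2 * M))//.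
      by rewrite mulr2n mulrDl mul1r lerD.
    by rewrite lerDr ltW.
  by rewrite notin_setE /= mulr0 addr0 => /contrapT; exact: gf.
have bb : bdd_meas (fun v : 'cV[R]_q => e1 + 2 * M * \1_(~` cube K) v).
  by apply: bdd_measD; [exact: bdd_meas_cst|apply: bdd_measZ; exact: bdd_meas_cubeC].
have Qfg : `|mean Q f - mean Q g| <= e1 + 2 * M * e1.
  apply: le_trans (norm_meanB Q bmf bg bb fg) _.
  rewrite meanD ?mean_cst ?meanZ ?lerD2l ?ler_wpM2l ?mulr_ge0//.
  - exact: bdd_meas_cubeC.
  - exact: bdd_meas_cst.
  - by apply: bdd_measZ; exact: bdd_meas_cubeC.
have /cvgrPdist_le/(_ e1 e10) gcvg := trig_cvg g tg.
near=> n.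
have gn : `|mean Q g - mean (P n) (fun x => g (Z n x))| <= e1 by near: n.
have Pfg : `|mean (P n) (fun x => f (Z n x)) - mean (P n) (fun x => g (Z n x))|
    <= e1 + 2 * M * e1.
  apply: le_trans (norm_meanB (P n) (bmZ _ n bmf) (bmZ _ n bg) (bmZ _ n bb) (fun x => fg (Z n x))) _.
  rewrite meanD ?mean_cst ?meanZ ?lerD2l ?ler_wpM2l ?mulr_ge0//.
  - apply: (@le_trans _ _ (mean (P n) (fun x => \1_(~` cube K0) (Z n x)))); last by near: n.
    apply: le_mean; [by apply: bmZ; exact: bdd_meas_cubeC..|].
    move=> x; rewrite !indicE ler_nat; case: (boolP (Z n x \in ~` cube K)) => //.
    rewrite inE => H; rewrite mem_set//= => Hn; apply: H => i.
    exact: le_trans (Hn i) K0K.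
  - by apply: bmZ; exact: bdd_meas_cubeC.
  - exact: bdd_meas_cst.
  - by apply: bdd_measZ; apply: bmZ; exact: bdd_meas_cubeC.
have -> : e = e1 + 2 * M * e1 + e1 + (e1 + 2 * M * e1).
  by rewrite -e1E; ring.
rewrite -[X in _ - X]/(mean (P n) (fun x => f (Z n x))).
rewrite [X in `|X|](_ : _ = (mean Q f - mean Q g)
  + (mean Q g - mean (P n) (fun x => g (Z n x)))
  - (mean (P n) (fun x => f (Z n x)) - mean (P n) (fun x => g (Z n x)))); last by ring.
apply: (le_trans (ler_normB _ _)); apply: lerD Pfg.
by apply: (le_trans (ler_normD _ _)); exact: lerD.
Unshelve. all: end_near. Qed.

End levy.

(** * Matrix norms, square roots and studentization *)

Section matrix_sup_norm.
Context (R : realType).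

Lemma mx_entry_le m n (A : 'M[R]_(m, n)) i j : `|A i j| <= `|A|.
Proof.
rewrite [leRHS]mx_normrE.
exact: (@le_bigmax _ _ _ 0 (fun ij : 'I_m * 'I_n => `|A ij.1 ij.2|) (i, j)).
Qed.

Lemma mx_norm_leP m n (A : 'M[R]_(m, n)) (r : R) : 0 <= r ->
  (forall i j, `|A i j| <= r) -> `|A| <= r.
Proof.
by move=> r0 Ar; rewrite [leLHS]mx_normrE; apply/bigmax_leP; split => // -[i j] _ /=.
Qed.

Lemma norm_mulmx m k n (A : 'M[R]_(m, k)) (B : 'M[R]_(k, n)) :
  `|A *m B| <= k%:R * `|A| * `|B|.
Proof.
apply: mx_norm_leP => [|i j]; first by rewrite !mulr_ge0.
rewrite mxE; apply: (le_trans (ler_norm_sum _ _ _)).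
apply: (@le_trans _ _ (\sum_(l < k) `|A| * `|B|)).
  by apply: ler_sum => l _; rewrite normrM ler_pM// mx_entry_le.
by rewrite sumr_const card_ord -mulrA mulr_natl.
Qed.

Lemma norm_trmx m n (A : 'M[R]_(m, n)) : `|A^T| = `|A|.
Proof.
apply/eqP; rewrite eq_le; apply/andP; split; apply: mx_norm_leP => // i j.
  by rewrite mxE mx_entry_le.
by have := mx_entry_le A^T j i; rewrite mxE.
Qed.

Lemma norm_mx1_le q : `|1%:M : 'M[R]_q| <= 1.
Proof.
by apply: mx_norm_leP => // i j; rewrite mxE; case: (_ == _); rewrite ?normr1// normr0.
Qed.

(** A row of the kernel of [M] satisfies [k = k (1 - M)], whose norm is smaller
    than that of [k] unless [k = 0]. *)
Lemma unitmx_near1 q (M : 'M[R]_q) : q%:R * `|M - 1%:M| < 1 -> M \in unitmx.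
Proof.
move=> H; rewrite -row_free_unit -kermx_eq0.
set k := kermx M.
have kM : k = k *m (1%:M - M) by rewrite mulmxBr mulmx1 mulmx_ker subr0.
have : `|k| <= q%:R * `|M - 1%:M| * `|k|.
  by rewrite {1}kM (le_trans (norm_mulmx _ _))// [ `|1%:M - M| ]distrC mulrAC.
rewrite -subr_ge0 -{2}[ `|k| ]mul1r -mulrBl => h.
rewrite -normr_eq0 eq_le normr_ge0 andbT.
by move: h; rewrite nmulr_rge0// subr_lt0.
Qed.

(** From [M^-1 - 1 = (1 - M) M^-1] one first gets [|M^-1| <= 1 + |M^-1| / 2]. *)
Lemma invmx_near1 q (M : 'M[R]_q) (d : R) : `|M - 1%:M| <= d ->
  q%:R * d <= 2^-1 ->
  [/\ M \in unitmx, `|invmx M| <= 2 & `|invmx M - 1%:M| <= 2 * q%:R * d].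
Proof.
move=> Md qd.
have uM : M \in unitmx.
  apply: unitmx_near1; apply: (@le_lt_trans _ _ 2^-1); last by lra.
  by apply: le_trans qd; rewrite ler_wpM2l.
have d0 : 0 <= d by exact: le_trans (normr_ge0 _) Md.
have E : invmx M - 1%:M = (1%:M - M) *m invmx M.
  by rewrite mulmxBl mul1mx mulmxV.
have h : `|invmx M - 1%:M| <= q%:R * d * `|invmx M|.
  rewrite E (le_trans (norm_mulmx _ _))// ler_wpM2r// ler_wpM2l//.
  by rewrite distrC.
have h2 : `|invmx M| <= 2.
  have : `|invmx M| <= `|invmx M - 1%:M| + `|1%:M : 'M[R]_q|.
    by rewrite -{1}[invmx M](subrK 1%:M) ler_normD.
  have := norm_mx1_le q; have : q%:R * d * `|invmx M| <= 2^-1 * `|invmx M|.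
    by rewrite ler_wpM2r.
  lra.
split => //; apply: (le_trans h).
have : 0 <= q%:R * d by rewrite mulr_ge0.
nra.
Qed.

Definition sqn q (v : 'cV[R]_q) : R := (v^T *m v) 0 0.

Lemma sqnE q (v : 'cV[R]_q) : sqn v = \sum_i v i 0 ^+ 2.
Proof. by rewrite /sqn mxE; apply: eq_bigr => i _; rewrite mxE expr2. Qed.

Lemma sqn_ge0 q (v : 'cV[R]_q) : 0 <= sqn v.
Proof. by rewrite sqnE sumr_ge0// => i _; exact: sqr_ge0. Qed.

Lemma sqn_eq0 q (v : 'cV[R]_q) : sqn v = 0 -> v = 0.
Proof.
rewrite sqnE => /eqP; rewrite psumr_eq0; last by move=> i _; exact: sqr_ge0.
move=> /allP h; apply/colP => i; apply/eqP.
by have := h i (mem_index_enum _); rewrite sqrf_eq0 mxE.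
Qed.

Lemma sqn_mulmx q (M : 'M[R]_q) v : sqn (M *m v) = (v^T *m (M^T *m M) *m v) 0 0.
Proof. by rewrite /sqn trmx_mul !mulmxA. Qed.

Lemma norm_sqr_le_sqn q (v : 'cV[R]_q) : `|v| ^+ 2 <= sqn v.
Proof.
have h : `|v| <= Num.sqrt (sqn v).
  apply: mx_norm_leP => [|i j]; first exact: sqrtr_ge0.
  rewrite [j]ord1 -sqrtr_sqr ler_wsqrtr// sqnE (bigD1 i)//= lerDl sumr_ge0// => k _.
  exact: sqr_ge0.
rewrite -[leRHS]sqr_sqrtr ?sqn_ge0// lerXn2r// nnegrE ?sqrtr_ge0//.
Qed.

Lemma inner_norm_le q (u v : 'cV[R]_q) : `|(u^T *m v) 0 0| <= q%:R * `|u| * `|v|.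
Proof. by apply: le_trans (mx_entry_le _ _ _) _; rewrite -[ `|u| ]norm_trmx norm_mulmx. Qed.

Lemma coercive_norm q (B : 'M[R]_q) (v : 'cV[R]_q) :
  (forall v : 'cV[R]_q, sqn v <= (v^T *m B *m v) 0 0) -> `|v| <= q%:R * `|B *m v|.
Proof.
move=> Bpos.
have [->|v0] := eqVneq v 0; first by rewrite mulmx0 normr0 mulr0.
rewrite -(ler_pM2l (x := `|v|)) ?normr_gt0// -expr2.
apply: (le_trans (norm_sqr_le_sqn v)); apply: (le_trans (Bpos v)).
rewrite -mulmxA; apply: (le_trans (ler_norm _)).
by rewrite mulrA [ `|v| * _]mulrC; exact: inner_norm_le.
Qed.

End matrix_sup_norm.

Section symmetric_calculus.
Context (R : realType) (p : nat).
Local Notation q := p.+1.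
Implicit Types (A B : 'M[R]_q).

Lemma interpolating_poly (s : seq R) (g : R -> R) :
  exists r : {poly R}, forall x, x \in s -> r.[x] = g x.
Proof.
elim: s => [|a s [r rP]]; first by exists 0.
have [as_|as_] := boolP (a \in s).
  by exists r => x; rewrite inE => /orP[/eqP ->|/rP]//; exact: rP.
pose w := \prod_(y <- s) ('X - y%:P).
have wa : w.[a] != 0.
  by rewrite -[_ == 0]/(root w a) root_prod_XsubC.
exists (r + ((g a - r.[a]) / w.[a]) *: w) => x.
rewrite inE hornerD hornerZ => /orP[/eqP ->|xs].
  by rewrite divfK// addrC subrK.
have /eqP -> : root w x by rewrite root_prod_XsubC.
by rewrite mulr0 addr0 rP.
Qed.

Lemma horner_mx_sym A (r : {poly R}) : A^T = A -> (horner_mx A r)^T = horner_mx A r.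
Proof.
move=> sA; elim/poly_ind: r => [|r c IH]; first by rewrite !rmorph0 trmx0.
have comm : A * horner_mx A r = horner_mx A r * A.
  by have := rmorphM (horner_mx A) r 'X; rewrite mulrC rmorphM /= horner_mx_X.
rewrite rmorphD rmorphM /= horner_mx_X horner_mx_C linearD/= tr_scalar_mx.
by rewrite trmx_mul sA IH -[in RHS]comm.
Qed.

(** The spectral theorem over the complex numbers, in a form that descends to
    the real ones: a real symmetric matrix is a root of every polynomial that
    vanishes on its eigenvalues, which are real. *)
Lemma symmetric_horner_eq0 A : A^T = A -> exists s : seq R,
  (forall x, x \in s -> eigenvalue A x) /\
  (forall r : {poly R}, (forall x, x \in s -> r.[x] = 0) -> horner_mx A r = 0).
Proof.
move=> sA; pose C := R[i]; pose f : {rmorphism R -> C} := real_complex R.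
pose A' : 'M[C]_q := map_mx f A.
have A'real : A' \is a realmx.
  by apply/mxOverP => i j; rewrite mxE; apply/complex_realP; exists (A i j).
have A'sym : A' \is symmetricmx.
  apply/is_hermitianmxP; rewrite expr0 scale1r map_mx_id//.
  by apply/matrixP => i j; rewrite !mxE -[in LHS]sA mxE.
have A'herm := realsym_hermsym A'sym A'real.
have A'n := hermitian_normalmx A'herm.
have /mxOverP Dreal := hermitian_spectral_diag_real A'herm.
have := orthomx_spectralP A'n; set P := spectralmx A'; set D := spectral_diag A' in Dreal * => A'E.
have uP : P \in unitmx by exact: spectral_unit.
have DE i : D 0 i = f (complex.Re (D 0 i)).
  by have /complex_realP[x ->] := Dreal 0 i.
have eigD i : eigenvalue A' (D 0 i).
  apply/eigenvalueP; exists (row i P).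
    rewrite {1}A'E !mulmxA -row_mul mulmxV// row1 -rowE row_diag_mx -scalemxAl.
    by rewrite -rowE.
  apply/negP => /eqP ri0; have := row_free_unit P; rewrite uP => /row_freeP[B PB].
  have := congr1 (row i) PB; rewrite row_mul ri0 mul0mx => /rowP/(_ i).
  by rewrite !mxE eqxx => /eqP; rewrite eq_sym oner_eq0.
exists [seq complex.Re (D 0 i) | i <- enum 'I_q]; split.
  move=> x /mapP[i _ ->]; rewrite eigenvalue_root_char -(fmorph_root f) map_char_poly.
  by rewrite -[map_mx _ _]/A' -DE -eigenvalue_root_char.
move=> r r0; apply: (map_mx_inj (f := f)); rewrite map_mx0 map_horner_mx -/A'.
set r' := map_poly f r.
have d0 : diag_mx (map_mx (horner r') D) = 0.
  apply/matrixP => i j; rewrite !mxE DE horner_map.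
  rewrite r0 ?rmorph0 ?mul0rn//.
  by apply/mapP; exists i; rewrite ?mem_enum.
have -> : horner_mx A' r' = invmx P *m horner_mx (diag_mx D) r' *m P.
  by rewrite -horner_mx_uconjC// -A'E.
by rewrite horner_mx_diag d0 mulmx0 mul0mx.
Qed.

(** The square root is a polynomial [g] in [A], where [g] interpolates the square
    root at the eigenvalues. Writing [g = r^2 + sqrt a] makes the lower bound on
    [B] visible. *)
Lemma psd_sqrt_exists A (a : R) : 0 <= a -> A^T = A ->
  (forall v : 'cV[R]_q, a * sqn v <= (v^T *m A *m v) 0 0) ->
  exists B, [/\ B^T = B, B *m B = A &
    forall v : 'cV[R]_q, Num.sqrt a * sqn v <= (v^T *m B *m v) 0 0].
Proof.
move=> a0 sA Aa; have [s [sE s0]] := symmetric_horner_eq0 sA.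
have s_ge x : x \in s -> a <= x.
  move=> /sE/eigenvalueP[v vA v0].
  have h := Aa v^T; move: h; rewrite trmxK vA -scalemxAl mxE /sqn trmxK.
  rewrite ler_pM2r// lt_def; apply/andP; split.
    apply: contra v0 => /eqP h; rewrite -[v]trmxK (@sqn_eq0 R q v^T) ?trmx0//.
    by rewrite /sqn trmxK.
  by have := sqn_ge0 v^T; rewrite /sqn trmxK.
have [r rP] := interpolating_poly s (fun x => Num.sqrt (Num.sqrt x - Num.sqrt a)).
pose g := r ^+ 2 + (Num.sqrt a)%:P.
pose C := horner_mx A r.
have BE : horner_mx A g = C *m C + (Num.sqrt a)%:M.
  by rewrite /g rmorphD rmorphXn /= horner_mx_C expr2.
have sC : C^T = C by exact: horner_mx_sym.
exists (horner_mx A g); split; first exact: horner_mx_sym.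
  have e : horner_mx A (g * g - 'X) = 0.
    apply: s0 => x xs.
    rewrite hornerD hornerN hornerX hornerM /g hornerD hornerC horner_exp (rP _ xs).
    have ax := s_ge x xs; have x0 : 0 <= x by exact: le_trans ax.
    rewrite sqr_sqrtr ?subr_ge0 ?ler_wsqrtr// subrK -expr2 sqr_sqrtr//.
    by rewrite subrr.
  by move: e; rewrite rmorphB rmorphM /= horner_mx_X => /subr0_eq.
move=> v; have e : (v^T *m (C *m C) *m v) 0 0 = sqn (C *m v).
  by rewrite sqn_mulmx sC.
rewrite BE mulmxDr mulmxDl mxE e mul_mx_scalar -scalemxAl.
by rewrite [X in _ <= _ + X]mxE lerDr sqn_ge0.
Qed.

(** The square root is Lipschitz away from singular matrices: if [D = B - B0]
    then [tr (D^T (A - A0)) = tr (D^T B D) + tr (D B0 D^T)], whose first term is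
    nonnegative and whose second one dominates [tr (D D^T)]. *)
Lemma sqrt_stability A A0 B B0 :
  B^T = B -> B0^T = B0 -> B *m B = A -> B0 *m B0 = A0 ->
  (forall v : 'cV[R]_q, 0 <= (v^T *m B *m v) 0 0) ->
  (forall v : 'cV[R]_q, sqn v <= (v^T *m B0 *m v) 0 0) ->
  `|B - B0| <= q%:R ^+ 2 * `|A - A0|.
Proof.
move=> sB sB0 BA BA0 Bpos B0pos; set D := B - B0; set E := A - A0.
have DE : E = B *m D + D *m B0.
  by rewrite /E /D -BA -BA0 mulmxBr mulmxBl addrA subrK.
have sD : D^T = D by rewrite /D linearB/= sB sB0.
have trE (M : 'M[R]_q) : \tr (D^T *m M *m D) = \sum_j ((col j D)^T *m M *m col j D) 0 0.
  rewrite /mxtrace; apply: eq_bigr => j _.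
  by rewrite !mxE; apply: eq_bigr => k _; rewrite tr_col -row_mul !mxE.
have h1 : \tr (D^T *m E) = \tr (D^T *m B *m D) + \tr (D^T *m B0 *m D).
  rewrite DE mulmxDr raddfD/= !mulmxA; congr (_ + _).
  by rewrite sD [RHS]mxtrace_mulC mulmxA.
have h2 : \sum_i \sum_j D i j ^+ 2 <= \tr (D^T *m E).
  rewrite h1; apply: (@le_trans _ _ (\tr (D^T *m B0 *m D))).
    rewrite trE exchange_big; apply: ler_sum => j _.
    apply: le_trans (B0pos (col j D)); rewrite sqnE.
    by apply/le_of_eq/eq_bigr => i _; rewrite [col j D i 0]mxE.
  by rewrite lerDr trE sumr_ge0.
have h3 : \tr (D^T *m E) <= q%:R ^+ 2 * `|D| * `|E|.
  rewrite /mxtrace; apply: (@le_trans _ _ (\sum_(i < q) q%:R * `|D| * `|E|)).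
    apply: ler_sum => i _; apply: (le_trans (ler_norm _)).
    apply: (le_trans (mx_entry_le _ _ _)).
    by rewrite -[ `|D| ]norm_trmx norm_mulmx.
  by rewrite sumr_const card_ord -[_ *+ _]mulr_natl !mulrA expr2.
have h4 : `|D| ^+ 2 <= \sum_i \sum_j D i j ^+ 2.
  have S0 : 0 <= \sum_i \sum_j D i j ^+ 2.
    by apply: sumr_ge0 => i _; apply: sumr_ge0 => j _; exact: sqr_ge0.
  have h : `|D| <= Num.sqrt (\sum_i \sum_j D i j ^+ 2).
    apply: mx_norm_leP => [|i j]; first exact: sqrtr_ge0.
    rewrite -sqrtr_sqr ler_wsqrtr// (bigD1 i)//= (bigD1 j)//= -addrA lerDl.
    rewrite addr_ge0//; first by apply: sumr_ge0 => k _; exact: sqr_ge0.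
    by apply: sumr_ge0 => k _; apply: sumr_ge0 => l _; exact: sqr_ge0.
  by rewrite -[leRHS]sqr_sqrtr// lerXn2r// nnegrE ?sqrtr_ge0.
have := le_trans h4 (le_trans h2 h3).
have [->|D0] := eqVneq D 0; first by rewrite normr0 mulr_ge0// sqr_ge0.
by rewrite expr2 mulrAC ler_pM2r// normr_gt0.
Qed.

End symmetric_calculus.

Section studentization.
Context (R : realType) (p : nat).
Local Notation q := p.+1.

(** A vector in the kernel of [A] has norm zero. *)
Lemma coercive_unitmx (A : 'M[R]_q) (a : R) : 0 < a ->
  (forall v : 'cV[R]_q, a * sqn v <= (v^T *m A *m v) 0 0) -> A \in unitmx.
Proof.
move=> a0 Aa; rewrite -unitmx_tr -row_free_unit -kermx_eq0.
apply/eqP/row_matrixP => i; rewrite row0; set k := row i _.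
have kA : k *m A^T = 0 by rewrite -row_mul mulmx_ker row0.
have := Aa k^T; rewrite trmxK -mulmxA.
have -> : A *m k^T = 0 by rewrite -[A]trmxK -trmx_mul kA trmx0.
rewrite mulmx0 mxE pmulr_rle0// => h.
have /sqn_eq0 : sqn k^T = 0 by apply/eqP; rewrite eq_le h sqn_ge0.
by move=> /(congr1 trmx); rewrite trmxK trmx0.
Qed.

Lemma quad_form_norm_le (E : 'M[R]_q) (v : 'cV[R]_q) :
  `|(v^T *m E *m v) 0 0| <= q%:R ^+ 2 * `|E| * sqn v.
Proof.
rewrite -mulmxA; apply: (le_trans (inner_norm_le _ _)).
apply: (@le_trans _ _ (q%:R * `|v| * (q%:R * `|E| * `|v|))).
  by rewrite ler_wpM2l ?mulr_ge0// norm_mulmx.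
rewrite [leLHS](_ : _ = q%:R ^+ 2 * `|E| * `|v| ^+ 2); last by ring.
by rewrite ler_wpM2l ?norm_sqr_le_sqn// mulr_ge0// sqr_ge0.
Qed.

(** With [B] the square root chosen by [invsqrtmx], rescaled by [1 / s], and [z]
    the studentized vector, [B0 (z - z0) = (B0 - B) z + (y - y0)]; the first term
    is controlled by [sqrt_stability] and, [eta] being small, absorbed into the
    left-hand side. *)
Lemma studentization_perturbation (A A0 B0 : 'M[R]_q) (y y0 z0 : 'cV[R]_q)
    (s eta : R) :
  0 < s -> A^T = A -> B0^T = B0 -> B0 *m B0 = A0 ->
  (forall v : 'cV[R]_q, sqn v <= (v^T *m A0 *m v) 0 0) ->
  (forall v : 'cV[R]_q, sqn v <= (v^T *m B0 *m v) 0 0) ->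
  `|A - A0| <= eta -> q%:R ^+ 4 * eta <= 2^-1 ->
  B0 *m z0 = y0 ->
  s ^+ 2 *: A \in unitmx /\
  `|invsqrtmx (s ^+ 2 *: A) *m (s *: y) - z0| <=
    2 * q%:R ^+ 5 * eta * `|y0| + 2 * q%:R * `|y - y0|.
Proof.
move=> s0 sA sB0 BA0 A0pos B0pos Aeta eta_small Bz0.
have q1 : 1 <= q%:R :> R by rewrite ler1n.
have eta0 : 0 <= eta by exact: le_trans (normr_ge0 _) Aeta.
have Apos (v : 'cV[R]_q) : 2^-1 * sqn v <= (v^T *m A *m v) 0 0.
  have := quad_form_norm_le (A - A0) v.
  have -> : v^T *m (A - A0) *m v = v^T *m A *m v - v^T *m A0 *m v.
    by rewrite mulmxBr mulmxBl.
  rewrite [X in `|X|]mxE [(- (_ *m _)) 0 0]mxE ler_norml => /andP[h _].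
  have h2 : q%:R ^+ 2 * `|A - A0| * sqn v <= 2^-1 * sqn v.
    rewrite ler_wpM2r ?sqn_ge0//; apply: le_trans eta_small.
    by rewrite ler_pM ?sqr_ge0// ler_weXn2l.
  have := A0pos v; lra.
have s2A (v : 'cV[R]_q) : s ^+ 2 * 2^-1 * sqn v <= (v^T *m (s ^+ 2 *: A) *m v) 0 0.
  rewrite -scalemxAr -scalemxAl [leRHS]mxE -mulrA ler_wpM2l// sqr_ge0//.
have s20 : 0 < s ^+ 2 by rewrite exprn_gt0.
have uA : s ^+ 2 *: A \in unitmx.
  by apply: coercive_unitmx s2A; rewrite mulr_gt0.
split => //.
have ss2A : (s ^+ 2 *: A)^T = s ^+ 2 *: A by rewrite linearZ/= sA.
have : exists B : 'M[R]_q, psdmx B /\ B *m B = s ^+ 2 *: A.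
  have [|B [sB BB Bpos]] := psd_sqrt_exists (lexx 0) ss2A.
    move=> v; rewrite mul0r; apply: le_trans (s2A v).
    by apply: mulr_ge0; [apply: mulr_ge0; [exact: ltW|]|exact: sqn_ge0]; rewrite ?invr_ge0.
  exists B; split => //; split => // v.
  by have := Bpos v; rewrite sqrtr0 mul0r.
rewrite /invsqrtmx => -[B1 hB1]; have := @xgetPex _ 0 [set B : 'M[R]_q | psdmx B /\ B *m B = s ^+ 2 *: A] (ex_intro _ B1 hB1).
set B' := xget _ _ => -[[sB' B'pos] BB'].
have uB' : B' \in unitmx by move: uA; rewrite -BB' unitmx_mul => /andP[].
set z := invmx B' *m _.
have B'z : B' *m z = s *: y by rewrite /z mulKVmx.
pose B := s^-1 *: B'.
have Bz : B *m z = y by rewrite -scalemxAl B'z scalerA mulVf ?scale1r// gt_eqF.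
have BB : B *m B = A.
  rewrite -scalemxAl -scalemxAr BB' !scalerA [X in X *: A](_ : _ = 1) ?scale1r//.
  by field; rewrite gt_eqF.
have sB : B^T = B by rewrite linearZ/= sB'.
have Bpos (v : 'cV[R]_q) : 0 <= (v^T *m B *m v) 0 0.
  by rewrite -scalemxAr -scalemxAl mxE mulr_ge0// invr_ge0 ltW.
have stab := sqrt_stability sB sB0 BB BA0 Bpos B0pos.
have D : B0 *m (z - z0) = (B0 - B) *m z + (y - y0).
  by rewrite mulmxBr mulmxBl Bz Bz0 addrA subrK.
have h1 : `|z - z0| <= q%:R * (q%:R * (q%:R ^+ 2 * eta) * `|z| + `|y - y0|).
  apply: (le_trans (coercive_norm (z - z0) B0pos)); rewrite ler_wpM2l// D.
  apply: (le_trans (ler_normD _ _)); rewrite lerD2r.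
  apply: (le_trans (norm_mulmx _ _)); rewrite ler_wpM2r// ler_wpM2l//.
  by rewrite distrC (le_trans stab)// ler_wpM2l// sqr_ge0.
have h2 : `|z| <= `|z0| + `|z - z0|.
  by rewrite -{1}[z](subrK z0) addrC ler_normD.
have h3 : `|z0| <= q%:R * `|y0| by rewrite -Bz0; exact: coercive_norm.
have k0 : 0 <= q%:R ^+ 4 * eta by rewrite mulr_ge0// exprn_ge0.
have h4 : q%:R ^+ 4 * eta * `|z| <= q%:R ^+ 4 * eta * (q%:R * `|y0|) + 2^-1 * `|z - z0|.
  apply: (@le_trans _ _ (q%:R ^+ 4 * eta * (`|z0| + `|z - z0|))); first by rewrite ler_wpM2l.
  by rewrite mulrDr lerD ?ler_wpM2l// ler_wpM2r.
have e1 : q%:R * (q%:R * (q%:R ^+ 2 * eta) * `|z| + `|y - y0|) =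
   q%:R ^+ 4 * eta * `|z| + q%:R * `|y - y0| by ring.
have e2 : 2 * q%:R ^+ 5 * eta * `|y0| = 2 * (q%:R ^+ 4 * eta * (q%:R * `|y0|)) by ring.
rewrite e1 in h1; rewrite e2 -[2 * q%:R * _]mulrA.
move: h1 h4; move: (q%:R ^+ 4 * eta * `|z|) (q%:R ^+ 4 * eta * _) (q%:R * `|y - y0|).
by move=> a b c h1 h4; lra.
Qed.

End studentization.

(** * Sketched inner products as quadratic forms *)

Section bilinear_forms.
Context (R : realType) (m n zeta : nat).
Hypotheses (zeta_gt0 : (0 < zeta)%N) (zeta_le : (zeta <= m)%N).
Local Notation Om := {ffun 'I_n -> sparse_columns R m zeta}.
Local Notation h := (fun c c' : sparse_columns R m zeta => Num.sqrt m%:R * dot (col_entry c) (col_entry c')).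
Implicit Types (x y : 'cV[R]_n) (w : Om).

(** The symmetrization of [x y^T] without its diagonal; the associated quadratic
    form is the centered sketched inner product of [x] and [y]. *)
Definition cross_form x y (j k : 'I_n) : R :=
  if j == k then 0 else x j 0 * y k 0 + x k 0 * y j 0.

Definition l4 x : R := \sum_j x j 0 ^+ 4.

Lemma l4_ge0 x : 0 <= l4 x.
Proof. by apply: sumr_ge0 => j _; rewrite exprn_even_ge0. Qed.

Lemma hollow_cross_form x y : hollow (cross_form x y).
Proof.
split=> [j k|j]; rewrite /cross_form ?eqxx// eq_sym; case: eqP => // _.
by rewrite addrC.
Qed.

Let sm0 : Num.sqrt m%:R != 0 :> R.
Proof. by rewrite gt_eqF// sqrtr_gt0 ltr0n (leq_trans zeta_gt0). Qed.

Lemma sketch_dot x y w : ((sketch w *m x)^T *m (sketch w *m y)) 0 0 =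
  \sum_j \sum_k x j 0 * y k 0 * dot (col_entry (w j)) (col_entry (w k)).
Proof.
rewrite mxE; under eq_bigr => a _.
  rewrite !mxE mulr_suml; under eq_bigr => j _ do rewrite mulr_sumr.
  over.
rewrite exchange_big; apply: eq_bigr => j _; rewrite exchange_big.
apply: eq_bigr => k _; rewrite /dot mulr_sumr; apply: eq_bigr => a _.
by rewrite !mxE; ring.
Qed.

(** The diagonal terms of [<S x, S y>] sum up to [<x, y>] because the columns of
    [S] have norm one. *)
Lemma quad_cross_form x y w :
  quad_form h (cross_form x y) w =
  Num.sqrt m%:R * (((sketch w *m x)^T *m (sketch w *m y)) 0 0 - (x^T *m y) 0 0).
Proof.
pose d j k := dot (col_entry (w j)) (col_entry (w k)).
have dsym j k : d j k = d k j by apply: eq_bigr => a _; rewrite mulrC.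
have d1 j : d j j = 1.
  rewrite -[RHS](col_entry_norm zeta_gt0 (w j)).
  by apply: eq_bigr => a _; rewrite expr2.
rewrite sketch_dot.
have -> : (x^T *m y) 0 0 = \sum_j \sum_k (if j == k then x j 0 * y k 0 * d j k else 0).
  rewrite mxE; apply: eq_bigr => j _; rewrite -big_mkcond/=.
  by rewrite (eq_bigl (pred1 j)) ?big_pred1_eq ?d1 ?mulr1 ?mxE// => k; rewrite eq_sym.
have E (f : 'I_n -> 'I_n -> R) : (forall j k, f j k = f k j) ->
  \sum_j \sum_k f j k * (x j 0 * y k 0) = 2^-1 * \sum_j \sum_k f j k * (x j 0 * y k 0 + x k 0 * y j 0).
  move=> fs; have e : \sum_j \sum_k f j k * (x k 0 * y j 0) = \sum_j \sum_k f j k * (x j 0 * y k 0).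
    by rewrite exchange_big; apply: eq_bigr => j _; apply: eq_bigr => k _; rewrite fs.
  under [in RHS]eq_bigr => j _.
    under eq_bigr do rewrite mulrDr.
    rewrite big_split/=; over.
  by rewrite big_split/= e; field.
pose f j k := if j == k then 0 else d j k.
have fs j k : f j k = f k j by rewrite /f eq_sym dsym.
rewrite -sumrB (eq_bigr (fun j => \sum_k f j k * (x j 0 * y k 0))); last first.
  move=> j _; rewrite -sumrB; apply: eq_bigr => k _; rewrite /f -/(d j k).
  by case: ifP; rewrite ?subrr ?mul0r// subr0 mulrC.
rewrite E// /quad_form mulrCA; congr (_ * _); rewrite mulr_sumr.
apply: eq_bigr => j _; rewrite mulr_sumr; apply: eq_bigr => k _.
by rewrite /cross_form /f -/(d j k); case: ifP => _; ring.
Qed.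

Lemma half_mass_cross_form x y : half_mass (cross_form x y) =
  sqn x * sqn y + (x^T *m y) 0 0 ^+ 2 - 2 * \sum_j x j 0 ^+ 2 * y j 0 ^+ 2.
Proof.
rewrite !sqnE.
have -> : (x^T *m y) 0 0 = \sum_j x j 0 * y j 0.
  by rewrite mxE; apply: eq_bigr => j _; rewrite mxE.
have E (u v : 'I_n -> R) : (\sum_j u j) * (\sum_j v j) = \sum_j \sum_k u j * v k.
  by rewrite mulr_suml; apply: eq_bigr => j _; rewrite mulr_sumr.
have -> : half_mass (cross_form x y) =
  2^-1 * (\sum_j \sum_k (x j 0 * y k 0 + x k 0 * y j 0) ^+ 2) -
  2 * \sum_j x j 0 ^+ 2 * y j 0 ^+ 2.
  rewrite /half_mass [2 * _]mulr_sumr mulr_sumr [X in _ = X - _]mulr_sumr -sumrB.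
  apply: eq_bigr => j _; rewrite /row_mass (bigD1 j)//= [in RHS](bigD1 j)//=.
  rewrite /cross_form eqxx expr0n add0r.
  rewrite (eq_bigr (fun k => (x j 0 * y k 0 + x k 0 * y j 0) ^+ 2)); first by field.
  by move=> k kj; rewrite eq_sym (negbTE kj).
congr (_ - _); rewrite expr2 !E.
have sw (F : 'I_n -> 'I_n -> R) : \sum_j \sum_k F j k = \sum_j \sum_k F k j by rewrite exchange_big.
have -> : \sum_j \sum_k (x j 0 * y k 0 + x k 0 * y j 0) ^+ 2 =
  \sum_j \sum_k x j 0 ^+ 2 * y k 0 ^+ 2 + \sum_j \sum_k x k 0 ^+ 2 * y j 0 ^+ 2
  + 2 * \sum_j \sum_k (x j 0 * y j 0) * (x k 0 * y k 0).
  rewrite mulr_sumr -!big_split/=; apply: eq_bigr => j _.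
  by rewrite mulr_sumr -!big_split/=; apply: eq_bigr => k _; ring.
by rewrite (sw (fun j k => x k 0 ^+ 2 * y j 0 ^+ 2)); field.
Qed.

Lemma half_mass_cross_le x y : half_mass (cross_form x y) <= 2 * (sqn x * sqn y).
Proof.
rewrite half_mass_cross_form.
have : 0 <= \sum_j x j 0 ^+ 2 * y j 0 ^+ 2.
  by apply: sumr_ge0 => j _; rewrite mulr_ge0 ?sqr_ge0.
have : (x^T *m y) 0 0 ^+ 2 <= sqn x * sqn y.
  rewrite !sqnE mxE (eq_bigr (fun j => x j 0 * y j 0)); last by move=> j _; rewrite mxE.
  exact: sum_cauchy_schwarz.
by lra.
Qed.

(** The second moment bound behind all laws of large numbers for the sketch. *)
Lemma avg_bilinear_sqr x y :
  avg (fun w : Om => (((sketch w *m x)^T *m (sketch w *m y)) 0 0 - (x^T *m y) 0 0) ^+ 2)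
  <= m%:R^-1 * (2 * (sqn x * sqn y)).
Proof.
have c0 := sparse_columns_inhab R zeta_le.
have hK := sparse_kernel R zeta_gt0 zeta_le.
have mE : m%:R = Num.sqrt m%:R ^+ 2 :> R by rewrite sqr_sqrtr.
rewrite (@eq_avg _ _ _ (fun w => m%:R^-1 * quad_form h (cross_form x y) w ^+ 2)); last first.
  by move=> w; rewrite quad_cross_form {1}mE; field.
rewrite avgZ (avg_quad_form_sqr c0 hK (hollow_cross_form x y)).
by rewrite ler_wpM2l ?invr_ge0// half_mass_cross_le.
Qed.

(** Everything is bounded by fourth powers of entries of [x] and [y]: this is
    where the flatness conditions on [U] and [e] enter. *)
Lemma pow4_mass_cross_form (M4 : R) x y : 0 <= M4 ->
  pow4_mass M4 (cross_form x y) <=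
  16 * M4 * (l4 x * l4 y) + 24 * (sqn y ^+ 2 * l4 x + sqn x ^+ 2 * l4 y).
Proof.
move=> M40; have cf2 j k : cross_form x y j k ^+ 2 <=
    2 * (x j 0 ^+ 2 * y k 0 ^+ 2) + 2 * (x k 0 ^+ 2 * y j 0 ^+ 2).
  rewrite /cross_form; case: eqP => _.
    rewrite expr0n; apply: addr_ge0; (apply: mulr_ge0 => //; apply: mulr_ge0; exact: sqr_ge0).
  rewrite -subr_ge0 (_ : _ - _ = (x j 0 * y k 0 - x k 0 * y j 0) ^+ 2) ?sqr_ge0//.
  by ring.
have cf4 j k : cross_form x y j k ^+ 4 <=
    8 * (x j 0 ^+ 4 * y k 0 ^+ 4) + 8 * (x k 0 ^+ 4 * y j 0 ^+ 4).
  apply: (@le_trans _ _ ((2 * (x j 0 ^+ 2 * y k 0 ^+ 2) + 2 * (x k 0 ^+ 2 * y j 0 ^+ 2)) ^+ 2)).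
    rewrite (exprM _ 2 2) lerXn2r// ?nnegrE ?sqr_ge0//.
    by apply: addr_ge0; (apply: mulr_ge0 => //; apply: mulr_ge0; exact: sqr_ge0).
  rewrite -subr_ge0 (_ : _ - _ = 4 * (x j 0 ^+ 2 * y k 0 ^+ 2 - x k 0 ^+ 2 * y j 0 ^+ 2) ^+ 2).
    by rewrite mulr_ge0 ?sqr_ge0.
  by ring.
have E (u v : 'I_n -> R) : (\sum_j u j) * (\sum_j v j) = \sum_j \sum_k u j * v k.
  by rewrite mulr_suml; apply: eq_bigr => j _; rewrite mulr_sumr.
rewrite /pow4_mass; apply: lerD.
  rewrite [leRHS](_ : _ = M4 * (16 * (l4 x * l4 y))); last by ring.
  rewrite ler_wpM2l//.
  apply: (@le_trans _ _ (\sum_j \sum_k (8 * (x j 0 ^+ 4 * y k 0 ^+ 4) + 8 * (x k 0 ^+ 4 * y j 0 ^+ 4)))).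
    by apply: ler_sum => j _; apply: ler_sum => k _.
  under eq_bigr do rewrite big_split/= -!mulr_sumr.
  rewrite big_split/= -!mulr_sumr [X in _ + 8 * X]exchange_big/= -mulr_suml -E /l4.
  by apply/le_of_eq; ring.
have rm j : row_mass (cross_form x y) j <= 2 * (x j 0 ^+ 2 * sqn y) + 2 * (y j 0 ^+ 2 * sqn x).
  apply: (@le_trans _ _ (\sum_k (2 * (x j 0 ^+ 2 * y k 0 ^+ 2) + 2 * (x k 0 ^+ 2 * y j 0 ^+ 2)))).
    by apply: ler_sum.
  rewrite big_split/= -!mulr_sumr -mulr_suml !sqnE.
  by apply/le_of_eq; ring.
rewrite [leRHS](_ : _ = 3 * (8 * (sqn y ^+ 2 * l4 x + sqn x ^+ 2 * l4 y))); last by ring.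
rewrite ler_wpM2l// /l4 !mulr_sumr -big_split/= mulr_sumr; apply: ler_sum => j _.
apply: (@le_trans _ _ ((2 * (x j 0 ^+ 2 * sqn y) + 2 * (y j 0 ^+ 2 * sqn x)) ^+ 2)).
  rewrite lerXn2r// nnegrE ?row_mass_ge0//.
  by apply: addr_ge0; (apply: mulr_ge0 => //; apply: mulr_ge0; rewrite ?sqr_ge0 ?sqn_ge0).
rewrite -subr_ge0 (_ : _ - _ = 4 * (x j 0 ^+ 2 * sqn y - y j 0 ^+ 2 * sqn x) ^+ 2).
  by rewrite mulr_ge0 ?sqr_ge0.
by ring.
Qed.

End bilinear_forms.

(** * The law of the deviation of the sketch *)

Lemma spiked_sqn (R : realType) q (xi : 'cV[R]_q) (B : 'M[R]_q) (v : 'cV[R]_q) :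
  (v^T *m (B *m (1%:M + xi *m xi^T) *m B^T) *m v) 0 0 =
  sqn (B^T *m v) + ((B^T *m v)^T *m xi) 0 0 ^+ 2.
Proof.
set a := B^T *m v.
have -> : v^T *m (B *m (1%:M + xi *m xi^T) *m B^T) *m v =
   a^T *m a + (a^T *m xi) *m (a^T *m xi)^T.
  by rewrite /a !trmx_mul !trmxK !(mulmxDr, mulmxDl) mulmx1 !mulmxA.
by rewrite mxE; congr (_ + _); rewrite mxE big_ord1 [X in _ * X]mxE expr2.
Qed.

Section sketch_statistics.
Context (R : realType) (m n p : nat).
Local Notation q := p.+1.
Variables (U : 'M[R]_(n, q)) (e : 'cV[R]_n).
Implicit Types M : 'M[R]_(m, n).

Definition cross_dev M : 'cV[R]_q := (M *m U)^T *m (M *m e) - U^T *m e.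

Definition scaled_dev M : 'cV[R]_q := Num.sqrt m%:R *: cross_dev M.

(** The event on which the sketch nearly preserves the geometry of the columns
    of [U] together with [e]. *)
Definition good_sketch (d : R) M : bool :=
  [&& `|gram (M *m U) - 1%:M| <= d, `|cross_dev M| <= d & `|sqn (M *m e) - 1| <= d].

(** A sum of centered squared sketched inner products, whose mean is of order
    [1 / m]; by Markov's inequality the sketch is good with high
    probability. *)
Definition total_dev M : R :=
  \sum_a \sum_b ((gram (M *m U) - 1%:M) a b) ^+ 2
  + \sum_a (cross_dev M a 0) ^+ 2 + (sqn (M *m e) - 1) ^+ 2.

Lemma good_sketchP (d : R) M : 0 <= d -> total_dev M <= d ^+ 2 -> good_sketch d M.
Proof.
move=> d0 H.
have s0 (I : finType) (F : I -> R) : 0 <= \sum_i F i ^+ 2.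
  by apply: sumr_ge0 => i _; exact: sqr_ge0.
have G0 : 0 <= \sum_a \sum_b ((gram (M *m U) - 1%:M) a b) ^+ 2.
  by apply: sumr_ge0 => i _; exact: s0.
have C0 := s0 _ (fun a => cross_dev M a 0).
have N0 : 0 <= (sqn (M *m e) - 1) ^+ 2 by exact: sqr_ge0.
have small (x : R) : x ^+ 2 <= total_dev M -> `|x| <= d.
  move=> xs; rewrite -(@ler_pXn2r _ 2)// ?nnegrE ?normr_ge0//.
  by rewrite real_normK ?num_real// (le_trans xs).
apply/and3P; split.
- apply: mx_norm_leP => // i j; apply: small; rewrite /total_dev -addrA.
  apply: (@le_trans _ _ (\sum_a \sum_b ((gram (M *m U) - 1%:M) a b) ^+ 2)).
    rewrite (bigD1 i)//= (bigD1 j)//= -addrA lerDl addr_ge0//.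
      by apply: sumr_ge0 => k _; exact: sqr_ge0.
    by apply: sumr_ge0 => k _; exact: s0.
  by rewrite lerDl addr_ge0.
- apply: mx_norm_leP => // i j; rewrite [j]ord1; apply: small.
  rewrite [total_dev M](_ : _ = \sum_a (cross_dev M a 0) ^+ 2 +
    (\sum_a \sum_b ((gram (M *m U) - 1%:M) a b) ^+ 2 + (sqn (M *m e) - 1) ^+ 2)); last first.
    by rewrite /total_dev; ring.
  apply: (@le_trans _ _ (\sum_a (cross_dev M a 0) ^+ 2)); last by rewrite lerDl addr_ge0.
  rewrite (bigD1 i)//= lerDl.
  by apply: sumr_ge0 => k _; exact: sqr_ge0.
- by apply: small; rewrite /total_dev lerDr addr_ge0.
Qed.

Lemma mulmx_col M (a : 'I_q) : M *m col a U = col a (M *m U).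
Proof. by apply/colP => i; rewrite !mxE; apply: eq_bigr => k _; rewrite !mxE. Qed.

Lemma gram_entry M (a b : 'I_q) : gram (M *m U) a b =
  ((M *m col a U)^T *m (M *m col b U)) 0 0.
Proof. by rewrite !mulmx_col /gram !mxE; apply: eq_bigr => i _; rewrite !mxE. Qed.

Lemma inner_col (a : 'I_q) (v : 'cV[R]_n) : ((col a U)^T *m v) 0 0 = (U^T *m v) a 0.
Proof. by rewrite !mxE; apply: eq_bigr => i _; rewrite !mxE. Qed.

Lemma cross_dev_entry M (a : 'I_q) : cross_dev M a 0 =
  ((M *m col a U)^T *m (M *m e)) 0 0 - ((col a U)^T *m e) 0 0.
Proof.
rewrite inner_col mxE [(- (_ *m _)) a 0]mxE; congr (_ - _).
by rewrite mulmx_col !mxE; apply: eq_bigr => i _; rewrite !mxE.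
Qed.

Hypotheses (hU : U^T *m U = 1%:M) (he : sqn e = 1).

Lemma orthonormal_col (a b : 'I_q) : ((col a U)^T *m col b U) 0 0 = (a == b)%:R.
Proof.
have := congr1 (fun M : 'M[R]_q => M a b) hU; rewrite [X in _ = X]mxE => <-.
by rewrite !mxE; apply: eq_bigr => i _; rewrite !mxE.
Qed.

Lemma sqn_isometry (a : 'cV[R]_q) : sqn (U *m a) = sqn a.
Proof. by rewrite /sqn trmx_mul mulmxA -[a^T *m _ *m _]mulmxA hU mulmx1. Qed.

Lemma inner_scaled_dev (Q : 'M[R]_q) (t : 'cV[R]_q) M :
  let w := U *m (Q^T *m t) in
  inner t (Q *m scaled_dev M) =
  Num.sqrt m%:R * (((M *m w)^T *m (M *m e)) 0 0 - (w^T *m e) 0 0).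
Proof.
have innerE (v : 'cV[R]_q) : inner t v = (t^T *m v) 0 0.
  by rewrite mxE; apply: eq_bigr => i _; rewrite mxE.
rewrite /= innerE /scaled_dev -!scalemxAr mxE; congr (_ * _).
rewrite /cross_dev !mulmxBr mxE [(- (_ *m _)) 0 0]mxE.
by rewrite !trmx_mul !trmxK !mulmxA.
Qed.

Lemma l4_lpow k (x : 'cV[R]_k) : l4 x = lpow 4 x.
Proof.
apply: eq_bigr => j _; rewrite big_ord_recl big_ord0 addr0.
by rewrite (exprM `|_| 2 2) real_normK ?num_real// -exprM.
Qed.

(** Flatness of [U] is inherited by all vectors in its column space. *)
Lemma l4_mulmx (a : 'cV[R]_q) : l4 (U *m a) <= q%:R * sqn a ^+ 2 * lpow 4 U.
Proof.
rewrite /lpow mulr_sumr; apply: ler_sum => j _.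
have h1 : (U *m a) j 0 ^+ 2 <= (\sum_i U j i ^+ 2) * sqn a.
  by rewrite mxE sqnE; exact: sum_cauchy_schwarz.
have S0 : 0 <= \sum_i U j i ^+ 2 by apply: sumr_ge0 => i _; exact: sqr_ge0.
have h2 : (\sum_i U j i ^+ 2) ^+ 2 <= q%:R * \sum_i `|U j i| ^+ 4.
  have := sum_cauchy_schwarz (fun i => U j i ^+ 2) (fun=> 1).
  have -> : \sum_i U j i ^+ 2 * 1 = \sum_i U j i ^+ 2 by under eq_bigr do rewrite mulr1.
  have -> : \sum_(i < q) (1 : R) ^+ 2 = q%:R.
    by under eq_bigr do rewrite expr1n; rewrite sumr_const card_ord.
  have -> : \sum_i (U j i ^+ 2) ^+ 2 = \sum_i `|U j i| ^+ 4.
    by apply: eq_bigr => i _; rewrite (exprM `|_| 2 2) real_normK ?num_real.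
  by rewrite mulrC.
apply: (@le_trans _ _ (((\sum_i U j i ^+ 2) * sqn a) ^+ 2)).
  rewrite (exprM _ 2 2) lerXn2r// ?nnegrE ?sqr_ge0//.
  by apply: mulr_ge0 => //; exact: sqn_ge0.
rewrite exprMn [leRHS]mulrAC ler_wpM2r ?sqr_ge0//.
Qed.

Section law.
Variable zeta : nat.
Hypotheses (zeta_gt0 : (0 < zeta)%N) (zeta_le : (zeta <= m)%N).
Local Notation Om := {ffun 'I_n -> sparse_columns R m zeta}.

Lemma avg_total_dev : avg (fun w : Om => total_dev (sketch w)) <=
  (q%:R ^+ 2 + q%:R + 1) * (2 / m%:R).
Proof.
rewrite /total_dev !avgD avg_sum.
have E (x y : 'cV[R]_n) : sqn x = 1 -> sqn y = 1 ->
    avg (fun w : Om => (((sketch w *m x)^T *m (sketch w *m y)) 0 0 - (x^T *m y) 0 0) ^+ 2) <= 2 / m%:R.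
  move=> x1 y1; apply: (le_trans (avg_bilinear_sqr zeta_gt0 zeta_le x y)).
  by rewrite x1 y1 !mulr1 mulrC.
have U1 a : sqn (col a U) = 1 by rewrite /sqn orthonormal_col eqxx.
set k := 2 / m%:R in E *; rewrite !mulrDl; apply: lerD; first apply: lerD.
- rewrite expr2 -mulrA; apply: (@le_trans _ _ (\sum_(a < q) q%:R * k)).
    apply: ler_sum => a _; rewrite avg_sum.
    apply: (@le_trans _ _ (\sum_(b < q) k)).
      apply: ler_sum => b _; apply: le_trans (E _ _ (U1 a) (U1 b)).
      apply/le_of_eq/eq_avg => w.
      by rewrite mxE [(- 1%:M) a b]mxE [1%:M a b]mxE gram_entry orthonormal_col.
    by rewrite sumr_const card_ord -[leLHS]mulr_natl.
  by rewrite sumr_const card_ord -[leLHS]mulr_natl.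
- rewrite avg_sum; apply: (@le_trans _ _ (\sum_(a < q) k)).
    apply: ler_sum => a _; apply: le_trans (E _ _ (U1 a) he).
    by apply/le_of_eq/eq_avg => w; rewrite cross_dev_entry.
  by rewrite sumr_const card_ord -[leLHS]mulr_natl.
rewrite mul1r; apply: le_trans (E _ _ he he).
by apply/le_of_eq/eq_avg => w; rewrite -/(sqn e) he.
Qed.

Lemma avg_bad_sketch (d : R) : 0 < d ->
  avg (fun w : Om => (~~ good_sketch d (sketch w))%:R) <=
  d ^- 2 * ((q%:R ^+ 2 + q%:R + 1) * (2 / m%:R)).
Proof.
move=> d0; apply: (@le_trans _ _ (avg (fun w : Om => d ^- 2 * total_dev (sketch w)))).
  apply: le_avg => w; case: (boolP (good_sketch d (sketch w))) => [_|] /=.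
    rewrite mulr_ge0 ?invr_ge0 ?sqr_ge0//.
    apply: addr_ge0; last exact: sqr_ge0.
    apply: addr_ge0; apply: sumr_ge0 => a _; last exact: sqr_ge0.
    by apply: sumr_ge0 => b _; exact: sqr_ge0.
  apply: contraNT; rewrite -ltNge => H; apply: good_sketchP; first exact: ltW.
  by move: H; rewrite mulrC ltr_pdivrMr ?exprn_gt0// mul1r => /ltW.
by rewrite avgZ ler_wpM2l ?invr_ge0 ?sqr_ge0// avg_total_dev.
Qed.

Lemma avg_norm_scaled_dev :
  avg (fun w : Om => `|scaled_dev (sketch w)|) <= 2 * q%:R.
Proof.
have m0 : 0 < m%:R :> R by rewrite ltr0n (leq_trans zeta_gt0).
have h (w : Om) : `|scaled_dev (sketch w)| <=
    \sum_a (2^-1 + 2^-1 * (m%:R * cross_dev (sketch w) a 0 ^+ 2)).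
  have pos a : 0 <= 2^-1 + 2^-1 * (m%:R * cross_dev (sketch w) a 0 ^+ 2).
    by rewrite addr_ge0// mulr_ge0// mulr_ge0 ?sqr_ge0// ltW.
  apply: mx_norm_leP => [|a j]; first by apply: sumr_ge0 => a _.
  rewrite [j]ord1 (bigD1 a)//= ler_wpDr//; first by apply: sumr_ge0 => b _.
  rewrite mxE -[in leRHS](@sqr_sqrtr _ m%:R) ?(ltW m0)// -exprMn.
  set x := _ * _; have : 0 <= (`|x| - 1) ^+ 2 by exact: sqr_ge0.
  rewrite sqrrB1 real_normK ?num_real// mulr2n; lra.
apply: (le_trans (le_avg h)); rewrite avg_sum.
apply: (@le_trans _ _ (\sum_(a < q) 2)); last by rewrite sumr_const card_ord mulr_natr.
apply: ler_sum => a _.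
have w0 : Om by exact: [ffun=> sparse_columns_inhab R zeta_le].
rewrite avgD (avg_cst w0) !avgZ.
have : avg (fun w : Om => cross_dev (sketch w) a 0 ^+ 2) <= m%:R^-1 * 2.
  have := avg_bilinear_sqr zeta_gt0 zeta_le (col a U) e.
  rewrite he [sqn _]orthonormal_col eqxx !mulr1; apply: le_trans.
  by apply/le_of_eq/eq_avg => w; rewrite cross_dev_entry.
move=> H; have := ler_wpM2l (ltW m0) H; rewrite (mulVKf (lt0r_neq0 m0)); lra.
Qed.

(* [Q] whitens the covariance [1 + xi xi^T] of the limit of [scaled_dev]. *)
Variable Q : 'M[R]_q.
Let xi := U^T *m e.
Hypothesis hQ : Q *m (1%:M + xi *m xi^T) *m Q^T = 1%:M.

Lemma whitened_sqn (t : 'cV[R]_q) :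
  sqn t = sqn (Q^T *m t) + ((Q^T *m t)^T *m xi) 0 0 ^+ 2.
Proof.
by rewrite -spiked_sqn hQ mulmx1.
Qed.

(** The bound of [stein_quad_form] for the cross form of [U Q^T t] and [e] with
    [v = |t|^2], and a last term for the difference between its variance and
    [v]. *)
Definition char_error (v : R) (lam : R) : R :=
  lam * v + lam^-1 / 2 *
      (16 * (3 + m%:R / zeta%:R ^+ 2) * (q%:R * v ^+ 2 * lpow 4 U * lpow 4 e)
       + 24 * (q%:R * v ^+ 2 * lpow 4 U + v ^+ 2 * lpow 4 e))
  + (Num.sqrt m%:R)^-1 / 2 * (1 + 2 * v ^+ 2)
  + (q%:R * v ^+ 2 * lpow 4 U + lpow 4 e) / 2.

(** The variance of the quadratic form is [|t|^2] by whitening, up to the term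
    [2 D] with [D = sum_j x_j^2 e_j^2] that comes from the missing diagonal and
    is small by flatness. *)
Lemma char_scaled_dev (t : 'cV[R]_q) (b lam : R) : 0 < lam ->
  `|avg (fun w : Om => cos (inner t (Q *m scaled_dev (sketch w)) + b))
    - cos b * expR (- (sqn t / 2))| <= char_error (sqn t) lam.
Proof.
move=> lam0; set v := sqn t; set a := Q^T *m t; set x := U *m a.
have c0 := sparse_columns_inhab R zeta_le.
have hK := sparse_kernel R zeta_gt0 zeta_le.
have hA := hollow_cross_form x e.
have v0 : 0 <= v := sqn_ge0 t.
have av : sqn a <= v by rewrite /v (whitened_sqn t) lerDl sqr_ge0.
have a0 : 0 <= sqn a := sqn_ge0 a.
have a2v : sqn a ^+ 2 <= v ^+ 2 by rewrite lerXn2r.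
have L0 : 0 <= lpow 4 U by apply: sumr_ge0 => i _; apply: sumr_ge0 => j _; exact: exprn_ge0.
have Le0 : 0 <= lpow 4 e by apply: sumr_ge0 => i _; apply: sumr_ge0 => j _; exact: exprn_ge0.
have x4 : l4 x <= q%:R * v ^+ 2 * lpow 4 U.
  by apply: (le_trans (l4_mulmx a)); rewrite ler_wpM2r// ler_wpM2l.
have x40 : 0 <= l4 x := l4_ge0 x.
set D := \sum_j x j 0 ^+ 2 * e j 0 ^+ 2.
have D0 : 0 <= D by apply: sumr_ge0 => j _; apply: mulr_ge0; exact: sqr_ge0.
have D1 : 2 * D <= q%:R * v ^+ 2 * lpow 4 U + lpow 4 e.
  apply: (@le_trans _ _ (l4 x + l4 e)); last by rewrite -[lpow 4 e]l4_lpow lerD2r.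
  rewrite /D mulr_sumr -big_split/=; apply: ler_sum => j _.
  rewrite -subr_ge0 (_ : _ - _ = (x j 0 ^+ 2 - e j 0 ^+ 2) ^+ 2) ?sqr_ge0//.
  by ring.
set hm := half_mass (cross_form x e).
have hmE : hm = v - 2 * D.
  rewrite /hm half_mass_cross_form he mulr1 sqn_isometry /v (whitened_sqn t) -/a.
  congr (_ + _ ^+ 2 - _).
  by rewrite /x trmx_mul -mulmxA.
have hm0 : 0 <= hm := half_mass_ge0 _.
have hmv : hm <= v by rewrite hmE gerBl mulr_ge0.
have hm2 : hm ^+ 2 <= v ^+ 2 by rewrite lerXn2r.
have M40 : 0 <= 3 + m%:R / zeta%:R ^+ 2 :> R by rewrite addr_ge0// divr_ge0// sqr_ge0.
have P4 := pow4_mass_cross_form x e M40.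
have Hc := char_fun_quad_form c0 hK hA b lam0.
rewrite -/hm in Hc.
have WE w : inner t (Q *m scaled_dev (sketch w)) =
  quad_form (fun c c' : sparse_columns R m zeta =>
     Num.sqrt m%:R * dot (col_entry c) (col_entry c')) (cross_form x e) w.
  by rewrite inner_scaled_dev quad_cross_form.
set W := quad_form _ _ in Hc WE.
rewrite (@eq_avg _ _ _ (fun w => cos (W w + b))); last by move=> w; rewrite WE.
set err := stein_error _ _ _ _ in Hc.
have He : err <= lam * v + lam^-1 / 2 *
      (16 * (3 + m%:R / zeta%:R ^+ 2) * (q%:R * v ^+ 2 * lpow 4 U * lpow 4 e)
       + 24 * (q%:R * v ^+ 2 * lpow 4 U + v ^+ 2 * lpow 4 e))
      + (Num.sqrt m%:R)^-1 / 2 * (1 + 2 * v ^+ 2).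
  rewrite /err /stein_error -/hm; apply: lerD; first apply: lerD.
  - by rewrite ler_wpM2l// ltW.
  - rewrite ler_wpM2l//; first by rewrite divr_ge0// invr_ge0 ltW.
    apply: (le_trans P4); rewrite he expr1n mul1r -!l4_lpow sqn_isometry.
    apply: lerD.
      by rewrite ler_wpM2l ?mulr_ge0// ler_wpM2r// l4_ge0.
    rewrite ler_wpM2l//; apply: lerD => //.
    by rewrite ler_wpM2r// l4_ge0.
  rewrite ler_wpM2l ?divr_ge0 ?invr_ge0 ?sqrtr_ge0// lerD2l.
  by rewrite ler_wpM2l.
have Hexp : `|expR (- (hm / 2)) - expR (- (v / 2))| <= (q%:R * v ^+ 2 * lpow 4 U + lpow 4 e) / 2.
  have -> : expR (- (hm / 2)) - expR (- (v / 2)) = expR (- (hm / 2)) * (1 - expR (- D)).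
    by rewrite mulrBr mulr1 -expRD hmE; congr (_ - expR _); field.
  have E1 : expR (- (hm / 2)) <= 1 by rewrite -expR0 ler_expR oppr_le0 divr_ge0.
  have E2 : expR (- D) <= 1 by rewrite -expR0 ler_expR oppr_le0.
  have E3 : 1 + - D <= expR (- D) := expR_ge1Dx _.
  rewrite ger0_norm; last by rewrite mulr_ge0 ?expR_ge0// subr_ge0.
  apply: (@le_trans _ _ (1 - expR (- D))).
    by rewrite ler_piMl// subr_ge0.
  lra.
have -> : avg (fun w => cos (W w + b)) - cos b * expR (- (v / 2)) =
  (avg (fun w => cos (W w + b)) - cos b * expR (- (hm / 2)))
  + cos b * (expR (- (hm / 2)) - expR (- (v / 2))) by ring.
apply: (le_trans (ler_normD _ _)); apply: lerD; first exact: le_trans He.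
by rewrite normrM (le_trans (ler_piMl _ (norm_cos_le1 b))).
Qed.

End law.
End sketch_statistics.

(** * The central limit theorem for the sketch *)

Section asymptotics.
Context (R : realType) (p : nat).
Local Notation q := p.+1.
Variables (m zeta : nat -> nat) (U : forall n, 'M[R]_(n, q)) (e : forall n, 'cV[R]_n).
Hypotheses (m_oo : m n @[n --> \oo] --> \oo)
  (zeta_m : (zeta (m n))%:R ^+ 2 / (m n)%:R @[n --> \oo] --> (0 : R))
  (zeta_gt0 : \forall n \near \oo, (0 < zeta (m n) <= m n)%N)
  (U_flat : Num.sqrt (m n)%:R / (zeta (m n))%:R * lpow 4 (U n) @[n --> \oo] --> (0 : R))
  (e_flat : Num.sqrt (m n)%:R / (zeta (m n))%:R * lpow 4 (e n) @[n --> \oo] --> (0 : R)).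

Lemma inv_sqrt_cvg0 : (Num.sqrt (m n)%:R)^-1 @[n --> \oo] --> (0 : R).
Proof.
apply/cvgrPdist_le => eps eps0.
have : \forall n \near \oo, ((Num.truncn (eps ^- 2)).+1 <= m n)%N.
  by have /cvgnyPge := m_oo; apply.
apply: filterS => n mn; rewrite sub0r normrN ger0_norm ?invr_ge0 ?sqrtr_ge0//.
have h : eps ^- 2 < (m n)%:R.
  have x0 : 0 <= eps ^- 2 by rewrite invr_ge0 sqr_ge0.
  have /andP[_ h] := truncn_itv x0; apply: (lt_le_trans h).
  by rewrite ler_nat.
have m0 : 0 < (m n)%:R :> R by apply: lt_trans h; rewrite invr_gt0 exprn_gt0.
rewrite -[eps]invrK lef_pV2 ?posrE ?sqrtr_gt0 ?invr_gt0//.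
rewrite -[eps^-1]ger0_norm ?invr_ge0 ?(ltW eps0)// -sqrtr_sqr ler_wsqrtr//.
by rewrite exprVn ltW.
Qed.

Lemma lpow4_ge0 k l (A : 'M[R]_(k, l)) : 0 <= lpow 4 A.
Proof. by apply: sumr_ge0 => i _; apply: sumr_ge0 => j _; exact: exprn_ge0. Qed.

(** The fourth moment [3 + m / zeta^2] of the kernel multiplies
    [lpow 4 U * lpow 4 e]; with [r = sqrt m / zeta], eventually at least one, the
    product is at most [4 (r * lpow 4 U) (r * lpow 4 e)]. *)
Lemma char_error_small (v eps : R) : 0 <= v -> 0 < eps ->
  exists2 lam : R, 0 < lam & \forall n \near \oo,
    char_error (m n) (U n) (e n) (zeta (m n)) v lam <= eps.
Proof.
move=> v0 eps0; pose lam := eps / (2 * (v + 1)).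
have v10 : 0 < 2 * (v + 1) by rewrite mulr_gt0// ltr_wpDl.
have lam0 : 0 < lam by rewrite divr_gt0.
exists lam => //.
pose a n := Num.sqrt (m n)%:R / (zeta (m n))%:R * lpow 4 (U n) : R.
pose b n := Num.sqrt (m n)%:R / (zeta (m n))%:R * lpow 4 (e n) : R.
pose s n := (Num.sqrt (m n)%:R)^-1 : R.
pose G n := lam^-1 / 2 * (64 * q%:R * v ^+ 2 * (a n * b n)
   + 24 * (q%:R * v ^+ 2 * a n + v ^+ 2 * b n)) + s n * (2^-1 * (1 + 2 * v ^+ 2))
   + (q%:R * v ^+ 2 * a n + b n) * 2^-1.
have G0 : G n @[n --> \oo] --> (0 : R).
  rewrite [X in _ --> X](_ : 0 = lam^-1 / 2 * (64 * q%:R * v ^+ 2 * (0 * 0)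
   + 24 * (q%:R * v ^+ 2 * 0 + v ^+ 2 * 0)) + 0 * (2^-1 * (1 + 2 * v ^+ 2))
   + (q%:R * v ^+ 2 * 0 + 0) * 2^-1); last by ring.
  have c k : (fun=> k : R) @ \oo --> (k : R) by exact: cvg_cst.
  have as0 := inv_sqrt_cvg0.
  by repeat (first [exact: c | exact: U_flat | exact: e_flat | exact: as0
     | apply: cvgD | apply: cvgM]).
have /cvgrPdist_le/(_ (eps / 2)) := G0.
rewrite divr_gt0// => /(_ isT) Gn.
have /cvgrPdist_le/(_ 1 ltr01) zn := zeta_m.
near=> n.
have /andP[z0 zm] : (0 < zeta (m n) <= m n)%N by near: n.
have Gn' : `|0 - G n| <= eps / 2 by near: n.
have zn' : `|0 - (zeta (m n))%:R ^+ 2 / (m n)%:R| <= 1 :> R by near: n.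
have zR : 0 < (zeta (m n))%:R :> R by rewrite ltr0n.
have mR : 0 < (m n)%:R :> R by rewrite ltr0n (leq_trans z0).
have z2m : (zeta (m n))%:R ^+ 2 <= (m n)%:R :> R.
  move: zn'; rewrite sub0r normrN ger0_norm ?divr_ge0 ?sqr_ge0// ler_pdivrMr//.
  by rewrite mul1r.
pose r : R := Num.sqrt (m n)%:R / (zeta (m n))%:R.
have r2 : (m n)%:R / (zeta (m n))%:R ^+ 2 = r ^+ 2.
  by rewrite /r expr_div_n sqr_sqrtr// ltW.
have r1 : 1 <= r.
  rewrite /r ler_pdivlMr// mul1r -[leLHS]ger0_norm// -sqrtr_sqr.
  by rewrite ler_wsqrtr.
have A0 := lpow4_ge0 (U n); have B0 := lpow4_ge0 (e n).
have aE : a n = r * lpow 4 (U n) by [].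
have bE : b n = r * lpow 4 (e n) by [].
have Aa : lpow 4 (U n) <= a n by rewrite aE ler_peMl.
have Bb : lpow 4 (e n) <= b n by rewrite bE ler_peMl.
have ABab : (3 + r ^+ 2) * (lpow 4 (U n) * lpow 4 (e n)) <= 4 * (a n * b n).
  rewrite aE bE; have : 0 <= lpow 4 (U n) * lpow 4 (e n) by rewrite mulr_ge0.
  have : 1 <= r ^+ 2 by rewrite expr_ge1// (le_trans _ r1).
  move: (lpow 4 (U n)) (lpow 4 (e n)) => x y h1 h2; nra.
have qv0 : 0 <= q%:R * v ^+ 2 by rewrite mulr_ge0// sqr_ge0.
have l0 : 0 <= lam^-1 / 2 by rewrite divr_ge0// invr_ge0 ltW.
apply: (@le_trans _ _ (lam * v + G n)).
  rewrite /char_error r2 /G -!addrA lerD2l; apply: lerD; last first.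
    by apply: lerD; [apply/le_of_eq; rewrite /s; ring|rewrite ler_wpM2r// lerD// ler_wpM2l].
  rewrite ler_wpM2l// lerD//; last first.
    by rewrite ler_wpM2l// lerD// ler_wpM2l// sqr_ge0.
  rewrite [leLHS](_ : _ = 16 * (q%:R * v ^+ 2) * ((3 + r ^+ 2) * (lpow 4 (U n) * lpow 4 (e n)))); last by ring.
  rewrite [leRHS](_ : _ = 16 * (q%:R * v ^+ 2) * (4 * (a n * b n))); last by ring.
  by rewrite ler_wpM2l// mulr_ge0.
have : lam * v <= eps / 2.
  rewrite /lam; have -> : eps / (2 * (v + 1)) * v = eps / 2 * (v / (v + 1)).
    by field; rewrite gt_eqF// ltr_wpDl.
  rewrite ler_piMr ?divr_ge0 ?(ltW eps0)// ler_pdivrMr ?ltr_wpDl// mul1r.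
  by rewrite lerDl.
move: Gn'; rewrite sub0r normrN ler_norml => /andP[_]; lra.
Unshelve. all: end_near. Qed.

Lemma bad_sketch_small (d eps : R) : 0 < d -> 0 < eps ->
  \forall n \near \oo, d ^- 2 * ((q%:R ^+ 2 + q%:R + 1) * (2 / (m n)%:R)) <= eps.
Proof.
move=> d0 eps0.
pose s n := (Num.sqrt (m n)%:R)^-1 : R.
have : d ^- 2 * ((q%:R ^+ 2 + q%:R + 1) * 2) * (s n * s n) @[n --> \oo] --> (0 : R).
  rewrite [X in _ --> X](_ : 0 = d ^- 2 * ((q%:R ^+ 2 + q%:R + 1) * 2) * (0 * 0)); last by rewrite !mulr0.
  by apply: cvgM; [exact: cvg_cst|apply: cvgM; exact: inv_sqrt_cvg0].
move=> /cvgrPdist_le/(_ eps eps0); apply: filterS => n.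
rewrite sub0r normrN ler_norml => /andP[_]; apply: le_trans.
by rewrite /s -invfM -expr2 sqr_sqrtr// !mulrA.
Qed.

Section clt.
Variables (Q : nat -> 'M[R]_q) (d : nat -> measure_display)
  (T : forall n, measurableType (d n)) (P : forall n, probability (T n) R)
  (S : forall n, {RV (P n) >-> 'M[R]_(m n, n)}) (Z : forall n, {RV (P n) >-> 'cV[R]_q}).
Hypotheses
  (S_sse : \forall n \near \oo, sparse_sign_embedding (zeta (m n)) (S n))
  (U_orth : \forall n \near \oo, (U n)^T *m U n = 1%:M)
  (e_unit : \forall n \near \oo, sqn (e n) = 1)
  (Q_white : \forall n \near \oo,
     Q n *m (1%:M + ((U n)^T *m e n) *m ((U n)^T *m e n)^T) *m (Q n)^T = 1%:M).
Variables (C d0 : R).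
Hypotheses (C_ge0 : 0 <= C) (d0_gt0 : 0 < d0)
  (Z_approx : forall dl : R, 0 < dl -> dl <= d0 -> \forall n \near \oo, forall x,
     good_sketch (U n) (e n) dl (S n x) ->
     `|Z n x - Q n *m scaled_dev (U n) (e n) (S n x)| <=
       C * dl * `|scaled_dev (U n) (e n) (S n x)|).

(** [Q K Q^T = 1] and [K >= 1] give [Q Q^T <= 1]. *)
Lemma white_norm_le1 n :
  Q n *m (1%:M + ((U n)^T *m e n) *m ((U n)^T *m e n)^T) *m (Q n)^T = 1%:M ->
  `|Q n| <= 1.
Proof.
move=> hQ; apply: mx_norm_leP => // i j.
have := whitened_sqn hQ (delta_mx i 0); set a := (Q n)^T *m _ => e1.
have a1 : sqn a <= 1.
  have <- : sqn (delta_mx i 0 : 'cV[R]_q) = 1.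
    rewrite sqnE (bigD1 i)//= big1 ?addr0; first by rewrite mxE !eqxx expr1n.
    by move=> k ki; rewrite mxE (negbTE ki) expr0n.
  by rewrite e1 lerDl sqr_ge0.
have aj : a j 0 = Q n i j by rewrite /a -colE !mxE.
rewrite -aj -(@ler_pXn2r _ 2) ?nnegrE// real_normK ?num_real// expr1n.
apply: le_trans a1; rewrite sqnE (bigD1 j)//= lerDl.
by apply: sumr_ge0 => k _; exact: sqr_ge0.
Qed.

(** By [Z_approx] the approximation error is [C dl] times the size of
    [scaled_dev], whose mean is bounded; so both the characteristic function
    and the tightness of [Z] can be read off the whitened deviation. *)
Theorem sketch_clt : cvg_in_distribution Z (std_normal R q).
Proof.
have q0 : 0 < q%:R :> R by rewrite ltr0n.
apply: levy_continuity => [t b|eps eps0].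
  rewrite char_std_normal -sqnE; set v := sqn t.
  apply/cvgrPdist_le => eps eps0.
  have eps3 : 0 < eps / 3 by rewrite divr_gt0.
  have eps6 : 0 < eps / 6 by rewrite divr_gt0.
  pose kt := q%:R * `|t|.
  have kt0 : 0 <= kt by rewrite mulr_ge0.
  pose D := kt * C * (2 * q%:R) + 1.
  have D0 : 0 < D by rewrite ltr_wpDl// !mulr_ge0.
  pose dl := Num.min d0 (eps / 3 / D).
  have dl0 : 0 < dl by rewrite lt_min d0_gt0 divr_gt0.
  have dld0 : dl <= d0 by rewrite ge_min lexx.
  have dlD : dl * D <= eps / 3 by rewrite -ler_pdivlMr// ge_min lexx orbT.
  have [lam lam0 charE] := char_error_small (sqn_ge0 t) eps3.
  have badE := bad_sketch_small dl0 eps6.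
  have ZE := Z_approx dl0 dld0.
  near=> n.
  have Sn : sparse_sign_embedding (zeta (m n)) (S n) by near: n.
  have /andP[z0 zm] : (0 < zeta (m n) <= m n)%N by near: n.
  have Un : (U n)^T *m U n = 1%:M by near: n.
  have en : sqn (e n) = 1 by near: n.
  have Qn : Q n *m (1%:M + ((U n)^T *m e n) *m ((U n)^T *m e n)^T) *m (Q n)^T = 1%:M by near: n.
  have Zn : forall x, good_sketch (U n) (e n) dl (S n x) ->
     `|Z n x - Q n *m scaled_dev (U n) (e n) (S n x)| <=
       C * dl * `|scaled_dev (U n) (e n) (S n x)| by near: n.
  have charn : char_error (m n) (U n) (e n) (zeta (m n)) (sqn t) lam <= eps / 3 by near: n.
  have badn : dl ^- 2 * ((q%:R ^+ 2 + q%:R + 1) * (2 / (m n)%:R)) <= eps / 6 by near: n.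
  have H1 := char_scaled_dev Un en z0 zm Qn t b lam0.
  have H2 := avg_bad_sketch Un en z0 zm dl0.
  have H3 := avg_norm_scaled_dev Un en z0 zm.
  pose g (w : {ffun 'I_n -> sparse_columns R (m n) (zeta (m n))}) :=
    kt * C * dl * `|scaled_dev (U n) (e n) (sketch w)|.
  have H4 := @mean_sketch R _ _ (P n) _ _ _ (S n) Sn (fun x => cos (inner t (Z n x) + b))
    (fun w => cos (inner t (Q n *m scaled_dev (U n) (e n) (sketch w)) + b)) g
    (fun w => good_sketch (U n) (e n) dl (sketch w)) 1.
  have {}H4 := H4 _ (fun x => norm_cos_le1 _) (fun w => norm_cos_le1 _) _ _.
  have mZ : measurable_fun setT (fun x => cos (inner t (Z n x) + b)).
    have [mw _] := bdd_meas_wave t b.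
    exact: (measurableT_comp mw (measurable_funP (Z n))).
  have g0 w : 0 <= g w by rewrite /g !mulr_ge0// ltW.
  have Yg x w : good_sketch (U n) (e n) dl (sketch w) -> S n x = sketch w ->
    `|cos (inner t (Z n x) + b) - cos (inner t (Q n *m scaled_dev (U n) (e n) (sketch w)) + b)| <= g w.
    move=> Gw Sw; apply: (le_trans (cos_lipschitz _ _)).
    have -> : inner t (Z n x) + b - (inner t (Q n *m scaled_dev (U n) (e n) (sketch w)) + b)
      = (t^T *m (Z n x - Q n *m scaled_dev (U n) (e n) (sketch w))) 0 0.
      have innerE (u : 'cV[R]_q) : inner t u = (t^T *m u) 0 0.
        by rewrite mxE; apply: eq_bigr => i _; rewrite mxE.
      by rewrite !innerE mulmxBr [RHS]mxE [X in _ = _ + X]mxE; ring.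
    apply: (le_trans (inner_norm_le _ _)); rewrite -/kt.
    rewrite [g w](_ : _ = kt * (C * dl * `|scaled_dev (U n) (e n) (sketch w)|)); last first.
      by rewrite /g; ring.
    rewrite ler_wpM2l//.
    by rewrite -Sw; apply: Zn; rewrite Sw.
  have {}H4 := H4 mZ g0 Yg.
  have gE : avg g <= eps / 3.
    rewrite /g avgZ; apply: le_trans dlD.
    apply: (@le_trans _ _ (kt * C * dl * (2 * q%:R))).
      by rewrite ler_wpM2l// !mulr_ge0// ltW.
    rewrite (_ : kt * C * dl * (2 * q%:R) = dl * (kt * C * (2 * q%:R))); last by ring.
    by rewrite ler_wpM2l ?(ltW dl0)// /D lerDl.
  rewrite distrC.
  rewrite (_ : _ - _ = (mean (P n) (fun x => cos (inner t (Z n x) + b))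
     - avg (fun w : {ffun 'I_n -> sparse_columns R (m n) (zeta (m n))} =>
          cos (inner t (Q n *m scaled_dev (U n) (e n) (sketch w)) + b)))
    + (avg (fun w : {ffun 'I_n -> sparse_columns R (m n) (zeta (m n))} =>
          cos (inner t (Q n *m scaled_dev (U n) (e n) (sketch w)) + b))
       - cos b * expR (- (v / 2)))); last by ring.
  apply: (le_trans (ler_normD _ _)).
  have := le_trans H1 charn; have := le_trans H2 badn.
  move: H4 gE; rewrite mulr1 -/v; lra.
(* Tightness: [|Z| <= c1 * |scaled_dev|] on the good event, then Markov. *)
pose c1 := q%:R + C * d0.
have c10 : 0 < c1 by rewrite ltr_wpDr// mulr_ge0// ltW.
pose K := 4 * c1 * q%:R / eps.
have K0 : 0 < K by rewrite divr_gt0// !mulr_gt0.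
exists K => //.
have eps4 : 0 < eps / 4 by rewrite divr_gt0.
have badE := bad_sketch_small d0_gt0 eps4.
have ZE := Z_approx d0_gt0 (lexx d0).
near=> n.
have Sn : sparse_sign_embedding (zeta (m n)) (S n) by near: n.
have /andP[z0 zm] : (0 < zeta (m n) <= m n)%N by near: n.
have Un : (U n)^T *m U n = 1%:M by near: n.
have en : sqn (e n) = 1 by near: n.
have Qn : Q n *m (1%:M + ((U n)^T *m e n) *m ((U n)^T *m e n)^T) *m (Q n)^T = 1%:M by near: n.
have Zn : forall x, good_sketch (U n) (e n) d0 (S n x) ->
   `|Z n x - Q n *m scaled_dev (U n) (e n) (S n x)| <=
     C * d0 * `|scaled_dev (U n) (e n) (S n x)| by near: n.
have badn : d0 ^- 2 * ((q%:R ^+ 2 + q%:R + 1) * (2 / (m n)%:R)) <= eps / 4 by near: n.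
have H2 := avg_bad_sketch Un en z0 zm d0_gt0.
have H3 := avg_norm_scaled_dev Un en z0 zm.
pose g (w : {ffun 'I_n -> sparse_columns R (m n) (zeta (m n))}) :=
  c1 / K * `|scaled_dev (U n) (e n) (sketch w)|.
have H4 := @mean_sketch R _ _ (P n) _ _ _ (S n) Sn (fun x => \1_(~` cube K) (Z n x))
  (fun w => 0) g (fun w => good_sketch (U n) (e n) d0 (sketch w)) 1.
have mZ : measurable_fun setT (fun x => \1_(~` cube K) (Z n x) : R).
  have [mw _] := bdd_meas_cubeC q K.
  exact: (measurableT_comp mw (measurable_funP (Z n))).
have Y1 x : `|\1_(~` cube K) (Z n x)| <= 1 :> R.
  by rewrite indicE normr_nat; case: (_ \in _).
have F1 (w : {ffun 'I_n -> sparse_columns R (m n) (zeta (m n))}) : `|0 : R| <= 1 by rewrite normr0.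
have g0 w : 0 <= g w by rewrite /g mulr_ge0// divr_ge0// ltW.
have Yg x w : good_sketch (U n) (e n) d0 (sketch w) -> S n x = sketch w ->
    `|\1_(~` cube K) (Z n x) - 0| <= g w.
  move=> Gw Sw; rewrite subr0 indicE normr_nat.
  case: (boolP (_ \in _)) => [|_]; last exact: g0.
  rewrite inE /cube /= => /existsNP[i /negP]; rewrite -ltNge => Ki.
  rewrite /g -mulrA mulrCA -[leLHS]mulr1 -ler_pdivrMl//; last first.
    by rewrite invr_gt0.
  rewrite invrK mulr1 mulr1.
  apply: (le_trans (ltW Ki)); apply: (le_trans (mx_entry_le _ _ _)).
  have ZQ := Zn x; rewrite Sw in ZQ; have {}ZQ := ZQ Gw.
  rewrite -[Z n x](subrK (Q n *m scaled_dev (U n) (e n) (sketch w))) addrC.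
  apply: (le_trans (ler_normD _ _)); rewrite /c1 mulrDl lerD//.
  apply: (le_trans (norm_mulmx _ _)); rewrite ler_wpM2r//.
  by rewrite ler_piMr// white_norm_le1.
have {}H4 := H4 mZ Y1 F1 g0 Yg.
have gE : avg g <= eps / 2.
  rewrite /g avgZ; apply: (@le_trans _ _ (c1 / K * (2 * q%:R))).
    by rewrite ler_wpM2l// divr_ge0// ltW.
  apply/le_of_eq; rewrite /K; field.
  by rewrite !gt_eqF.
move: H4; rewrite avg0 subr0 ler_norml => /andP[_ H4].
apply: (le_trans H4); rewrite [leRHS](_ : eps = eps / 2 + 2 * 1 * (eps / 4)); last by field.
by apply: lerD gE _; rewrite ler_wpM2l// (le_trans H2 badn).
Unshelve. all: end_near. Qed.

End clt.
End asymptotics.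

(** * Studentized estimators *)

Section studentized_clt.
Context (R : realType) (p : nat).
Local Notation q := p.+1.
Variables (m zeta : nat -> nat) (U : forall n, 'M[R]_(n, q)) (e : forall n, 'cV[R]_n).
Hypotheses (m_oo : m n @[n --> \oo] --> \oo)
  (zeta_m : (zeta (m n))%:R ^+ 2 / (m n)%:R @[n --> \oo] --> (0 : R))
  (U_flat : Num.sqrt (m n)%:R / (zeta (m n))%:R * lpow 4 (U n) @[n --> \oo] --> (0 : R))
  (e_flat : Num.sqrt (m n)%:R / (zeta (m n))%:R * lpow 4 (e n) @[n --> \oo] --> (0 : R)).
Variables (d : nat -> measure_display)
  (T : forall n, measurableType (d n)) (P : forall n, probability (T n) R)
  (S : forall n, {RV (P n) >-> 'M[R]_(m n, n)}) (Z : forall n, {RV (P n) >-> 'cV[R]_q}).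
Hypotheses
  (S_sse : \forall n \near \oo, sparse_sign_embedding (zeta (m n)) (S n))
  (U_orth : \forall n \near \oo, (U n)^T *m U n = 1%:M)
  (e_unit : \forall n \near \oo, sqn (e n) = 1).
Variables (N : nat -> 'M[R]_q) (s : nat -> R) (Khat : forall n, 'M[R]_(m n, n) -> 'M[R]_q)
  (kappa C1 d1 : R).
Let K n : 'M[R]_q := 1%:M + ((U n)^T *m e n) *m ((U n)^T *m e n)^T.
Hypotheses (kappa_ge0 : 0 <= kappa) (C1_ge0 : 0 <= C1) (d1_gt0 : 0 < d1)
  (s_gt0 : \forall n \near \oo, 0 < s n)
  (N_le : \forall n \near \oo, `|N n| <= kappa)
  (N_ge : \forall n \near \oo, forall v, sqn v <= sqn ((N n)^T *m v))
  (Khat_near : \forall n \near \oo, forall dl (M : 'M[R]_(m n, n)), dl <= d1 ->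
     good_sketch (U n) (e n) dl M ->
     (Khat M)^T = Khat M /\ `|Khat M - K n| <= C1 * dl)
  (Z_student : \forall n \near \oo, forall x, good_sketch (U n) (e n) d1 (S n x) ->
     s n ^+ 2 *: (N n *m Khat (S n x) *m (N n)^T) \in unitmx ->
     Z n x = invsqrtmx (s n ^+ 2 *: (N n *m Khat (S n x) *m (N n)^T)) *m
       (s n *: (N n *m (invmx (gram (S n x *m U n)) *m scaled_dev (U n) (e n) (S n x))))).

Lemma good_sketchS n (a b : R) (M : 'M[R]_(m n, n)) : a <= b ->
  good_sketch (U n) (e n) a M -> good_sketch (U n) (e n) b M.
Proof. by move=> ab /and3P[h1 h2 h3]; apply/and3P; split; exact: le_trans ab. Qed.

(** [B0 = (N K N^T)^(1/2)] is coercive because [N K N^T >= N N^T >= 1]. *)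
Lemma whitening_exists n : (forall v : 'cV[R]_q, sqn v <= sqn ((N n)^T *m v)) ->
  exists B0 : 'M[R]_q, [/\ B0^T = B0, B0 *m B0 = N n *m K n *m (N n)^T,
    (forall v : 'cV[R]_q, sqn v <= (v^T *m B0 *m v) 0 0) &
    (forall v : 'cV[R]_q, sqn v <= (v^T *m (N n *m K n *m (N n)^T) *m v) 0 0)].
Proof.
move=> Nn; set A0 := N n *m K n *m (N n)^T.
have A0pos (v : 'cV[R]_q) : sqn v <= (v^T *m A0 *m v) 0 0.
  rewrite /A0 /K spiked_sqn; apply: (le_trans (Nn v)).
  by rewrite lerDl sqr_ge0.
have sK : (K n)^T = K n by rewrite /K linearD/= trmx1 trmx_mul trmxK.
have sA0 : A0^T = A0 by rewrite /A0 !trmx_mul trmxK sK mulmxA.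
have [|B0 [sB0 BB B0pos]] := psd_sqrt_exists ler01 sA0.
  by move=> v; rewrite mul1r.
by exists B0; split => // v; have := B0pos v; rewrite sqrtr1 mul1r.
Qed.

(** The limit [B0^-1 N] of the normalised coefficient whitens the deviation, and
    on the good event the studentized error is within a multiple of
    [dl * |scaled_dev|] of [B0^-1 N scaled_dev]. *)
Theorem studentized_clt : cvg_in_distribution Z (std_normal R q).
Proof.
have [B0 B0P] : exists B0 : nat -> 'M[R]_q, forall n,
    (forall v : 'cV[R]_q, sqn v <= sqn ((N n)^T *m v)) ->
    [/\ (B0 n)^T = B0 n, B0 n *m B0 n = N n *m K n *m (N n)^T,
    (forall v : 'cV[R]_q, sqn v <= (v^T *m B0 n *m v) 0 0) &
    (forall v : 'cV[R]_q, sqn v <= (v^T *m (N n *m K n *m (N n)^T) *m v) 0 0)].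
  have H n : exists B : 'M[R]_q, (forall v : 'cV[R]_q, sqn v <= sqn ((N n)^T *m v)) ->
    [/\ B^T = B, B *m B = N n *m K n *m (N n)^T,
    (forall v : 'cV[R]_q, sqn v <= (v^T *m B *m v) 0 0) &
    (forall v : 'cV[R]_q, sqn v <= (v^T *m (N n *m K n *m (N n)^T) *m v) 0 0)].
    have [Nn|Nn] := pselect (forall v : 'cV[R]_q, sqn v <= sqn ((N n)^T *m v)).
      by have [B0 HB] := whitening_exists Nn; exists B0.
    by exists 0.
  by have [B0 B0P] := choice H; exists B0.
have uB0 n : (forall v : 'cV[R]_q, sqn v <= sqn ((N n)^T *m v)) -> B0 n \in unitmx.
  move=> /B0P[_ _ B0pos _]; apply: (coercive_unitmx ltr01) => v.
  by rewrite mul1r.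
have q1 : 1 <= q%:R :> R by rewrite ler1n.
have q0 : 0 < q%:R :> R by rewrite ltr0n.
(* [d0] makes the two perturbation lemmas applicable: [E * dl] is
   [q^4 * eta], and [q * dl <= 1/2] inverts the sketched Gram matrix. *)
pose E := q%:R ^+ 6 * kappa ^+ 2 * C1.
have E0 : 0 <= E by rewrite /E !mulr_ge0 ?exprn_ge0.
pose d0 := Num.min d1 (Num.min (2^-1 / q%:R) (2^-1 / (E + 1))).
have d00 : 0 < d0.
  by rewrite !lt_min d1_gt0 !divr_gt0// ltr_wpDl.
pose C := 2 * q%:R ^+ 8 * kappa ^+ 3 * C1 + 4 * q%:R ^+ 4 * kappa.
have C0 : 0 <= C.
  by apply: addr_ge0; rewrite !mulr_ge0 ?exprn_ge0.
apply: (@sketch_clt R p m zeta U e m_oo zeta_m _ U_flat e_flat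
  (fun n => invmx (B0 n) *m N n) d T P S Z S_sse U_orth e_unit _ C d0 C0 d00).
- by apply: filterS S_sse => n [/andP[z0 zm] _ _]; rewrite z0.
- apply: filterS N_ge => n Nn; have uB := uB0 n Nn.
  have [sB0 BB _ _] := B0P n Nn.
  rewrite -/(K n) trmx_mul trmx_inv sB0.
  rewrite [LHS](_ : _ = invmx (B0 n) *m (N n *m K n *m (N n)^T) *m invmx (B0 n)); last first.
    by rewrite !mulmxA.
  by rewrite -BB mulKmx// mulmxV.
move=> dl dl0 dld0.
have dld1 : dl <= d1 by apply: (le_trans dld0); rewrite ge_min lexx.
have qdl : q%:R * dl <= 2^-1.
  rewrite mulrC -ler_pdivlMr//; apply: (le_trans dld0).
  by rewrite !ge_min lexx !orbT.
have Edl : E * dl <= 2^-1.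
  apply: (@le_trans _ _ ((E + 1) * dl)); first by rewrite ler_wpM2r ?(ltW dl0)// lerDl.
  rewrite mulrC -ler_pdivlMr ?ltr_wpDl//; apply: (le_trans dld0).
  by rewrite !ge_min lexx !orbT.
near=> n => x Gx.
have Nn : forall v : 'cV[R]_q, sqn v <= sqn ((N n)^T *m v) by near: n.
have Nk : `|N n| <= kappa by near: n.
have sn : 0 < s n by near: n.
have [sB0 BB B0pos A0pos] := B0P n Nn.
have uB := uB0 n Nn.
set M := S n x in Gx *.
have [sK hK] : (Khat M)^T = Khat M /\ `|Khat M - K n| <= C1 * dl.
  have H : forall dl (M : 'M[R]_(m n, n)), dl <= d1 ->
     good_sketch (U n) (e n) dl M ->
     (Khat M)^T = Khat M /\ `|Khat M - K n| <= C1 * dl by near: n.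
  exact: H.
have HZ : s n ^+ 2 *: (N n *m Khat M *m (N n)^T) \in unitmx ->
     Z n x = invsqrtmx (s n ^+ 2 *: (N n *m Khat M *m (N n)^T)) *m
       (s n *: (N n *m (invmx (gram (M *m U n)) *m scaled_dev (U n) (e n) M))).
  have H : forall x, good_sketch (U n) (e n) d1 (S n x) ->
     s n ^+ 2 *: (N n *m Khat (S n x) *m (N n)^T) \in unitmx ->
     Z n x = invsqrtmx (s n ^+ 2 *: (N n *m Khat (S n x) *m (N n)^T)) *m
       (s n *: (N n *m (invmx (gram (S n x *m U n)) *m scaled_dev (U n) (e n) (S n x)))).
    by near: n.
  by apply: H; exact: good_sketchS dld1 Gx.
have /and3P[GH _ _] := Gx.
have [_ _ Hinv] := invmx_near1 GH qdl.
set t := scaled_dev (U n) (e n) M in HZ *.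
set A := N n *m Khat M *m (N n)^T in HZ *.
set A0 := N n *m K n *m (N n)^T in BB A0pos.
pose eta := q%:R ^+ 2 * kappa ^+ 2 * C1 * dl.
have Aeta : `|A - A0| <= eta.
  have -> : A - A0 = N n *m (Khat M - K n) *m (N n)^T.
    by rewrite mulmxBr mulmxBl.
  apply: (le_trans (norm_mulmx _ _)); rewrite norm_trmx.
  rewrite [eta](_ : _ = q%:R * (q%:R * kappa * (C1 * dl)) * kappa); last by rewrite /eta; ring.
  rewrite ler_pM// ?mulr_ge0// ler_wpM2l//.
  apply: (le_trans (norm_mulmx _ _)).
  by rewrite ler_pM// ?mulr_ge0// ler_wpM2l.
have eta_small : q%:R ^+ 4 * eta <= 2^-1.
  by rewrite [leLHS](_ : _ = E * dl)// /eta /E; ring.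
have sA : A^T = A by rewrite /A !trmx_mul trmxK sK mulmxA.
have Bz : B0 n *m (invmx (B0 n) *m N n *m t) = N n *m t.
  by rewrite -mulmxA mulKVmx.
have [uA Hst] := @studentization_perturbation R p A A0 (B0 n)
  (N n *m (invmx (gram (M *m U n)) *m t)) (N n *m t) (invmx (B0 n) *m N n *m t) (s n) eta
  sn sA sB0 BB A0pos B0pos Aeta eta_small Bz.
rewrite (HZ uA); apply: (le_trans Hst).
have y0 : `|N n *m t| <= q%:R * kappa * `|t|.
  by apply: (le_trans (norm_mulmx _ _)); rewrite ler_wpM2r// ler_wpM2l.
have yy0 : `|N n *m (invmx (gram (M *m U n)) *m t) - N n *m t| <=
    q%:R * kappa * (q%:R * (2 * q%:R * dl) * `|t|).
  rewrite -mulmxBr -{2}[t]mul1mx -mulmxBl.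
  apply: (le_trans (norm_mulmx _ _)); rewrite ler_pM// ?mulr_ge0//; first by rewrite ler_wpM2l.
  apply: (le_trans (norm_mulmx _ _)).
  by rewrite ler_wpM2r// ler_wpM2l.
have eta0 : 0 <= eta by exact: le_trans (normr_ge0 _) Aeta.
rewrite [leRHS](_ : _ = 2 * q%:R ^+ 5 * eta * (q%:R * kappa * `|t|)
   + 2 * q%:R * (q%:R * kappa * (q%:R * (2 * q%:R * dl) * `|t|))); last first.
  by rewrite /C /eta; ring.
apply: lerD.
  apply: ler_wpM2l; last exact: y0.
  apply: mulr_ge0 => //; apply: mulr_ge0 => //; exact: exprn_ge0.

by rewrite ler_wpM2l// mulr_ge0.
Unshelve. all: end_near. Qed.

End studentized_clt.

Section normalizing_matrices.
Context (R : realType) (p : nat).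
Local Notation q := p.+1.

Lemma norm_rank1 (u v : 'cV[R]_q) : `|u *m v^T| <= `|u| * `|v|.
Proof.
by apply: (le_trans (norm_mulmx _ _)); rewrite mul1r norm_trmx.
Qed.

Lemma sketched_Khat_near (H : 'M[R]_q) (c : 'cV[R]_q) (rho dl : R) :
  `|H - 1%:M| <= dl -> `|c| <= dl -> `|rho - 1| <= dl -> q%:R * dl <= 2^-1 ->
  `|(rho - (c^T *m invmx H *m c) 0 0) *: invmx H - 1%:M| <= 12 * q%:R ^+ 3 * dl.
Proof.
move=> Hd cd rd qd; have [_ H2 H1] := invmx_near1 Hd qd.
have q1 : 1 <= q%:R :> R by rewrite ler1n.
have d0 : 0 <= dl by exact: le_trans (normr_ge0 _) Hd.
have cc : `|(c^T *m invmx H *m c) 0 0| <= q%:R * dl.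
  rewrite -mulmxA; apply: (le_trans (inner_norm_le _ _)).
  apply: (@le_trans _ _ (q%:R * dl * (q%:R * 2 * dl))).
    rewrite ler_pM// ?mulr_ge0//; first by rewrite ler_wpM2l.
    apply: (le_trans (norm_mulmx _ _)).
    by rewrite ler_pM// ?mulr_ge0// ler_wpM2l.
  rewrite ler_piMr ?mulr_ge0//; lra.
set r := rho - _.
have r1 : `|r - 1| <= 2 * q%:R * dl.
  rewrite /r addrAC; apply: (le_trans (ler_normB _ _)).
  apply: (le_trans (lerD rd cc)).
  have : dl <= q%:R * dl by rewrite ler_peMl.
  lra.
rewrite (_ : r *: invmx H - 1%:M = (r - 1) *: invmx H + (invmx H - 1%:M)); last first.
  by rewrite [(r - 1) *: _]scalerBl scale1r addrA subrK.
apply: (le_trans (ler_normD _ _)).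
apply: (@le_trans _ _ (2 * q%:R * dl * 2 + 2 * q%:R * dl)).
  rewrite lerD// normrZ ler_pM//.
have : q%:R * dl <= q%:R ^+ 3 * dl by rewrite ler_wpM2r// -[leLHS]expr1 ler_weXn2l.
have : 0 <= q%:R * dl by rewrite mulr_ge0.
lra.
Qed.

Lemma partial_Khat_near (H : 'M[R]_q) (xi : 'cV[R]_q) (dl : R) :
  `|H - 1%:M| <= dl -> sqn xi = 1 -> q%:R * dl <= 2^-1 ->
  `|(xi^T *m invmx H *m xi) 0 0 *: invmx H
    + (invmx H *m xi) *m (invmx H *m xi)^T - (1%:M + xi *m xi^T)|
  <= 12 * q%:R ^+ 3 * dl.
Proof.
move=> Hd xi1 qd; have [_ H2 H1] := invmx_near1 Hd qd.
have q1 : 1 <= q%:R :> R by rewrite ler1n.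
have d0 : 0 <= dl by exact: le_trans (normr_ge0 _) Hd.
have xle : `|xi| <= 1.
  rewrite -(@ler_pXn2r _ 2)// ?nnegrE// expr1n -xi1; exact: norm_sqr_le_sqn.
set G := invmx H in H1 H2 *; set eta := G *m xi.
have he : `|eta - xi| <= 2 * q%:R ^+ 2 * dl.
  rewrite /eta -{2}[xi]mul1mx -mulmxBl; apply: (le_trans (norm_mulmx _ _)).
  apply: (@le_trans _ _ (q%:R * (2 * q%:R * dl) * 1)).
    by rewrite ler_pM// ?mulr_ge0// ler_wpM2l.
  by apply/le_of_eq; ring.
have he2 : `|eta| <= 2 * q%:R.
  apply: (le_trans (norm_mulmx _ _)).
  apply: (@le_trans _ _ (q%:R * 2 * 1)); last by rewrite mulr1 mulrC.
  by rewrite ler_pM// ?mulr_ge0// ler_wpM2l.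
have hr : `|(xi^T *m G *m xi) 0 0 - 1| <= 2 * q%:R ^+ 3 * dl.
  have -> : (xi^T *m G *m xi) 0 0 - 1 = (xi^T *m (eta - xi)) 0 0.
    by rewrite -xi1 /sqn mulmxBr mulmxA [RHS]mxE [X in _ = _ + X]mxE.
  apply: (le_trans (inner_norm_le _ _)).
  apply: (@le_trans _ _ (q%:R * 1 * (2 * q%:R ^+ 2 * dl))).
    by rewrite ler_pM// ?mulr_ge0// ler_wpM2l.
  by apply/le_of_eq; ring.
set r := (xi^T *m G *m xi) 0 0 in hr *.
have -> : r *: G + eta *m eta^T - (1%:M + xi *m xi^T) =
    (r - 1) *: G + (G - 1%:M) + ((eta - xi) *m eta^T + xi *m (eta - xi)^T).
  clearbody r eta; clearbody G.
  by apply/matrixP => i j; rewrite !mxE !big_ord1 !mxE; ring.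
apply: (le_trans (ler_normD _ _)).
have b1 : `|(r - 1) *: G + (G - 1%:M)| <= 2 * q%:R ^+ 3 * dl * 2 + 2 * q%:R * dl.
  apply: (le_trans (ler_normD _ _)); rewrite lerD// normrZ ler_pM//.
have b2 : `|(eta - xi) *m eta^T + xi *m (eta - xi)^T| <=
    2 * q%:R ^+ 2 * dl * (2 * q%:R) + 1 * (2 * q%:R ^+ 2 * dl).
  apply: (le_trans (ler_normD _ _)).
  rewrite lerD//; apply: (le_trans (norm_rank1 _ _)); rewrite ler_pM//.
apply: (le_trans (lerD b1 b2)).
have q13 : q%:R * dl <= q%:R ^+ 3 * dl by rewrite ler_wpM2r// -[leLHS]expr1 ler_weXn2l.
have q23 : q%:R ^+ 2 * dl <= q%:R ^+ 3 * dl by rewrite ler_wpM2r// ler_weXn2l.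
rewrite [leLHS](_ : _ = 8 * (q%:R ^+ 3 * dl) + 2 * (q%:R * dl) + 2 * (q%:R ^+ 2 * dl)); last by ring.
lra.
Qed.

End normalizing_matrices.

(** * Least squares in the coordinates of the singular value decomposition *)

Section reduced_least_squares.
Context (R : realType) (n q m : nat).
Variables (X U : 'M[R]_(n, q)) (W P : 'M[R]_q) (M : 'M[R]_(m, n)).
Hypotheses (XE : X = U *m P^T) (PW : P^T *m W = 1%:M).

Let WP : W^T *m P = 1%:M.
Proof. by rewrite -[P]trmxK -trmx_mul PW trmx1. Qed.

Let PWT : P *m W^T = 1%:M.
Proof. by apply: mulmx1C. Qed.

Lemma invmx_unique (A B : 'M[R]_q) : A *m B = 1%:M -> A \in unitmx /\ invmx A = B.
Proof.
move=> AB; have [uA _] := mulmx1_unit AB; split=> //.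
by rewrite -[invmx A]mulmx1 -AB mulKmx.
Qed.

Lemma gram_reduced (H := gram (M *m U)) : H \in unitmx ->
  gram (M *m X) \in unitmx /\ invmx (gram (M *m X)) = W *m invmx H *m W^T.
Proof.
move=> uH; apply: invmx_unique.
have -> : gram (M *m X) = P *m H *m P^T.
  by rewrite /H /gram XE !trmx_mul trmxK !mulmxA.
clearbody H; rewrite -!mulmxA [P^T *m _]mulmxA PW mul1mx [H *m _]mulmxA mulmxV// mul1mx.
exact: PWT.
Qed.

Variable y : 'cV[R]_n.

Lemma partial_ols_reduced : gram (M *m U) \in unitmx ->
  partial_ols M X y = W *m (invmx (gram (M *m U)) *m (U^T *m y)).
Proof.
move=> uH; have [_ E] := gram_reduced uH; rewrite /partial_ols E.
rewrite XE trmx_mul trmxK -!mulmxA; congr (_ *m (_ *m _)).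
by rewrite [LHS]mulmxA WP mul1mx.
Qed.

Lemma Sigma_partial_reduced (G := invmx (gram (M *m U))) (a := U^T *m y) :
  gram (M *m U) \in unitmx ->
  Sigma_partial M X y =
  W *m ((a^T *m G *m a) 0 0 *: G + (G *m a) *m (G *m a)^T) *m W^T.
Proof.
move=> uH; have [_ E] := gram_reduced uH.
rewrite /Sigma_partial partial_ols_reduced// E -/G -/a.
have GG : gram (M *m X) = P *m gram (M *m U) *m P^T.
  by rewrite /gram XE !trmx_mul trmxK !mulmxA.
have sG : G^T = G by rewrite /G trmx_inv /gram trmx_mul trmxK.
have -> : (W *m (G *m a))^T *m gram (M *m X) *m (W *m (G *m a)) = a^T *m G *m a.
  clear E; rewrite GG; move: uH sG; rewrite /G; clearbody a.
  move: (gram _) => H uH sG; rewrite !trmx_mul sG -!mulmxA; congr (_ *m (_ *m _)).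
  by rewrite [W^T *m _]mulmxA WP mul1mx [P^T *m _]mulmxA PW mul1mx mulKVmx.
rewrite mulmxDr mulmxDl -scalemxAr -scalemxAl; congr (_ + _).
by rewrite [in LHS]trmx_mul !mulmxA.
Qed.

End reduced_least_squares.

Section exact_least_squares.
Context (R : realType) (n p : nat).
Local Notation q := p.+1.
Variables (X U : 'M[R]_(n, q)) (W P : 'M[R]_q) (y : 'cV[R]_n).
Hypotheses (XE : X = U *m P^T) (U_orth : U^T *m U = 1%:M) (PW : P^T *m W = 1%:M).

Lemma ols_reduced : ols X y = W *m (U^T *m y).
Proof.
have uH : gram (1%:M *m U) \in unitmx by rewrite mul1mx /gram U_orth unitmx1.
have := partial_ols_reduced XE PW y uH.
by rewrite /partial_ols !mul1mx /gram U_orth invmx1 mul1mx.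
Qed.

Lemma fitted_reduced : X *m ols X y = U *m (U^T *m y).
Proof. by rewrite ols_reduced {1}XE -mulmxA [P^T *m _]mulmxA PW mul1mx. Qed.

Lemma residual_reduced : residual X y = y - U *m (U^T *m y).
Proof. by rewrite /residual fitted_reduced. Qed.

Lemma residual_orthogonal : U^T *m residual X y = 0.
Proof. by rewrite residual_reduced mulmxBr [U^T *m (U *m _)]mulmxA U_orth mul1mx subrr. Qed.

Context (m : nat).
Variable M : 'M[R]_(m, n).
Local Notation H := (gram (M *m U)).
Local Notation eps := (residual X y).

(** With [y - eps = U a], the deviation is [(H - 1) a], while the error of the
    partial sketch is [W (H^-1 - 1) a]. *)
Lemma partial_error_reduced : H \in unitmx ->
  partial_ols M X y - ols X y =
  - (W *m (invmx H *m cross_dev U (y - eps) M)).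
Proof.
move=> uH; rewrite (partial_ols_reduced XE PW)// ols_reduced.
have -> : y - eps = U *m (U^T *m y) by rewrite residual_reduced opprB addrC subrK.
move: (U^T *m y) => a; have -> : cross_dev U (U *m a) M = H *m a - a.
  by rewrite /cross_dev [U^T *m _]mulmxA U_orth mul1mx /gram !mulmxA.
by rewrite mulmxBr mulKmx// mulmxBr opprB.
Qed.

Lemma sketched_ols_reduced : H \in unitmx ->
  sketched_ols M X y =
  W *m (U^T *m y + invmx H *m ((M *m U)^T *m (M *m eps))).
Proof.
move=> uH; have [_ E] := gram_reduced XE PW uH; rewrite /sketched_ols /ols E.
rewrite -!mulmxA; congr (_ *m _).
have -> : W^T *m ((M *m X)^T *m (M *m y)) = (M *m U)^T *m (M *m y).
  rewrite XE !trmx_mul trmxK !mulmxA.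
  have -> : W^T *m P = 1%:M by rewrite -[P]trmxK -trmx_mul PW trmx1.
  by rewrite mul1mx.
have yE : y = U *m (U^T *m y) + eps by rewrite residual_reduced addrC subrK.
rewrite {1}yE !mulmxDr; congr (_ + _).
by rewrite [M *m (U *m _)]mulmxA [_^T *m (_ *m _ *m _)]mulmxA mulKmx.
Qed.

Lemma sketched_error_reduced : H \in unitmx ->
  sketched_ols M X y - ols X y = W *m (invmx H *m cross_dev U eps M).
Proof.
move=> uH; rewrite sketched_ols_reduced// ols_reduced -mulmxBr addrAC subrr add0r.
by rewrite /cross_dev residual_orthogonal subr0.
Qed.

Lemma lpow2_sqn k (v : 'cV[R]_k) : lpow 2 v = sqn v.
Proof.
rewrite sqnE /lpow; apply: eq_bigr => i _.
by rewrite big_ord1 real_normK// num_real.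
Qed.

(** The sketched residual is the projection of [M eps] orthogonally to the
    columns of [M U]. *)
Lemma Sigma_sketched_reduced (c := cross_dev U eps M) : H \in unitmx ->
  Sigma_sketched M X y =
  W *m ((sqn (M *m eps) - (c^T *m invmx H *m c) 0 0) *: invmx H) *m W^T.
Proof.
move=> uH; have [_ E] := gram_reduced XE PW uH; rewrite /Sigma_sketched E.
rewrite -scalemxAr -scalemxAl; congr (_ *: _).
rewrite lpow2_sqn.
have cE : c = (M *m U)^T *m (M *m eps).
  by rewrite /c /cross_dev residual_orthogonal subr0.
have -> : residual (M *m X) (M *m y) = M *m eps - M *m U *m (invmx H *m c).
  rewrite /residual -/(sketched_ols M X y) sketched_ols_reduced// -cE.
  have -> : M *m X *m (W *m (U^T *m y + invmx H *m c)) =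
            M *m U *m (U^T *m y) + M *m U *m (invmx H *m c).
    by rewrite XE -mulmxDr -!mulmxA [P^T *m _]mulmxA PW mul1mx.
  by rewrite opprD addrA fitted_reduced [M *m (y - _)]mulmxBr [M *m (U *m _)]mulmxA.
clearbody c; set z := M *m eps in cE *; move: cE uH E; rewrite -/z; move: z => z; set B := M *m U; move: B => B cE uH _.
set g := invmx (gram B) *m c.
have sG : (invmx (gram B))^T = invmx (gram B).
  by rewrite trmx_inv /gram trmx_mul trmxK.
have h1 : z^T *m (B *m g) = c^T *m invmx (gram B) *m c.
  by rewrite cE trmx_mul trmxK -!mulmxA /g cE.
have h2 : (B *m g)^T *m z = c^T *m invmx (gram B) *m c.
  by rewrite trmx_mul -[g^T *m _ *m _]mulmxA -cE /g trmx_mul sG.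
have h3 : (B *m g)^T *m (B *m g) = c^T *m invmx (gram B) *m c.
  rewrite trmx_mul -[g^T *m _ *m _]mulmxA [B^T *m _]mulmxA -/(gram B) /g mulKVmx//.
  by rewrite trmx_mul sG.
rewrite /sqn [(z - _)^T]linearB/= mulmxBl !mulmxBr h1 h2 h3 subrr subr0.
by rewrite mxE [X in _ + X = _]mxE.
Qed.

End exact_least_squares.

Section svd.
Context (R : realType) (n p : nat).
Local Notation q := p.+1.
Variables (X U : 'M[R]_(n, q)) (ell : 'rV[R]_q) (V : 'M[R]_q).
Hypothesis X_svd : thin_svd X U ell V.

Definition spectral_part : 'M[R]_q := V *m diag_mx ell.
Definition spectral_inv : 'M[R]_q := V *m diag_mx (\row_i (ell 0 i)^-1).
(** The largest singular value comes first, so [normalizer] stretches every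
    direction by a factor between one and the condition number. *)
Definition normalizer : 'M[R]_q := ell 0 ord0 *: spectral_inv.

Lemma svd_factor : X = U *m spectral_part^T.
Proof.
have [-> _ _ _ _] := X_svd.
by rewrite /spectral_part trmx_mul tr_diag_mx mulmxA.
Qed.

Lemma svd_inverse : spectral_part^T *m spectral_inv = 1%:M.
Proof.
have [_ _ VV _ ell_gt0] := X_svd.
rewrite /spectral_part /spectral_inv trmx_mul tr_diag_mx mulmxA.
rewrite -[_ *m _ *m V]mulmxA VV mulmx1 mulmx_diag -diag_const_mx.
congr diag_mx; apply/rowP => i; rewrite !mxE divff//.
by rewrite gt_eqF.
Qed.

Lemma normalizer_coercive (v : 'cV[R]_q) : sqn v <= sqn (normalizer^T *m v).
Proof.
have [_ _ VV ell_mono ell_gt0] := X_svd.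
have -> : sqn v = sqn (V^T *m v).
  by rewrite sqn_mulmx trmxK (mulmx1C VV) mulmx1.
rewrite /normalizer /spectral_inv linearZ/= trmx_mul tr_diag_mx -scalemxAl -mulmxA.
rewrite !sqnE; apply: ler_sum => i _.
move: (V^T *m v) => w; rewrite mxE mul_diag_mx mxE mxE mulrA exprMn ler_peMl ?sqr_ge0//.
by rewrite exprn_ege1// ler_pdivlMr// mul1r ell_mono.
Qed.

Lemma normalizer_norm (kappa : R) : ell 0 ord0 / ell 0 ord_max <= kappa ->
  `|normalizer| <= kappa.
Proof.
have [_ _ VV ell_mono ell_gt0] := X_svd => hk.
have k0 : 0 <= kappa by apply: le_trans hk; rewrite divr_ge0// ltW.
apply/mx_norm_leP => // i j.
rewrite /normalizer /spectral_inv mxE mul_mx_diag mxE [X in V i j * X]mxE.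
rewrite mulrCA normrM.
apply: (@le_trans _ _ (1 * (ell 0 ord0 / ell 0 ord_max))); last by rewrite mul1r.
rewrite ler_pM//.
- rewrite -(@ler_pXn2r _ 2)// ?nnegrE// expr1n real_normK ?num_real//.
  have <- : (V *m V^T) i i = 1 by rewrite (mulmx1C VV) mxE eqxx.
  rewrite mxE (bigD1 j)//= mxE -expr2 lerDl sumr_ge0// => k _.
  by rewrite mxE -expr2 sqr_ge0.
- rewrite ger0_norm ?divr_ge0 ?(ltW (ell_gt0 _))//.
  rewrite ler_wpM2l ?(ltW (ell_gt0 _))// lef_pV2 ?posrE//.
  by apply: ell_mono; rewrite leq_ord.
Qed.

End svd.

Section unit_part.
Context (R : realType) (n : nat).
Implicit Types v : 'cV[R]_n.

Definition len v : R := Num.sqrt (sqn v).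
Definition unit_part v : 'cV[R]_n := (len v)^-1 *: v.

Lemma len_gt0 v : v != 0 -> 0 < len v.
Proof.
move=> v0; rewrite sqrtr_gt0 lt_neqAle sqn_ge0 andbT eq_sym.
by apply: contraNneq v0 => /sqn_eq0 ->.
Qed.

Lemma unit_partK v : v != 0 -> len v *: unit_part v = v.
Proof. by move=> v0; rewrite scalerA divff ?scale1r// gt_eqF// len_gt0. Qed.

Lemma sqnZ k (a : R) (u : 'cV[R]_k) : sqn (a *: u) = a ^+ 2 * sqn u.
Proof. by rewrite !sqnE mulr_sumr; apply: eq_bigr => i _; rewrite mxE exprMn. Qed.

Lemma sqn_unit_part v : v != 0 -> sqn (unit_part v) = 1.
Proof.
move=> v0; rewrite sqnZ exprVn sqr_sqrtr ?sqn_ge0// mulVf//.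
by apply: contraNneq v0 => /sqn_eq0 ->.
Qed.

(** Normalising turns the scale-invariant flatness conditions of the theorem into
    conditions on a unit vector. *)
Lemma lpow4_unit_part v : lpow 4 (unit_part v) = lpow 4 v / lpow 2 v ^+ 2.
Proof.
rewrite lpow2_sqn /lpow mulr_suml; apply: eq_bigr => i _.
rewrite mulr_suml; apply: eq_bigr => j _; rewrite mxE normrM exprMn mulrC.
congr (_ * _); rewrite ger0_norm ?invr_ge0 ?sqrtr_ge0// exprVn.
by rewrite (exprM _ 2 2) sqr_sqrtr ?sqn_ge0.
Qed.

End unit_part.

Lemma limn_esup_bounded (R : realType) (u : nat -> R) :
  (limn_esup (fun n => (u n)%:E) < +oo)%E ->
  exists2 B : R, 0 <= B & \forall n \near \oo, u n <= B.
Proof.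
move=> /ereal_inf_lt[_ [A A_oo <-]].
set b := ereal_sup _ => b_lt; exists `|fine b| => //.
apply: filterS A_oo => n An; apply: le_trans (ler_norm _).
have ub : ((u n)%:E <= b)%E by apply: ereal_sup_ubound; exists n.
have bfin : b \is a fin_num.
  by rewrite fin_numE gt_eqF ?(lt_le_trans _ ub) ?ltNyr// lt_eqF.
by rewrite -lee_fin fineK.
Qed.

Section studentized_error.
Context (R : realType) (n p m : nat).
Local Notation q := p.+1.
Variables (X U : 'M[R]_(n, q)) (ell : 'rV[R]_q) (V : 'M[R]_q) (y : 'cV[R]_n).
Variable M : 'M[R]_(m, n).
Hypotheses (X_svd : thin_svd X U ell V) (uH : gram (M *m U) \in unitmx).

Local Notation H := (gram (M *m U)).
Local Notation N := (normalizer ell V).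
Local Notation W := (spectral_inv ell V).

(** The random parts of the two normalising matrices, after the scale of the
    data has been factored out. *)
Definition sketched_Khat (e : 'cV[R]_n) : 'M[R]_q :=
  let c := cross_dev U e M in
  (sqn (M *m e) - (c^T *m invmx H *m c) 0 0) *: invmx H.

Definition partial_Khat (e : 'cV[R]_n) : 'M[R]_q :=
  let xi := U^T *m e in
  (xi^T *m invmx H *m xi) 0 0 *: invmx H + (invmx H *m xi) *m (invmx H *m xi)^T.

Lemma cross_devZ (a : R) (e : 'cV[R]_n) : cross_dev U (a *: e) M = a *: cross_dev U e M.
Proof. by rewrite /cross_dev -!scalemxAr scalerBr. Qed.

Let U_orth : U^T *m U = 1%:M. Proof. by case: X_svd. Qed.

Let XE := svd_factor X_svd.
Let PW := svd_inverse X_svd.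

Let ell0 : ell 0 ord0 != 0. Proof. by case: X_svd => _ _ _ _ h; rewrite gt_eqF. Qed.

Lemma scaled_congruence (a : R) (K : 'M[R]_q) :
  W *m (a ^+ 2 *: K) *m W^T = (a / ell 0 ord0) ^+ 2 *: (N *m K *m N^T).
Proof.
rewrite /normalizer [(_ *: W)^T]linearZ/= -!scalemxAr -!scalemxAl !scalerA.
by congr (_ *: _); field.
Qed.

Lemma scaled_error (a b : R) (v : 'cV[R]_q) :
  b *: (W *m (invmx H *m (a *: v))) =
  (a / ell 0 ord0) *: (N *m (invmx H *m (b *: v))).
Proof.
rewrite /normalizer -!scalemxAr -scalemxAl !scalerA.
by congr (_ *: _); field.
Qed.

Lemma sketched_studentized (eps := residual X y) (e := unit_part eps) (s := len eps / ell 0 ord0) :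
  eps != 0 ->
  Sigma_sketched M X y = s ^+ 2 *: (N *m sketched_Khat e *m N^T) /\
  forall b : R, b *: (sketched_ols M X y - ols X y) =
    s *: (N *m (invmx H *m (b *: cross_dev U e M))).
Proof.
move=> eps0; have epsE : eps = len eps *: e by rewrite unit_partK.
clearbody e.
split=> [|b]; last first.
  by rewrite (sketched_error_reduced y XE U_orth PW uH) -/eps {1}epsE cross_devZ scaled_error.
rewrite (Sigma_sketched_reduced y XE U_orth PW uH) -/eps -scaled_congruence.
congr (_ *m _ *m _); rewrite {1}epsE.
have -> : cross_dev U eps M = len eps *: cross_dev U e M by rewrite {1}epsE cross_devZ.
rewrite /sketched_Khat scalerA; congr (_ *: _).
rewrite -scalemxAr sqnZ [(_ *: cross_dev _ _ _)^T]linearZ/= -!scalemxAl -scalemxAr [X in _ - X = _]mxE.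
by rewrite [X in _ - _ * X = _]mxE; ring.
Qed.

(** The error has the opposite sign to that of the full sketch, whence [- N]; the
    sign does not affect the normalising matrix. *)
Lemma partial_studentized (f := y - residual X y) (e := unit_part f) (s := len f / ell 0 ord0) :
  f != 0 ->
  Sigma_partial M X y = s ^+ 2 *: (- N *m partial_Khat e *m (- N)^T) /\
  forall b : R, b *: (partial_ols M X y - ols X y) =
    s *: (- N *m (invmx H *m (b *: cross_dev U e M))).
Proof.
move=> f0; have fE : f = len f *: e by rewrite unit_partK.
clearbody e.
split=> [|b]; last first.
  rewrite (partial_error_reduced y XE U_orth PW uH) -/f {1}fE cross_devZ scalerN.
  by rewrite scaled_error mulNmx scalerN.
have Uf : U^T *m y = len f *: (U^T *m e).
  rewrite scalemxAr -fE /f (residual_reduced y XE U_orth PW) opprB addrC subrK.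
  by rewrite [U^T *m (U *m _)]mulmxA U_orth mul1mx.
rewrite (Sigma_partial_reduced XE PW y uH) Uf.
rewrite linearN/= mulNmx mulNmx mulmxN opprK -scaled_congruence.
congr (_ *m _ *m _); rewrite /partial_Khat scalerDr scalerA.
have sq_outer (g : 'cV[R]_q) : (len f *: g) *m (len f *: g)^T = len f ^+ 2 *: (g *m g^T).
  by rewrite linearZ/= -scalemxAl -scalemxAr scalerA expr2.
rewrite -!scalemxAr sq_outer; congr (_ *: _ + _).
rewrite [(_ *: _)^T]linearZ/= -!scalemxAl scalerA -expr2.
by rewrite [LHS]mxE.
Qed.

Lemma fitted_direction (f := y - residual X y) (e := unit_part f) : f != 0 -> sqn (U^T *m e) = 1.
Proof.
move=> f0; rewrite -(sqn_unit_part f0) -/e -(sqn_isometry U_orth) mulmxA.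
congr sqn; rewrite /e /unit_part -!scalemxAr; congr (_ *: _).
rewrite /f (residual_reduced y XE U_orth PW) opprB addrC subrK.
by rewrite -mulmxA [U^T *m (U *m _)]mulmxA U_orth mul1mx.
Qed.

Lemma residual_direction : U^T *m unit_part (residual X y) = 0.
Proof.
by rewrite /unit_part -scalemxAr (residual_orthogonal y XE U_orth PW) scaler0.
Qed.

End studentized_error.

Section normalizing_matrices_near.
Context (R : realType) (n p m : nat).
Local Notation q := p.+1.
Variables (U : 'M[R]_(n, q)) (e : 'cV[R]_n) (M : 'M[R]_(m, n)) (dl : R).
Hypotheses (dl_small : dl <= 2^-1 / q%:R) (M_good : good_sketch U e dl M).

Lemma good_gram_near : `|gram (M *m U) - 1%:M| <= dl.
Proof. by case/and3P: M_good. Qed.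

Lemma small_dim : q%:R * dl <= 2^-1.
Proof. by rewrite mulrC -ler_pdivlMr// ltr0n. Qed.

Lemma good_gram_unit : gram (M *m U) \in unitmx.
Proof. by have [] := invmx_near1 good_gram_near small_dim. Qed.

Let sG : (invmx (gram (M *m U)))^T = invmx (gram (M *m U)).
Proof. by rewrite trmx_inv /gram trmx_mul trmxK. Qed.

Lemma sketched_Khat_limit : U^T *m e = 0 ->
  (sketched_Khat U M e)^T = sketched_Khat U M e /\
  `|sketched_Khat U M e - (1%:M + (U^T *m e) *m (U^T *m e)^T)| <= 12 * q%:R ^+ 3 * dl.
Proof.
move=> Ue; split; first by rewrite /sketched_Khat linearZ/= sG.
rewrite Ue mul0mx addr0; have /and3P[h1 h2 h3] := M_good.
exact: sketched_Khat_near h1 h2 h3 small_dim.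
Qed.

Lemma partial_Khat_limit : sqn (U^T *m e) = 1 ->
  (partial_Khat U M e)^T = partial_Khat U M e /\
  `|partial_Khat U M e - (1%:M + (U^T *m e) *m (U^T *m e)^T)| <= 12 * q%:R ^+ 3 * dl.
Proof.
move=> Ue; split.
  by rewrite /partial_Khat linearD/= linearZ/= sG [(_ *m _^T)^T]trmx_mul trmxK.
exact: partial_Khat_near good_gram_near Ue small_dim.
Qed.

End normalizing_matrices_near.

Theorem mainTheorem8 (R : realType) (p : nat)
    (m : nat -> nat) (zeta : nat -> nat)
    (X : forall n, 'M[R]_(n, p.+1)) (y : forall n, 'cV[R]_n)
    (U : forall n, 'M[R]_(n, p.+1)) (ell : nat -> 'rV[R]_p.+1)
    (V : nat -> 'M[R]_p.+1)
    (d : nat -> measure_display) (T : forall n, measurableType (d n))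
    (P : forall n, probability (T n) R)
    (S : forall n, {RV (P n) >-> 'M[R]_(m n, n)})
    (m_oo : m n @[n --> \oo] --> \oo)
    (m_lt : \forall n \near \oo, (m n < n)%N)
    (X_rank : \forall n \near \oo, \rank (X n) = p.+1)
    (X_svd : \forall n \near \oo, thin_svd (X n) (U n) (ell n) (V n))
    (X_cond : (limn_esup (fun n => (ell n 0 ord0 / ell n 0 ord_max)%:E)
               < +oo)%E)
    (S_sse : \forall n \near \oo, sparse_sign_embedding (zeta (m n)) (S n))
    (zeta_m : (zeta (m n))%:R ^+ 2 / (m n)%:R @[n --> \oo] --> (0 : R)) :
  ((\forall n \near \oo, residual (X n) (y n) != 0) ->
   Num.sqrt (m n)%:R / (zeta (m n))%:R * lpow 4 (U n)
     @[n --> \oo] --> (0 : R) ->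
   Num.sqrt (m n)%:R / (zeta (m n))%:R *
     (lpow 4 (residual (X n) (y n)) / lpow 2 (residual (X n) (y n)) ^+ 2)
     @[n --> \oo] --> (0 : R) ->
   (* Z n is the studentized estimator wherever it is defined, and is
      arbitrary elsewhere *)
   forall Z : forall n, {RV (P n) >-> 'cV[R]_p.+1},
   (forall n t,
      gram (S n t *m X n) \in unitmx ->
      Sigma_sketched (S n t) (X n) (y n) \in unitmx ->
      Z n t = Num.sqrt (m n)%:R *:
        (invsqrtmx (Sigma_sketched (S n t) (X n) (y n)) *m
         (sketched_ols (S n t) (X n) (y n) - ols (X n) (y n)))) ->
   cvg_in_distribution Z (std_normal R p.+1)) /\
  ((\forall n \near \oo, X n *m ols (X n) (y n) != 0) ->
   Num.sqrt (m n)%:R / (zeta (m n))%:R * lpow 4 (U n)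
     @[n --> \oo] --> (0 : R) ->
   Num.sqrt (m n)%:R / (zeta (m n))%:R *
     (lpow 4 (y n - residual (X n) (y n)) /
      lpow 2 (y n - residual (X n) (y n)) ^+ 2)
     @[n --> \oo] --> (0 : R) ->
   forall Z : forall n, {RV (P n) >-> 'cV[R]_p.+1},
   (forall n t,
      gram (S n t *m X n) \in unitmx ->
      Sigma_partial (S n t) (X n) (y n) \in unitmx ->
      Z n t = Num.sqrt (m n)%:R *:
        (invsqrtmx (Sigma_partial (S n t) (X n) (y n)) *m
         (partial_ols (S n t) (X n) (y n) - ols (X n) (y n)))) ->
   cvg_in_distribution Z (std_normal R p.+1)).
Proof.
have [kappa kappa0 hk] := limn_esup_bounded X_cond.
have C10 : 0 <= 12 * p.+1%:R ^+ 3 :> R by rewrite mulr_ge0// exprn_ge0.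
have d10 : 0 < 2^-1 / p.+1%:R :> R by rewrite divr_gt0.
have U_orth : \forall n \near \oo, (U n)^T *m U n = 1%:M.
  by apply: filterS X_svd => n [].
have ell_gt0 : \forall n \near \oo, 0 < ell n 0 ord0.
  by apply: filterS X_svd => n [].
have N_le : \forall n \near \oo, `|normalizer (ell n) (V n)| <= kappa.
  by near=> n; apply: (@normalizer_norm _ n _ (X n) (U n)); near: n.
have N_ge : \forall n \near \oo, forall v : 'cV[R]_p.+1,
    sqn v <= sqn ((normalizer (ell n) (V n))^T *m v).
  by apply: filterS X_svd => n; exact: normalizer_coercive.
split=> [eps0 U_flat e_flat Z ZE|f0 U_flat e_flat Z ZE].
  pose e n : 'cV[R]_n := unit_part (residual (X n) (y n)).
  have e_flat' : Num.sqrt (m n)%:R / (zeta (m n))%:R * lpow 4 (e n) @[n --> \oo] --> (0 : R).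
    by under eq_fun do rewrite lpow4_unit_part.
  have e_unit : \forall n \near \oo, sqn (e n) = 1.
    by apply: filterS eps0 => n; exact: sqn_unit_part.
  apply: (@studentized_clt R p m zeta U e m_oo zeta_m U_flat e_flat' d T P S Z
    S_sse U_orth e_unit (fun n => normalizer (ell n) (V n))
    (fun n => len (residual (X n) (y n)) / ell n 0 ord0)
    (fun n M => sketched_Khat (U n) M (e n)) kappa (12 * p.+1%:R ^+ 3)
    (2^-1 / p.+1%:R) kappa0 C10 d10 _ N_le N_ge) => //.
  - by near=> n; rewrite divr_gt0 ?len_gt0//; near: n.
  - near=> n => dl M dl_le M_good; apply: (sketched_Khat_limit dl_le M_good).
    by apply: (@residual_direction _ _ _ (X n) _ (ell n) (V n)); near: n.
  near=> n => x Gx uK.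
  have svd : thin_svd (X n) (U n) (ell n) (V n) by near: n.
  have eps0n : residual (X n) (y n) != 0 by near: n.
  have uH := good_gram_unit (lexx _) Gx.
  have [SE errE] := sketched_studentized svd uH eps0n.
  have [uG _] := gram_reduced (svd_factor svd) (svd_inverse svd) uH.
  have := ZE n x uG; rewrite SE => /(_ uK) ->.
  by rewrite scalemxAr errE.
pose f n : 'cV[R]_n := y n - residual (X n) (y n).
have fn0 : \forall n \near \oo, f n != 0.
  by apply: filterS f0 => n; rewrite /f /residual opprB addrC subrK.
pose e n : 'cV[R]_n := unit_part (f n).
have e_flat' : Num.sqrt (m n)%:R / (zeta (m n))%:R * lpow 4 (e n) @[n --> \oo] --> (0 : R).
  by under eq_fun do rewrite lpow4_unit_part.
have e_unit : \forall n \near \oo, sqn (e n) = 1.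
  by apply: filterS fn0 => n; exact: sqn_unit_part.
have NN_le : \forall n \near \oo, `|- normalizer (ell n) (V n)| <= kappa.
  by apply: filterS N_le => n; rewrite normrN.
have NN_ge : \forall n \near \oo, forall v : 'cV[R]_p.+1,
    sqn v <= sqn ((- normalizer (ell n) (V n))^T *m v).
  apply: filterS N_ge => n H v; rewrite linearN/= mulNmx -scaleN1r sqnZ sqrrN.
  by rewrite expr1n mul1r.
apply: (@studentized_clt R p m zeta U e m_oo zeta_m U_flat e_flat' d T P S Z
  S_sse U_orth e_unit (fun n => - normalizer (ell n) (V n))
  (fun n => len (f n) / ell n 0 ord0)
  (fun n M => partial_Khat (U n) M (e n)) kappa (12 * p.+1%:R ^+ 3)
  (2^-1 / p.+1%:R) kappa0 C10 d10 _ NN_le NN_ge) => //.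
- by near=> n; rewrite divr_gt0 ?len_gt0//; near: n.
- near=> n => dl M dl_le M_good; apply: (partial_Khat_limit dl_le M_good).
  by apply: (@fitted_direction _ _ _ (X n) _ (ell n) (V n)); near: n.
near=> n => x Gx uK.
have svd : thin_svd (X n) (U n) (ell n) (V n) by near: n.
have f0n : f n != 0 by near: n.
have uH := good_gram_unit (lexx _) Gx.
have [SE errE] := partial_studentized svd uH f0n.
have [uG _] := gram_reduced (svd_factor svd) (svd_inverse svd) uH.
have := ZE n x uG; rewrite SE => /(_ uK) ->.
by rewrite scalemxAr errE.
Unshelve. all: end_near. Qed.
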